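(* Let $u\in H\mathbb{W}^{s,G}(\Omega)\cap L^g_s(\mathbb{H}^n)$ be a weak solution of $\mathcal{L}u=0$ in $\Omega$. Let $B_{4R}(\xi_0)\subset\subset\Omega$ be any ball such that $u$ is nonnegative in $B_{4R}(\xi_0)$. Then $$ \sup_{B_R(\xi_0)}u\le C\left(\inf_{B_R(\xi_0)}u+R^sg^{-1}\left(R^s\,\mathrm{Tail}(u_-;\xi_0,R)\right)\right) $$ with a constant $C>0$ depending only on $n,p,q,s$.
   Context: $\mathbb{H}^n$ ($n\ge1$) is the Heisenberg group: $\mathbb{R}^{2n+1}$ with $\xi\circ\eta=(x_1+y_1,\dots,x_{2n}+y_{2n},\tau+\tau'+\frac12\sum_{i=1}^n(x_iy_{n+i}-x_{n+i}y_i))$ for $\xi=(x_1,\dots,x_{2n},\tau)$, $\eta=(y_1,\dots,y_{2n},\tau')$; homogeneous norm $|\xi|_{\mathbb{H}^n}=\big((\sum_{i=1}^{2n}x_i^2)^2+\tau^2\big)^{1/4}$; balls $B_r(\xi_0)=\{\xi:|\xi_0^{-1}\circ\xi|_{\mathbb{H}^n}<r\}$; $Q=2n+2$; $d\xi$ is Lebesgue measure on $\mathbb{R}^{2n+1}$. $\Omega\subset\mathbb{H}^n$ is a bounded domain, $s\in(0,1)$, and $\subset\subset$ means compactly contained. $u_-=\max\{-u,0\}$. Suprema, infima and pointwise inequalities are understood up to null sets. The function $g:[0,\infty)\to[0,\infty)$ is continuous and strictly increasing with $g(0)=0$, $\lim_{t\to\infty}g(t)=\infty$, and $G(t)=\int_0^tg(\tau)\,d\tau$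 satisfies $1<p\le \frac{tg(t)}{G(t)}\le q<\infty$ for $t>0$. $g^{-1}$ is the inverse function of $g$. Equation: $\mathcal{L}u(\xi)=\mathrm{P.V.}\int_{\mathbb{H}^n}g\Big(\frac{|u(\xi)-u(\eta)|}{|\eta^{-1}\circ\xi|^s_{\mathbb{H}^n}}\Big)\frac{u(\xi)-u(\eta)}{|u(\xi)-u(\eta)|}\frac{d\eta}{|\eta^{-1}\circ\xi|^{Q+s}_{\mathbb{H}^n}}=0$ in $\Omega$ (the integrand is $0$ where $u(\xi)=u(\eta)$). Spaces: $L^G(\Omega)=\{u \text{ measurable on }\Omega:\int_\Omega G(|u|)\,d\xi<\infty\}$. With $\mathcal{C}_\Omega=(\Omega\times\mathbb{H}^n)\cup(\mathbb{H}^n\times\Omega)$, $H\mathbb{W}^{s,G}(\Omega)$ is the set of measurable $u:\mathbb{H}^n\to\mathbb{R}$ with $u|_\Omega\in L^G(\Omega)$ and $\iint_{\mathcal{C}_\Omega}G\Big(\frac{|u(\xi)-u(\eta)|}{|\eta^{-1}\circ\xi|^s_{\mathbb{H}^n}}\Big)\frac{d\xi d\eta}{|\eta^{-1}\circ\xi|^Q_{\mathbb{H}^n}}<\infty$. $L^g_s(\mathbb{H}^n)$ is the set of measurable $u:\mathbb{H}^n\to\mathbb{R}$ with $\int_{\mathbb{H}^n}g\Big(\frac{|u(\xi)|}{(1+|\xi|_{\mathbb{H}^n})^s}\Big)\frac{d\xi}{(1+|\xi|_{\mathbb{H}^n})^{Q+s}}<\infty$. Weak solution: $u\in H\mathbb{W}^{s,G}(\Omega)$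 is a weak solution if $$\iint_{\mathcal{C}_\Omega}g\Big(\frac{|u(\xi)-u(\eta)|}{|\eta^{-1}\circ\xi|^s_{\mathbb{H}^n}}\Big)\frac{u(\xi)-u(\eta)}{|u(\xi)-u(\eta)|}(\psi(\xi)-\psi(\eta))\frac{d\xi d\eta}{|\eta^{-1}\circ\xi|^{Q+s}_{\mathbb{H}^n}}=0$$ for every $\psi\in H\mathbb{W}^{s,G}(\Omega)$ with compact support in $\Omega$. Tail: $\mathrm{Tail}(u;\xi_0,r)=\int_{\mathbb{H}^n\setminus B_r(\xi_0)}g\Big(\frac{|u(\xi)|}{|\xi_0^{-1}\circ\xi|^s_{\mathbb{H}^n}}\Big)\frac{d\xi}{|\xi_0^{-1}\circ\xi|^{Q+s}_{\mathbb{H}^n}}$. *)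

(* Defs.v *)
From HB Require Import structures.
From mathcomp Require Import all_boot all_order all_algebra.
From mathcomp Require Import all_classical all_reals all_analysis.
From mathcomp Require Import measurable_realfun ess_sup_inf.
From mathcomp Require Import ring.

Set Implicit Arguments.
Unset Strict Implicit.
Unset Printing Implicit Defensive.

Import Order.TTheory GRing.Theory Num.Theory.
Import numFieldNormedType.Exports.

Local Open Scope classical_set_scope.
Local Open Scope ring_scope.

(** * Lebesgue measure on [R^k]

The sigma-algebra on ['rV[R]_k] is generated by the coordinates, as the library
does for tuples (these are the Borel sets of [R^k]), and [lebesgue_rV k] is the
[k]-fold product of the one-dimensional Lebesgue measure; see
[lebesgue_rV_box]. *)

Definition measure_rV_display : measure_display -> measure_display.
Proof. exact. Qed.

Section measurable_rV.
Context {R : realType} {k : nat}.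

Let coors : 'I_k -> 'rV[R]_k -> R := fun i v => v ord0 i.

Let rV_set0 : g_sigma_preimage coors set0.
Proof. exact: sigma_algebra0. Qed.

Let rV_setC A : g_sigma_preimage coors A -> g_sigma_preimage coors (~` A).
Proof. exact: sigma_algebraC. Qed.

Let rV_bigcup (F : _^nat) : (forall i, g_sigma_preimage coors (F i)) ->
  g_sigma_preimage coors (\bigcup_i (F i)).
Proof. exact: sigma_algebra_bigcup. Qed.

HB.instance Definition _ := @isMeasurable.Build
  (measure_rV_display default_measure_display)
  'rV[R]_k (g_sigma_preimage coors) rV_set0 rV_setC rV_bigcup.

End measurable_rV.

Section measurable_fun_rV.
Context {R : realType}.

Lemma measurable_coord k (i : 'I_k) :
  measurable_fun [set: 'rV[R]_k] (fun v => v ord0 i).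
Proof.
move=> _ Y mY; rewrite setTI; apply: sub_sigma_algebra => /=.
rewrite -bigcup_seq/=; exists i => /=; first by rewrite mem_index_enum.
by exists Y => //; rewrite setTI.
Qed.

Lemma measurable_fun_rV d (T : measurableType d) k (f : T -> 'rV[R]_k) :
  (forall i, measurable_fun [set: T] (fun x => f x ord0 i)) ->
  measurable_fun [set: T] f.
Proof.
move=> mf _ Y mY; rewrite setTI.
have : preimage_set_system [set: T] f measurable `<=` measurable; last first.
  by apply; exists Y => //; rewrite setTI.
rewrite -/(preimage_set_system [set: T] f (g_sigma_preimage _)).
rewrite -g_sigma_preimage_comp.
apply: smallest_sub; first exact: sigma_algebra_measurable.
move=> A; rewrite -bigcup_seq => -[i _] [B mB <-].
exact: mf.
Qed.

Definition rV_cons k (z : measurableTypeR R * 'rV[R]_k) : 'rV[R]_k.+1 :=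
  row_mx (z.1%:M : 'rV[R]_1) z.2.

Definition rV_uncons k (v : 'rV[R]_k.+1) : measurableTypeR R * 'rV[R]_k :=
  (v ord0 ord0, rsubmx (v : 'rV[R]_(1 + k))).

Lemma rV_cons0 k z : @rV_cons k z ord0 ord0 = z.1.
Proof. by rewrite mxE; case: splitP => j // _; rewrite !ord1 mxE. Qed.

Lemma rV_consS k z i : @rV_cons k z ord0 (lift ord0 i) = z.2 ord0 i.
Proof.
by rewrite (_ : lift ord0 i = rshift 1 i) ?[LHS]row_mxEr//; exact: val_inj.
Qed.

Lemma rV_consK k : cancel (@rV_cons k) (@rV_uncons k).
Proof.
by move=> [x v]; rewrite /rV_uncons rV_cons0 row_mxKr.
Qed.

Lemma measurable_rV_cons k : measurable_fun setT (@rV_cons k).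
Proof.
apply: measurable_fun_rV => i.
have [j ->|j ->] := @split_ordP 1 k i.
  rewrite (_ : (fun _ => _) = fst); first exact: measurable_fst.
  by apply/funext => z; rewrite [LHS]row_mxEl !ord1 mxE.
rewrite (_ : (fun _ => _) = (fun v : 'rV[R]_k => v ord0 j) \o snd).
  exact: measurableT_comp (measurable_coord j) measurable_snd.
by apply/funext => z; rewrite [LHS]row_mxEr.
Qed.

Lemma measurable_rV_uncons k : measurable_fun setT (@rV_uncons k).
Proof.
apply: measurable_fun_pair; first exact: measurable_coord.
apply: measurable_fun_rV => i.
under eq_fun do rewrite mxE.
exact: measurable_coord.
Qed.

End measurable_fun_rV.

Section lebesgue_rV_succ.
Context {R : realType} {k : nat}.
Variable m : {sigma_finite_measure set 'rV[R]_k -> \bar R}.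

Definition lebesgue_rV_succ : set 'rV[R]_k.+1 -> \bar R :=
  pushforward (lebesgue_measure \x m)%E (@rV_cons R k).

HB.instance Definition _ := Measure.copy lebesgue_rV_succ
  (measure_function_pushforward__canonical__measure_function_Measure
    (lebesgue_measure \x m)%E (@measurable_rV_cons R k)).

Let sigma_finite_succ : sigma_finite setT lebesgue_rV_succ.
Proof.
have /sigma_finiteP[F [FT ndF Foo]] :=
  sigma_finiteT (@lebesgue_measure R).
have /sigma_finiteP[G [GT ndG Goo]] := sigma_finiteT m.
exists (fun i => @rV_uncons R k @^-1` (F i `*` G i)).
  apply/esym; rewrite -subTset => v _.
  have [i _ Fi] : (\bigcup_i F i) (rV_uncons v).1 by rewrite -FT.
  have [j _ Gj] : (\bigcup_i G i) (rV_uncons v).2 by rewrite -GT.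
  exists (maxn i j) => //; split.
    by move: Fi; apply/subsetPset/ndF/leq_maxl.
  by move: Gj; apply/subsetPset/ndG/leq_maxr.
move=> i; have [mF Fi] := Foo i; have [mG Gi] := Goo i; split.
  rewrite -[X in measurable X]setTI.
  by apply: measurable_rV_uncons => //; exact: measurableX.
rewrite /lebesgue_rV_succ /pushforward -comp_preimage.
rewrite (_ : _ @^-1` _ = F i `*` G i); last first.
  apply/funext => z.
  by rewrite -[RHS]/((F i `*` G i) z) -[in RHS](rV_consK z).
by rewrite product_measure1E// lte_mul_pinfty// ge0_fin_numE.
Qed.

HB.instance Definition _ := Measure_isSigmaFinite.Build _ _ _
  lebesgue_rV_succ sigma_finite_succ.

End lebesgue_rV_succ.

Fixpoint lebesgue_rV {R : realType} (k : nat) :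
    {sigma_finite_measure set 'rV[R]_k -> \bar R} :=
  if k is k'.+1 then lebesgue_rV_succ (lebesgue_rV k') else dirac (0 : 'rV[R]_0).

Lemma lebesgue_rV_box (R : realType) (k : nat) (A : 'I_k -> set R) :
  (forall i, measurable (A i)) ->
  lebesgue_rV k [set v : 'rV[R]_k | forall i, A i (v ord0 i)] =
  (\prod_(i < k) lebesgue_measure (A i))%E.
Proof.
elim: k A => [|k IH] A mA.
  by rewrite big_ord0 /= diracE mem_set// => -[].
rewrite big_ord_recl -IH//= /lebesgue_rV_succ /pushforward.
set B := [set v : 'rV[R]_k | forall i, A (lift ord0 i) (v ord0 i)].
have mB : measurable B.
  rewrite (_ : B = \bigcap_(i in [set: 'I_k])
      ((fun v : 'rV[R]_k => v ord0 i) @^-1` A (lift ord0 i))); last first.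
    by apply/seteqP; split => v Bv i; [move=> _|]; exact: Bv.
  apply: fin_bigcap_measurable => // i _.
  by rewrite -[X in measurable X]setTI; exact: measurable_coord.
rewrite (_ : _ @^-1` _ = A ord0 `*` B); last first.
  apply/seteqP; split => z /=.
    by move=> Az; split=> [|i]; rewrite -?rV_cons0 -?rV_consS; exact: Az.
  move=> [Az Bz] i; have [->|[j ->]] : i = ord0 \/ exists j, i = lift ord0 j.
      by case: (unliftP ord0 i) => [j|] ->; [right; exists j|left].
    by rewrite rV_cons0.
  by rewrite rV_consS; exact: Bz.
by rewrite product_measure1E//; exact: mA.
Qed.

(* [f] is measurable for the completed sigma-algebra. For such an [f >= 0], the
   library's integral, a supremum over Borel simple functions below [f], is the
   usual Lebesgue integral. *)
Definition lebesgue_measurable (R : realType) (k : nat) (f : 'rV[R]_k -> R) :=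
  forall Y : set R, measurable Y ->
    completed_algebra_gen (lebesgue_rV k) (f @^-1` Y).

(* Essential supremum and infimum over [A]. *)
Definition ess_sup_on (R : realType) (k : nat) (A : set 'rV[R]_k)
    (f : 'rV[R]_k -> R) : \bar R :=
  ess_sup (lebesgue_rV k) (patch (fun=> -oo%E) A (EFin \o f)).

Definition ess_inf_on (R : realType) (k : nat) (A : set 'rV[R]_k)
    (f : 'rV[R]_k -> R) : \bar R :=
  ess_inf (lebesgue_rV k) (patch (fun=> +oo%E) A (EFin \o f)).

Definition compactly_contained (T : topologicalType) (A B : set T) :=
  compact (closure A) /\ closure A `<=` B.

(** * The Heisenberg group *)

(* The point [(x_1, ..., x_2n, tau)]; [x_i] and [x_(n+i)] are [heis_x xi i] and
   [heis_y xi i]. *)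
Notation heis R n := 'rV[R]_(n + n + 1)%N.

Section heisenberg.
Context {R : realType} {n : nat}.
Implicit Types xi eta zeta : heis R n.

Definition heis_x xi (i : 'I_n) : R := xi ord0 (lshift 1 (lshift n i)).
Definition heis_y xi (i : 'I_n) : R := xi ord0 (lshift 1 (rshift n i)).
Definition heis_t xi : R := xi ord0 (rshift (n + n) ord0).

Definition heis_mul xi eta : heis R n :=
  row_mx (lsubmx xi + lsubmx eta)
    (heis_t xi + heis_t eta +
     2^-1 * \sum_(i < n) (heis_x xi i * heis_y eta i -
                          heis_y xi i * heis_x eta i))%:M.

Definition heis_inv xi : heis R n := - xi.

Lemma heis_lsubM xi eta : lsubmx (heis_mul xi eta) = lsubmx xi + lsubmx eta.
Proof. exact: row_mxKl. Qed.

Lemma heis_xM xi eta i : heis_x (heis_mul xi eta) i = heis_x xi i + heis_x eta i.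
Proof. by rewrite [LHS]row_mxEl !mxE. Qed.

Lemma heis_yM xi eta i : heis_y (heis_mul xi eta) i = heis_y xi i + heis_y eta i.
Proof. by rewrite [LHS]row_mxEl !mxE. Qed.

Lemma heis_tM xi eta : heis_t (heis_mul xi eta) = heis_t xi + heis_t eta +
  2^-1 * \sum_(i < n) (heis_x xi i * heis_y eta i - heis_y xi i * heis_x eta i).
Proof. by rewrite [LHS]row_mxEr mxE. Qed.

Lemma heis_mulA : associative heis_mul.
Proof.
move=> xi eta zeta; rewrite [LHS]/heis_mul [RHS]/heis_mul !heis_lsubM addrA.
congr (row_mx _ _%:M); rewrite !heis_tM !addrA -!addrA; congr (_ + _).
rewrite (addrC (2^-1 * _) (heis_t zeta + _)) -!addrA; congr (_ + (_ + _)).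
rewrite -!mulrDr -!big_split/=; congr (_ * _); apply: eq_bigr => i _.
by rewrite !heis_xM !heis_yM; ring.
Qed.

Lemma heis_mul0g xi : heis_mul 0 xi = xi.
Proof.
rewrite /heis_mul big1 => [|i _]; last first.
  by rewrite /heis_x /heis_y !mxE !mul0r subr0.
rewrite mulr0 addr0 [heis_t 0]mxE add0r [lsubmx 0]linear0 add0r.
rewrite -[RHS]hsubmxK; congr row_mx.
by apply/rowP => i; rewrite !ord1 !mxE.
Qed.

Lemma heis_mulVg xi : heis_mul (heis_inv xi) xi = 0.
Proof.
rewrite /heis_mul big1 => [|i _]; last first.
  by rewrite /heis_x /heis_y !mxE; ring.
rewrite mulr0 addr0 [heis_t (heis_inv xi)]mxE addNr [lsubmx (- xi)]linearN addNr.
by rewrite raddf0 row_mx0.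
Qed.

Definition heis_norm xi : R :=
  ((\sum_(i < n + n) xi ord0 (lshift 1 i) ^+ 2) ^+ 2 + heis_t xi ^+ 2)
    `^ (4^-1).

(* [|eta^-1 o xi|] *)
Definition heis_dist eta xi : R := heis_norm (heis_mul (heis_inv eta) xi).

Definition heis_ball xi0 (r : R) : set (heis R n) :=
  [set xi | heis_dist xi0 xi < r].

End heisenberg.

Notation heis_measure R n := (@lebesgue_rV R (n + n + 1)%N).

(* The homogeneous dimension [Q] *)
Definition heis_dim (n : nat) : nat := (2 * n + 2)%N.

(** * Growth functions *)

(* [g : [0, oo[ -> [0, oo[] is represented by a function on [R] of which only
   the values on [[0, oo[] matter. *)

Definition primitiveG (R : realType) (g : R -> R) (t : R) : R :=
  \int[lebesgue_measure]_(tau in `[0, t]) g tau.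

Record growth_function (R : realType) (p q : R) (g : R -> R) : Prop := {
  growth_continuous : {within `[0, +oo[, continuous g} ;
  growth_increasing : forall x y, 0 <= x -> x < y -> g x < g y ;
  growth0 : g 0 = 0 ;
  growth_infty : g t @[t --> +oo] --> +oo ;
  growth_p_gt1 : 1 < p ;
  growth_bounds : forall t, 0 < t -> p <= t * g t / primitiveG g t <= q
}.

Definition growth_inv (R : realType) (g : R -> R) : R -> R :=
  'pinv_(fun=> 0) `[0, +oo[ g.

(** * Function spaces, weak solutions and the tail *)

Section nonlocal.
Context {R : realType} {n : nat}.
Variables (s : R) (g : R -> R).
Implicit Types (Omega : set (heis R n)) (u psi : heis R n -> R).

Local Notation mu := (heis_measure R n).
Local Notation Q := ((heis_dim n)%:R : R).
Local Notation G := (primitiveG g).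
Local Notation d := (@heis_dist R n).

Definition bounded_domain Omega :=
  [/\ open Omega, connected Omega, Omega !=set0 &
      exists M : R, Omega `<=` heis_ball 0 M].

(* The domain of integration [C_Omega] *)
Definition crossed Omega : set (heis R n * heis R n) :=
  (Omega `*` setT) `|` (setT `*` Omega).

Definition HW Omega u : Prop :=
  [/\ lebesgue_measurable u,
      (\int[mu]_(xi in Omega) (G `|u xi|)%:E < +oo)%E &
      (\int[mu \x mu]_(z in crossed Omega)
         (G (`|u z.1 - u z.2| / d z.2 z.1 `^ s) / d z.2 z.1 `^ Q)%:E
       < +oo)%E].

Definition Lgs u : Prop :=
  lebesgue_measurable u /\
  (\int[mu]_xi (g (`|u xi| / (1 + heis_norm xi) `^ s) /
                (1 + heis_norm xi) `^ (Q + s))%:E < +oo)%E.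

(* Here [0 / 0] is [0], so the integrand vanishes where [u z.1 = u z.2]. *)
Definition weak_form Omega u psi : \bar R :=
  (\int[mu \x mu]_(z in crossed Omega)
     (g (`|u z.1 - u z.2| / d z.2 z.1 `^ s) *
      ((u z.1 - u z.2) / `|u z.1 - u z.2|) *
      (psi z.1 - psi z.2) / d z.2 z.1 `^ (Q + s))%:E)%E.

Definition weak_solution Omega u : Prop :=
  HW Omega u /\
  forall psi, HW Omega psi ->
    compactly_contained [set xi | psi xi != 0] Omega ->
    weak_form Omega u psi = 0%E.

(* For [u] in [Lgs] the tail is finite when [0 < r], so that [fine (tail u xi0 r)]
   is its value as a real number. *)
Definition tail u (xi0 : heis R n) (r : R) : \bar R :=
  (\int[mu]_(xi in ~` heis_ball xi0 r)
     (g (`|u xi| / d xi0 xi `^ s) / d xi0 xi `^ (Q + s))%:E)%E.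

End nonlocal.

(* Main.v *)
(* The proof runs on an abstract space with a measure [mu] and a metric [d]
   whose balls of radius [t] have measure comparable with [c t^Q]; everything is
   at unit scale.  Put [H t = t g(t)].

   (1) For a solution [u >= 0] on a ball and a small tail of [u_-], testing with
   [psi = (phi - u_+)_+], [phi] a bounded Lipschitz cutoff, bounds the integral of
   [g((u(y) - u(x)) / d^s) psi(x) / d^(Q+s)] over [psi(y) = 0] by a multiple of
   [mu {psi > 0}].  No Sobolev inequality is needed to exploit this: a ball
   centred at [x] and of radius a suitable power of [mu {psi > 0}] contains many
   points [y] with [psi(y) = 0], which bounds the left-hand side from below.
   De Giorgi iteration then gives [u >= m] in [B_1] once [{u < 2m}] has small
   measure in [B_2].
   (2) Testing at level [3m], and restricting [y] to [{u >= 6m}], bounds the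
   integral of [g(u_+ / (1 + |y|)^s) / (1 + |y|)^(Q+s)] by a multiple of [g(m)],
   unless [{u < 2m}] is so small that (1) gives [u >= m] in [B_1].
   (3) Symmetrically, testing with [(u - k)_+ eta^N] gives a local bound of [u]
   from above in terms of its energy and of the integral in (2); iterating it on
   the radii [2 - 2^-i], with levels that interpolate between the supremum of [u]
   and [m], gives [u <= C m] in [B_1] as soon as [m] exceeds the infimum.

   For the theorem, [d] is the distance of the Heisenberg group divided by [r],
   [g(t)] becomes [g(t / r^s)], and [u] is replaced by a Borel function that agrees
   with it outside a null set. *)
From HB Require Import structures.
Require Import Defs.
From mathcomp Require Import all_boot all_order all_algebra.
From mathcomp Require Import all_classical all_reals all_analysis.
From mathcomp Require Import measurable_realfun ess_sup_inf.
From mathcomp Require Import ring lra.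
Import Order.TTheory GRing.Theory Num.Theory.
Import numFieldNormedType.Exports.
Local Open Scope classical_set_scope.
Local Open Scope ring_scope.

Set Implicit Arguments.
Unset Strict Implicit.
Unset Printing Implicit Defensive.

(** * Growth functions *)

(** Since [g] is not homogeneous, a multiple of a solution solves a different equation and [u]
    cannot be normalized. The abstract setting is closed under rescaling instead: passing to the
    unit ball changes [d], [c] and [g] but none of [p], [q], [s], [Q], [La], and the constants of
    the iterations and of [harnack] are chosen before [d], [c], [g], [o] and [u]. Hence the final
    constant depends neither on the radius nor on [g]. Both iterations draw their smallness from one
    source. If the test function has size [h] at a point and vanishes at most points within distance
    [rho], the gain is of order [H(h / rho ^ s)], and the lower growth makes this at least of order
    [rho ^ (- s p) H(h)]. Letting [rho] shrink geometrically beats the losses caused by cutoffs and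
    levels; a small initial radius makes each step contract. The control in (2) is on [g(u)] only,
    while (3) needs [H(u) = u g(u)]. Bounding the factor [u] by its supremum costs a larger ball,
    which is why (3) is iterated with an explicit dependence on the gap between the radii. *)

Record power_growth (R : realType) (p q La : R) (g : R -> R) : Prop := {
  pg_homo : {homo g : x y / x <= y} ;
  pg_eq0 : forall t, t <= 0 -> g t = 0 ;
  pg_gt0 : forall t, 0 < t -> 0 < g t ;
  pg_upper : forall l t, 1 <= l -> 0 <= t ->
    g (l * t) <= La * l `^ (q - 1) * g t ;
  pg_lower : forall l t, 1 <= l -> 0 <= t ->
    l `^ (p - 1) * g t <= La * g (l * t)
}.

Ltac nneg := lazymatch goal with
  | |- is_true (@Order.le _ _ _ ?b) => lazymatch b with
    | @GRing.mul _ _ _ => apply: mulr_ge0; nneg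
    | @Algebra.add _ _ _ => apply: addr_ge0; nneg
    | @powR _ _ _ => exact: powR_ge0
    | @GRing.exp _ _ _ => apply: exprn_ge0; nneg
    | @GRing.inv _ _ => rewrite invr_ge0; nneg
    | _ => try first [done | by apply: ltW]
    end
  end.

Lemma maxr0_lip (R : realDomainType) (a b : R) :
  `|Num.max a 0 - Num.max b 0| <= `|a - b|.
Proof.
wlog ab : a b / a <= b.
  by move=> W; have [/W//|/ltW/W] := leP a b; rewrite distrC [leRHS]distrC.
rewrite !ler0_norm ?subr_le0 ?ge_max ?le_max ?ab ?lexx ?orbT//.
by have [?|?] := leP a 0; have [?|?] := leP b 0; rewrite ?(max_l, max_r)//; lra.
Qed.

Section power_growth.
Context {R : realType} (p q s Q La : R) (g : R -> R).
Hypotheses (p1 : 1 < p) (pq : p <= q) (s01 : 0 < s < 1) (Q0 : 0 < Q).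
Hypotheses (La1 : 1 <= La) (gG : power_growth p q La g).

(** Stands in for the primitive [G], with which it is comparable by [primitiveG_bounds]; the flux of
    a function against its own differences is exactly an energy density in this sense, see
    [energy_kernE]. *)
Definition energy (g : R -> R) (t : R) : R := t * g t.

Local Notation H := (energy g).

Let La0 : 0 < La. Proof. exact: lt_le_trans La1. Qed.
Let p0 : 0 < p. Proof. exact: lt_trans p1. Qed.
Let q1 : 1 < q. Proof. exact: lt_le_trans pq. Qed.
Let q0 : 0 < q. Proof. exact: lt_trans q1. Qed.

Lemma pg_ge0 t : 0 <= g t.
Proof.
have [t0|t0] := leP t 0; first by rewrite (pg_eq0 gG).
exact/ltW/(pg_gt0 gG).
Qed.

Lemma pg0 : g 0 = 0. Proof. exact: pg_eq0 gG _ _. Qed.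

Lemma energy_ge0 t : 0 <= H t.
Proof.
rewrite /energy; have [t0|t0] := leP t 0; first by rewrite (pg_eq0 gG)// mulr0.
by rewrite mulr_ge0// ?pg_ge0// ltW.
Qed.

Lemma energy_gt0 t : 0 < t -> 0 < H t.
Proof. by move=> t0; rewrite mulr_gt0// (pg_gt0 gG). Qed.

Lemma energy0 : H 0 = 0. Proof. by rewrite /energy mul0r. Qed.

Lemma energy_homo : {homo H : x y / x <= y}.
Proof.
move=> x y xy; have [x0|x0] := leP x 0.
  by rewrite {1}/energy (pg_eq0 gG)// mulr0 energy_ge0.
exact: ler_pM (ltW x0) (pg_ge0 _) xy (pg_homo gG xy).
Qed.

Lemma pg_small b t : 0 <= b <= 1 -> 0 <= t -> g (b * t) <= La * b `^ (p - 1) * g t.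
Proof.
move=> /andP[b0 b1] t0; have [->|bn0] := eqVneq b 0.
  by rewrite mul0r pg0 !mulr_ge0 ?powR_ge0 ?pg_ge0// ltW.
have {}b0 : 0 < b by rewrite lt_neqAle eq_sym bn0.
have := @pg_lower _ _ _ _ _ gG b^-1 (b * t).
rewrite invf_ge1// mulKf// => /(_ b1 (mulr_ge0 (ltW b0) t0)) bt.
have c0 : 0 < b `^ (p - 1) by rewrite powR_gt0.
move: bt; rewrite -powR_inv1 ?(ltW b0)// -powRrM mulN1r powRN => bt.
by rewrite mulrAC -ler_pdivrMr// mulrC.
Qed.

Lemma energy_upper l t : 1 <= l -> 0 <= t -> H (l * t) <= La * l `^ q * H t.
Proof.
move=> l1 t0; have l0 : 0 <= l by rewrite (le_trans ler01).
rewrite /energy -(mulr_powRB1 l0 q0).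
have := pg_upper gG l1 t0; move/(ler_wpM2l (mulr_ge0 l0 t0))/le_trans; apply.
by rewrite le_eqVlt; apply/orP; left; apply/eqP; ring.
Qed.

Lemma energy_lower l t : 1 <= l -> 0 <= t -> l `^ p * H t <= La * H (l * t).
Proof.
move=> l1 t0; have l0 : 0 <= l by rewrite (le_trans ler01).
rewrite /energy -(mulr_powRB1 l0 p0).
have := pg_lower gG l1 t0; move/(ler_wpM2l (mulr_ge0 l0 t0)) => h.
by apply: le_trans (le_trans _ h) _; rewrite le_eqVlt; apply/orP; left; apply/eqP; ring.
Qed.

Lemma energy_small b t : 0 <= b <= 1 -> 0 <= t -> H (b * t) <= La * b `^ p * H t.
Proof.
move=> b01 t0; have /andP[b0 b1] := b01.
rewrite /energy -(mulr_powRB1 b0 p0).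
have := pg_small b01 t0; move/(ler_wpM2l (mulr_ge0 b0 t0))/le_trans; apply.
by rewrite le_eqVlt; apply/orP; left; apply/eqP; ring.
Qed.

(** The sum is at most twice the larger term, so monotonicity and doubling do the work of
    convexity. *)
Lemma energy_add a b : 0 <= a -> 0 <= b ->
  H (a + b) <= La * 2 `^ q * (H a + H b).
Proof.
move=> a0 b0; wlog ab : a b a0 b0 / a <= b.
  by move=> W; have [/W|/ltW/W] := leP a b; [|rewrite addrC [H a + _]addrC]; apply.
have /energy_homo/le_trans -> // : a + b <= 2 * b by lra.
apply: le_trans (energy_upper _ b0) _; first by rewrite ler1n.
by rewrite ler_wpM2l ?mulr_ge0 ?powR_ge0 ?(ltW La0)// lerDr energy_ge0.
Qed.

Lemma pg_add a b : 0 <= a -> 0 <= b ->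
  g (a + b) <= La * 2 `^ q * (g a + g b).
Proof.
move=> a0 b0; wlog ab : a b a0 b0 / a <= b.
  by move=> W; have [/W|/ltW/W] := leP a b; [|rewrite addrC [g a + _]addrC]; apply.
have /(pg_homo gG)/le_trans -> // : a + b <= 2 * b by lra.
apply: le_trans (pg_upper gG _ b0) _; first by rewrite ler1n.
rewrite ler_pM ?mulr_ge0 ?powR_ge0 ?pg_ge0 ?(ltW La0)//; last first.
  by rewrite lerDr pg_ge0.
by rewrite ler_pM2l// ler_powR ?ler1n// gerBl.
Qed.

(* Up to a constant, the energy density at distance [d] of a function that is
   bounded by [1] and Lipschitz; see [energy_kern]. *)
Definition kern (d : R) : R :=
  if d < 1 then d `^ ((1 - s) * p - Q) else d `^ (- (s * p + Q)).

Lemma kern_ge0 d : 0 <= kern d.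
Proof. by rewrite /kern; case: ifP; rewrite powR_ge0. Qed.

(** For [d < 1] the Lipschitz bound gives [D / d ^ s <= L d ^ (1 - s) M], and [energy_small]
    extracts the power [(1 - s) p]; for [d >= 1] the bound [D <= M] and the factor [d ^ (- s)] give
    the power [- s p]. *)
Lemma energy_kern M L D d : 0 <= M -> 1 <= L -> 0 <= d ->
  0 <= D <= M -> D <= M * (L * d) ->
  H (D / d `^ s) / d `^ Q <= La ^+ 2 * L `^ q * H M * kern d.
Proof.
move=> M0 L1 d0 /andP[D0 DM] DL; have /andP[s0 s1] := s01.
have C0 : 0 <= La ^+ 2 * L `^ q * H M.
  by rewrite mulr_ge0 ?energy_ge0// mulr_ge0 ?powR_ge0 ?exprn_ge0 ?(ltW La0).
have [dE|dn0] := eqVneq d 0.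
  have -> : D = 0 by apply/eqP; rewrite eq_le D0 andbT; move: DL; rewrite dE !mulr0.
  by rewrite mul0r energy0 mul0r mulr_ge0 ?kern_ge0.
have {}d0 : 0 < d by rewrite lt_neqAle eq_sym dn0.
rewrite ler_pdivrMr ?powR_gt0//.
rewrite /kern; case: ifPn => [d1|]; [|rewrite -leNgt => d1].
  rewrite -[leRHS]mulrA -powRD ?dn0 ?implybT// subrK powRrM.
  have -> : La ^+ 2 * L `^ q * H M * d `^ (1 - s) `^ p =
     La * L `^ q * (La * (d `^ (1 - s)) `^ p * H M) by ring.
  have ds : 0 <= d `^ (1 - s) <= 1.
    rewrite powR_ge0 -[leRHS](powRr0 d) ger_powR ?d0 ?ltW//; lra.
  apply: le_trans (_ : La * L `^ q * H (d `^ (1 - s) * M) <= _); last first.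
    by rewrite ler_wpM2l ?energy_small// mulr_ge0 ?powR_ge0// ltW.
  apply: le_trans (energy_upper L1 _); last by rewrite mulr_ge0 ?powR_ge0.
  apply: energy_homo; rewrite ler_pdivrMr ?powR_gt0//.
  rewrite (_ : L * _ * _ = M * (L * (d `^ (1 - s) * d `^ s))); last by ring.
  by rewrite -powRD ?dn0 ?implybT// subrK powRr1// ltW.
rewrite -[leRHS]mulrA -powRD ?dn0 ?implybT// opprD addrNK -mulNr powRrM.
have Lq : 1 <= L `^ q by rewrite -[leLHS](powRr0 L) ler_powR// ltW.
apply: le_trans (_ : La * (d `^ (- s)) `^ p * H M <= _); last first.
  rewrite [leRHS]mulrAC ler_wpM2r ?energy_ge0// ler_wpM2r ?powR_ge0//.
  by rewrite expr2 -mulrA ler_peMr ?(ltW La0) ?mulr_ege1.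
have ds : 0 <= d `^ (- s) <= 1.
  by rewrite powR_ge0 -[leRHS](powRr0 d) ler_powR// oppr_le0 ltW.
apply: le_trans (energy_small ds M0); apply: energy_homo.
by rewrite powRN mulrC ler_wpM2l// invr_ge0 powR_ge0.
Qed.

(* Moving the base point of the tail costs a power of the ratio [l] of the
   distances. *)
Lemma tail_kern_comp v d e l : 0 <= v -> 1 <= l -> 0 < d -> 0 < e -> e <= l * d ->
  g (v / d `^ s) / d `^ (Q + s) <=
  La * l `^ (s * (q - 1) + (Q + s)) * (g (v / e `^ s) / e `^ (Q + s)).
Proof.
move=> v0 l1 d0 e0 eld; have /andP[s0 s1] := s01.
have l0 : 0 < l by exact: lt_le_trans l1.
have ed a : 0 <= a -> (d `^ a)^-1 <= l `^ a * (e `^ a)^-1.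
  move=> a0; rewrite ler_pdivlMr ?powR_gt0// ler_pdivrMl ?powR_gt0//.
  rewrite -powRM ?(ltW l0) ?(ltW d0)// ge0_ler_powR// ?nnegrE ?(ltW e0)//.
    by rewrite mulr_ge0 ?ltW.
  by rewrite (mulrC d).
have h1 : g (v / d `^ s) <= La * (l `^ s) `^ (q - 1) * g (v / e `^ s).
  apply: le_trans (pg_upper gG _ _); last 2 first.
    by rewrite -[leLHS](powRr0 l) ler_powR// ltW.
    by rewrite divr_ge0 ?powR_ge0.
  by apply: (pg_homo gG); rewrite mulrCA ler_wpM2l// ed// ltW.
have h2 : (d `^ (Q + s))^-1 <= l `^ (Q + s) * (e `^ (Q + s))^-1.
  by rewrite ed// addr_ge0 ?ltW.
apply: le_trans (ler_pM _ _ h1 h2) _; rewrite ?pg_ge0 ?invr_ge0 ?powR_ge0//.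
rewrite -powRrM [l `^ (_ + (_ + _))]powRD ?(gt_eqF l0) ?implybT// le_eqVlt; apply/orP; left; apply/eqP; ring.
Qed.

(** Lower power growth starting from [t = 1]. In [harnack] it provides a level high enough for a
    first bound of the solution, from the bare finiteness of its energy. *)
Lemma pg_unbounded (c : R) : exists2 t, 0 < t & c <= g t.
Proof.
have g1 : 0 < g 1 by exact: pg_gt0 gG _ _.
set a := Num.max 1 (La * c / g 1).
exists (a `^ (p - 1)^-1); first by rewrite powR_gt0// lt_max ltr01.
have a1 : 1 <= a by rewrite le_max lexx.
have l1 : 1 <= a `^ (p - 1)^-1.
  by rewrite -[leLHS](powRr0 a) ler_powR// invr_ge0 subr_ge0 ltW.
have := pg_lower gG l1 (@ler01 R).
rewrite mulr1 -powRrM mulVf ?subr_eq0 ?gt_eqF// powRr1 ?(le_trans ler01)//.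
have : La * c / g 1 <= a by rewrite le_max lexx orbT.
rewrite ler_pdivrMr// => /le_trans h /h.
by rewrite ler_pM2l.
Qed.

Lemma measurable_pg : measurable_fun [set: R] g.
Proof. by apply: nondecreasing_measurable => //; exact: pg_homo gG. Qed.

Lemma measurable_energy : measurable_fun [set: R] H.
Proof. by apply: nondecreasing_measurable => //; exact: energy_homo. Qed.

Lemma measurable_kern : measurable_fun [set: R] kern.
Proof.
apply: measurable_fun_ifT; first exact: measurable_fun_ltr.
all: exact: measurable_powR.
Qed.

End power_growth.

(** * Integrals of nonnegative functions *)

Section nonneg_integral.
Context {R : realType} {dT : measure_display} {T : measurableType dT}.
Variable mu : {measure set T -> \bar R}.
Implicit Types f h : T -> R.

(** All integrals run over the whole space; a domain of integration is written as an [if] in the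
    integrand. *)
Definition nint f : \bar R := \int[mu]_x (f x)%:E.

Lemma nint_ge0 f : (forall x, 0 <= f x) -> (0 <= nint f)%E.
Proof. by move=> f0; apply: integral_ge0 => x _; rewrite lee_fin. Qed.

Lemma le_nint f h : measurable_fun setT f -> measurable_fun setT h ->
  (forall x, 0 <= f x) -> (forall x, f x <= h x) -> (nint f <= nint h)%E.
Proof.
move=> mf mh f0 fh; apply: ge0_le_integral => //.
- by move=> x _; rewrite lee_fin.
- exact/measurable_EFinP.
- exact/measurable_EFinP.
- by move=> x _; rewrite lee_fin.
Qed.

Lemma nintD f h : measurable_fun setT f -> measurable_fun setT h ->
  (forall x, 0 <= f x) -> (forall x, 0 <= h x) ->
  nint (fun x => f x + h x) = (nint f + nint h)%E.
Proof.
move=> mf mh f0 h0; rewrite /nint -ge0_integralD//.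
- by move=> x _; rewrite lee_fin.
- exact/measurable_EFinP.
- by move=> x _; rewrite lee_fin.
- exact/measurable_EFinP.
Qed.

Lemma nintZ k f : measurable_fun setT f -> 0 <= k -> (forall x, 0 <= f x) ->
  nint (fun x => k * f x) = (k%:E * nint f)%E.
Proof.
move=> mf k0 f0; rewrite /nint -ge0_integralZl//.
- exact/measurable_EFinP.
- by move=> x _; rewrite lee_fin.
Qed.

Lemma nint_if (b : T -> bool) : measurable_fun setT b ->
  nint (fun x => if b x then 1 else 0) = mu [set x | b x].
Proof.
move=> mb; have mA : measurable [set x | b x].
  have := mb measurableT [set true] I.
  by rewrite setTI; congr measurable; apply/seteqP; split => x /=; case: (b x).
rewrite -[in RHS](setIT [set x | b x]) -integral_indic//; apply: eq_integral => x _.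
rewrite indicE; congr (_%:E); case: ifPn => bx; first by rewrite mem_set.
by rewrite memNset//; exact/negP.
Qed.

Lemma nint_if_cst (b : T -> bool) k : measurable_fun setT b -> 0 <= k ->
  nint (fun x => if b x then k else 0) = (k%:E * mu [set x | b x])%E.
Proof.
move=> mb k0; rewrite -nint_if// -nintZ//.
- by congr nint; apply/funext => x; case: ifP; rewrite ?mulr1 ?mulr0.
- exact: measurable_fun_ifT.
- by move=> x; case: ifP.
Qed.

Lemma measurable_pred (b : T -> bool) : measurable_fun setT b ->
  measurable [set x | b x].
Proof.
move=> mb; have := mb measurableT [set true] I.
by rewrite setTI; congr measurable; apply/seteqP; split => x /=; case: (b x).
Qed.

(** Dyadic decomposition: at each point one term of the series already dominates [f], and the others
    are nonnegative. *)
Lemma nint_series (F : nat -> T -> R) f (a : nat -> R) K :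
  (forall i, measurable_fun setT (F i)) -> measurable_fun setT f ->
  (forall i x, 0 <= F i x) -> (forall x, 0 <= f x) ->
  (forall x, exists i, f x <= F i x) ->
  (forall i, (nint (F i) <= (a i)%:E)%E) ->
  (forall n, \sum_(i < n) a i <= K) -> (nint f <= K%:E)%E.
Proof.
move=> mF mf F0 f0 fF Fa aK.
apply: (@le_trans _ _ (\int[mu]_x \sum_(i <oo) (F i x)%:E)%E).
  apply: ge0_le_integral => //.
  - by move=> x _; rewrite lee_fin.
  - exact/measurable_EFinP.
  - apply: ge0_emeasurable_sum => // i; first by move=> x _; rewrite lee_fin.
    by move=> _; exact/measurable_EFinP.
  - move=> x _; have [i fi] := fF x.
    apply: le_trans (nneseries_lim_ge i.+1 _); last by move=> *; rewrite lee_fin.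
    rewrite big_mkord big_ord_recr/= -[leLHS]add0e leeD ?lee_fin//.
    by apply: sume_ge0 => j _; rewrite lee_fin.
rewrite integral_nneseries//; last 2 first.
- by move=> i; exact/measurable_EFinP.
- by move=> i x _; rewrite lee_fin.
apply: lime_le.
  by apply: is_cvg_nneseries => i _ _; exact: nint_ge0.
apply: nearW => n; apply: (@le_trans _ _ (\sum_(0 <= i < n) (a i)%:E)%E).
  by apply: lee_sum => i _; exact: Fa.
by rewrite sumEFin lee_fin big_mkord.
Qed.

End nonneg_integral.

(** * Tonelli's theorem for functions of two points *)

Section iterated.
Context {R : realType} {dT : measure_display} {T : measurableType dT}.
Variable mu : {sigma_finite_measure set T -> \bar R}.
Implicit Types f : T * T -> R.

Lemma nint_swap f : measurable_fun setT f -> (forall z, 0 <= f z) ->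
  nint (mu \x mu)%E (fun z => f (z.2, z.1)) = nint (mu \x mu)%E f.
Proof.
move=> mf f0; rewrite /nint (fubini_tonelli1 (fun z => (f z)%:E))//; last exact/measurable_EFinP.
rewrite (fubini_tonelli2 (fun z => (f (z.2, z.1))%:E))//.
- apply/measurable_EFinP.
  exact: measurableT_comp mf (measurable_fun_pair measurable_snd measurable_fst).
- by move=> z; rewrite lee_fin.
Qed.

Lemma nint2_le f (h : T -> R) : measurable_fun setT f -> measurable_fun setT h ->
  (forall z, 0 <= f z) ->
  (forall x, (nint mu (fun y => f (x, y)) <= (h x)%:E)%E) ->
  (nint (mu \x mu)%E f <= nint mu h)%E.
Proof.
move=> mf mh f0 fh; rewrite /nint (fubini_tonelli1 (fun z => (f z)%:E))//; last exact/measurable_EFinP.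
apply: ge0_le_integral => //.
- by move=> x _; apply: integral_ge0 => y _; rewrite lee_fin.
- apply: (measurable_fun_fubini_tonelli_F (fun z => (f z)%:E)).
  + exact/measurable_EFinP.
  + by move=> z; rewrite lee_fin.
- exact/measurable_EFinP.
- by move=> x _; exact: fh.
Qed.

Lemma nint2_ge f (h : T -> R) : measurable_fun setT f -> measurable_fun setT h ->
  (forall z, 0 <= f z) -> (forall x, 0 <= h x) ->
  (forall x, ((h x)%:E <= nint mu (fun y => f (x, y)))%E) ->
  (nint mu h <= nint (mu \x mu)%E f)%E.
Proof.
move=> mf mh f0 h0 fh.
rewrite /nint (fubini_tonelli1 (fun z => (f z)%:E))//; last exact/measurable_EFinP.
apply: ge0_le_integral => //.
- by move=> x _; rewrite lee_fin.
- exact/measurable_EFinP.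
- apply: (measurable_fun_fubini_tonelli_F (fun z => (f z)%:E)).
  + exact/measurable_EFinP.
  + by move=> z; rewrite lee_fin.
Qed.

End iterated.

(** * Metrics with balls of measure comparable to [c t ^ Q], and the integral of the kernel *)

Section regular.
Context {R : realType} {dX : measure_display} {X : measurableType dX}.
Variables (mu : {sigma_finite_measure set X -> \bar R}) (Q La : R).

(** The factor [c] carries the scale, so that dividing the metric by a radius changes [c] alone;
    estimates depend on the geometry only through [Q] and the ratio [La] of the two bounds. *)
Record regular_metric (d : X -> X -> R) (c : R) : Prop := {
  rm_ge0 : forall x y, 0 <= d x y ;
  rm_eq0 : forall x y, d x y = 0 -> x = y ;
  rm_sym : forall x y, d x y = d y x ;
  rm_triangle : forall x y z, d x z <= d x y + d y z ;
  rm_measurable : measurable_fun setT (fun z : X * X => d z.1 z.2) ;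
  rm_gt0 : 0 < c ;
  rm_ball_ge : forall x r, 0 < r ->
    ((c * r `^ Q)%:E <= mu [set y | (d x y < r)%R])%E ;
  rm_ball_le : forall x r, 0 < r ->
    (mu [set y | (d x y < r)%R] <= (La * c * r `^ Q)%:E)%E
}.

Lemma regular_dist1 d c x : regular_metric d c ->
  measurable_fun setT (fun y => d x y).
Proof.
move=> dc; exact: measurableT_comp (rm_measurable dc) (measurable_pair1 x).
Qed.

Lemma powRV (x a : R) : 0 <= x -> x^-1 `^ a = (x `^ a)^-1.
Proof. by move=> x0; rewrite -powR_inv1// powRAC powR_inv1 ?powR_ge0. Qed.

Lemma geometric_le (a : R) n : 0 <= a < 1 -> \sum_(i < n) a ^+ i <= (1 - a)^-1.
Proof.
move=> /andP[a0 a1]; have a1' : 0 < 1 - a by rewrite subr_gt0.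
rewrite -[leRHS]mul1r ler_pdivlMr// mulrC -[X in X * _]opprB mulNr -subrX1 opprB.
by rewrite gerBl exprn_ge0.
Qed.

Lemma dyadic_large (d : R) : 1 <= d -> exists i, 2 ^+ i <= d < 2 ^+ i.+1.
Proof.
move=> d1; have ex : exists i, d < 2 ^+ i.+1.
  exists (Num.truncn d); apply: lt_trans (_ : (Num.truncn d).+1%:R < _).
    by rewrite real_truncnS_gt// num_real.
  by rewrite -natrX ltr_nat ltn_expl.
have := ex_minnP ex; case=> i di mini; exists i; rewrite di andbT.
case: i di mini => [|i] di mini; first by rewrite expr0.
by rewrite leNgt; apply/negP => /mini; rewrite ltnn.
Qed.

Variables (p s : R).
Hypotheses (p1 : 1 < p) (s01 : 0 < s < 1) (Q0 : 0 < Q) (La1 : 1 <= La).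

Local Notation kern := (kern p s Q).

(** The witness is the dyadic scale of [d]: [2 ^ (- i - 1) < d <= 2 ^ (- i)] uses the first summand,
    [2 ^ i <= d < 2 ^ (i + 1)] the second. The radius [2 / 2 ^ i] in the first is doubled to allow a
    strict inequality. *)
Lemma kern_dyadic (d : R) (A := 2 `^ (- ((1 - s) * p))) (B := 2 `^ (- (s * p)))
    (Z := 2 `^ Q) : 0 <= d -> exists i,
  kern d <= (if d < 2 / 2 ^+ i then Z * (A * Z) ^+ i else 0) +
            (if d < 2 ^+ i.+1 then (B / Z) ^+ i else 0).
Proof.
have /andP[s0 s1] := s01.
have p0 : 0 < p by rewrite (lt_trans ltr01).
have Z1 : 1 <= Z by rewrite -[leLHS](powRr0 2) ler_powR ?ler1n// ltW.
have Z0 : 0 < Z by rewrite (lt_le_trans ltr01).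
have A0 : 0 <= A by rewrite powR_ge0.
have B0 : 0 <= B by rewrite powR_ge0.
have pw (i : nat) x : 2 `^ x ^+ i = (2 ^+ i) `^ x :> R.
  by rewrite -powR_mulrn ?powR_ge0// -powRrM mulrC powRrM powR_mulrn.
move=> d0; have [->|dn0] := eqVneq d 0.
  (* At distance [0] the kernel takes the conventional value of a power of [0], which is [0] or
     [1]. *)
  exists 0%N; rewrite !expr0 !divr1 expr1 ltr0n/= /kern ltr01.
  rewrite mulr1 /powR eqxx (le_trans (_ : _ <= 1))// ?ler_wpDr//.
  by case: (_ == _).
have {}d0 : 0 < d by rewrite lt_neqAle eq_sym dn0.
have [d1|d1] := ltP d 1.
  have /dyadic_large[i /andP[id di]] : 1 <= d^-1 by rewrite invf_ge1// ltW.
  exists i; rewrite /kern d1.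
  have di1 : d <= (2 ^+ i)^-1 by rewrite -[d]invrK lef_pV2 ?posrE ?invr_gt0 ?exprn_gt0.
  have di2 : d^-1 <= 2 ^+ i.+1 by rewrite ltW.
  rewrite ifT; last first.
    by rewrite (le_lt_trans di1)// ltr_pMl ?ltr1n// invr_gt0 exprn_gt0.
  rewrite ler_wpDr//; first by case: ifP => // _; rewrite exprn_ge0// divr_ge0// ltW.
  rewrite powRD ?dn0 ?implybT// exprMn mulrCA -exprS pw pw.
  apply: ler_pM; rewrite ?powR_ge0//.
    rewrite powRN -powRV ?exprn_ge0// ge0_ler_powR ?nnegrE ?invr_ge0 ?exprn_ge0 ?(ltW d0)//.
    by rewrite mulr_ge0 ?subr_ge0// ltW.
  rewrite powRN -powRV ?(ltW d0)// ge0_ler_powR ?nnegrE ?invr_ge0 ?exprn_ge0 ?(ltW d0)//.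
  exact: ltW.
have [i /andP[id di]] := dyadic_large d1; exists i.
rewrite /kern ltNge d1/= di ler_wpDl//.
  by case: ifP => // _; rewrite mulr_ge0 ?exprn_ge0 ?mulr_ge0// ltW.
rewrite -powRN -powRD ?pnatr_eq0 ?implybT// pw -opprD !powRN lef_pV2 ?posrE ?powR_gt0 ?exprn_gt0//.
by rewrite ge0_ler_powR ?nnegrE ?exprn_ge0 ?(ltW d0)// addr_ge0 ?mulr_ge0 ?ltW.
Qed.

(** The measure of the ball at scale [i] cancels the powers of [Z] in [kern_dyadic], leaving
    [A ^ i + B ^ i]. The series converges near the centre because [s < 1] and at infinity because
    [s > 0]. *)
Lemma kern_integral : exists2 C, 0 < C & forall d c, regular_metric d c ->
  forall x, (nint mu (fun y => kern (d x y)) <= (C * c)%:E)%E.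
Proof.
have /andP[s0 s1] := s01.
have p0 : 0 < p by rewrite (lt_trans ltr01).
set A := 2 `^ (- ((1 - s) * p)); set B := 2 `^ (- (s * p)); set Z := 2 `^ Q.
have Z0 : 0 < Z by rewrite powR_gt0.
have lt1 (x : R) : 0 < x -> 0 <= 2 `^ (- x) < 1.
  move=> x0; rewrite powR_ge0/= powRN invf_lt1 ?powR_gt0//.
  by have := gt0_ltr_powR x0 _ _ (ltr1n R 2); rewrite powR1; apply; rewrite nnegrE.
have A01 : 0 <= A < 1 by rewrite lt1// mulr_gt0// subr_gt0.
have B01 : 0 <= B < 1 by rewrite lt1// mulr_gt0.
have /andP[A0 A1] := A01; have /andP[B0 B1] := B01.
have AB0 : 0 < (1 - A)^-1 + (1 - B)^-1 by rewrite addr_gt0 ?invr_gt0 ?subr_gt0.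
have La0 : 0 < La by rewrite (lt_le_trans ltr01).
have pw (i : nat) x : 2 `^ x ^+ i = (2 ^+ i) `^ x :> R.
  by rewrite -powR_mulrn ?powR_ge0// -powRrM mulrC powRrM powR_mulrn.
exists (La * Z ^+ 2 * ((1 - A)^-1 + (1 - B)^-1)).
  by rewrite !mulr_gt0// exprn_gt0.
move=> d c dc x; have md := regular_dist1 x dc; have c0 := rm_gt0 dc.
pose F i y := (if d x y < 2 / 2 ^+ i then Z * (A * Z) ^+ i else 0) +
            (if d x y < 2 ^+ i.+1 then (B / Z) ^+ i else 0).
have F10 i : 0 <= Z * (A * Z) ^+ i by rewrite mulr_ge0 ?exprn_ge0 ?mulr_ge0// ltW.
have F20 i : 0 <= (B / Z) ^+ i by rewrite exprn_ge0 ?divr_ge0// ltW.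
have mb (r : R) : measurable_fun setT (fun y => d x y < r).
  exact: measurable_fun_ltr.
apply: (@nint_series _ _ _ _ F _ (fun i => La * c * Z ^+ 2 * (A ^+ i + B ^+ i))).
- by move=> i; apply: measurable_funD; apply: measurable_fun_ifT.
- by apply: measurableT_comp md; exact: measurable_kern.
- by move=> i y; rewrite addr_ge0//; case: ifP.
- by move=> y; rewrite kern_ge0.
- by move=> y; apply: kern_dyadic; exact: rm_ge0 dc _ _.
- move=> i; rewrite nintD//; last 4 first.
  + exact: measurable_fun_ifT.
  + exact: measurable_fun_ifT.
  + by move=> y; case: ifP.
  + by move=> y; case: ifP.
  rewrite !nint_if_cst// mulrDr EFinD leeD//.
    apply: le_trans (lee_wpmul2l _ (rm_ball_le dc _ _)) _; rewrite ?lee_fin//.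
      by rewrite powRM ?invr_ge0 ?exprn_ge0// -/Z powRV ?exprn_ge0// -pw -/Z exprMn
        le_eqVlt; apply/orP; left; apply/eqP; field; rewrite expf_neq0 ?gt_eqF.
  apply: le_trans (lee_wpmul2l _ (rm_ball_le dc _ _)) _; rewrite ?lee_fin ?exprn_gt0//.
  rewrite -pw -/Z exprMn exprVn exprS; apply: (@le_trans _ _ (La * c * Z * B ^+ i)).
    by rewrite le_eqVlt; apply/orP; left; apply/eqP; field; rewrite expf_neq0 ?gt_eqF.
  have Z1 : 1 <= Z by rewrite -[leLHS](powRr0 2) ler_powR ?ler1n// ltW.
  rewrite ler_wpM2r ?exprn_ge0// ler_wpM2l ?mulr_ge0 ?(ltW La0) ?(ltW c0)//.
  by rewrite expr2 ler_peMl ?(ltW Z0).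
- move=> n; rewrite -mulr_sumr big_split/=.
  rewrite (_ : _ * _ * c = La * c * Z ^+ 2 * ((1 - A)^-1 + (1 - B)^-1)); last by ring.
  rewrite ler_wpM2l ?lerD ?geometric_le//.
  by rewrite mulr_ge0 ?exprn_ge0 ?mulr_ge0 ?(ltW Z0) ?(ltW La0) ?(ltW c0).
Qed.

End regular.

(** * Solutions on a regular metric space *)

Section solution.
Context {R : realType} {dX : measure_display} {X : measurableType dX}.
Variables (mu : {sigma_finite_measure set X -> \bar R}) (p q s Q La : R).

Definition flux (d : X -> X -> R) (g : R -> R) (u psi : X -> R) (z : X * X) : R :=
  g (`|u z.1 - u z.2| / d z.1 z.2 `^ s) * Num.sg (u z.1 - u z.2) *
  (psi z.1 - psi z.2) / d z.1 z.2 `^ (Q + s).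

Definition energy_density (d : X -> X -> R) (g : R -> R) (u : X -> R) (z : X * X) : R :=
  energy g (`|u z.1 - u z.2| / d z.1 z.2 `^ s) / d z.1 z.2 `^ Q.

(** The weight [1 + d o y] makes the tail an integral over the whole space. It is comparable with
    the distance of [y] to a point of a bounded region as soon as [y] keeps a fixed distance from
    that point, see [tail_kern_comp]. *)
Definition tail_density (d : X -> X -> R) (g : R -> R) (o : X) (v : X -> R) (y : X) : R :=
  g (v y / (1 + d o y) `^ s) / (1 + d o y) `^ (Q + s).

Definition pospart (u : X -> R) (x : X) : R := Num.max (u x) 0.
Definition negpart (u : X -> R) (x : X) : R := Num.max (- u x) 0.

(* [sol_weak] is the weak equation: the integrals of the positive and negative
   parts of the flux are equal. *)
Record solution (d : X -> X -> R) (c : R) (g : R -> R) (o : X) (u : X -> R) : Prop := {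
  sol_metric : regular_metric mu Q La d c ;
  sol_growth : power_growth p q La g ;
  sol_measurable : measurable_fun setT u ;
  sol_ge0 : forall x, d o x < 4 -> 0 <= u x ;
  sol_energy0 : (nint mu (fun x => if (d o x < 3)%R then energy g (u x) else 0)%R < +oo)%E ;
  sol_energy : (nint (mu \x mu)%E
    (fun z => if (d o z.1 < 3)%R then energy_density d g u z else 0)%R < +oo)%E ;
  sol_weak : forall psi : X -> R, measurable_fun setT psi ->
    (forall x, 3 <= d o x -> psi x = 0) ->
    (nint mu (fun x => energy g `|psi x|)%R < +oo)%E ->
    (nint (mu \x mu)%E (energy_density d g psi) < +oo)%E ->
    nint (mu \x mu)%E (fun z => Num.max (flux d g u psi z) 0)%R =
    nint (mu \x mu)%E (fun z => Num.max (- flux d g u psi z) 0)%R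
}.

Lemma measurable_sg : measurable_fun [set: R] (@Num.sg R).
Proof.
apply: nondecreasing_measurable => // x y xy.
have [x0|x0|x0] := ltgtP x 0.
- by rewrite (ltr0_sg x0) -lerNl (le_trans (ler_norm _))// normrN normr_sg lern1; case: (_ != _).
- by rewrite (gtr0_sg x0) gtr0_sg// (lt_le_trans x0).
- by rewrite x0 sgr0 sgr_ge0 -x0.
Qed.

Lemma measurable_div_powR dT (T : measurableType dT) (f e : T -> R) a :
  measurable_fun setT f -> measurable_fun setT e ->
  measurable_fun setT (fun z => f z / e z `^ a).
Proof.
move=> mf me; rewrite (_ : (fun z => _) = (fun z => f z * e z `^ (- a))).
  by apply: measurable_funM => //; exact: (measurableT_comp (measurable_powR _)).
by apply/funext => z; rewrite powRN.
Qed.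

Lemma measurable_fst_comp (f : X -> R) : measurable_fun setT f ->
  measurable_fun setT (fun z : X * X => f z.1).
Proof. by move=> mf; exact: measurableT_comp mf measurable_fst. Qed.

Lemma measurable_snd_comp (f : X -> R) : measurable_fun setT f ->
  measurable_fun setT (fun z : X * X => f z.2).
Proof. by move=> mf; exact: measurableT_comp mf measurable_snd. Qed.

Lemma measurable_diff_comp (f : X -> R) : measurable_fun setT f ->
  measurable_fun setT (fun z : X * X => f z.1 - f z.2).
Proof.
move=> mf; apply: measurable_funB.
  exact: measurable_fst_comp.
exact: measurable_snd_comp.
Qed.

Lemma measurable_swap (f : X * X -> R) : measurable_fun setT f ->
  measurable_fun setT (fun z : X * X => f (z.2, z.1)).
Proof.
move=> mf; exact: measurableT_comp mf (measurable_fun_pair measurable_snd measurable_fst).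
Qed.

Lemma measurable_maxr0 dT (T : measurableType dT) (f : T -> R) :
  measurable_fun setT f -> measurable_fun setT (fun z => Num.max (f z) 0).
Proof. by move=> mf; exact: measurable_maxr. Qed.

Lemma flux_measurable (d : X -> X -> R) (g : R -> R) (u psi : X -> R) :
  measurable_fun setT (fun z : X * X => d z.1 z.2) -> measurable_fun setT g ->
  measurable_fun setT u -> measurable_fun setT psi ->
  measurable_fun setT (flux d g u psi).
Proof.
move=> md mg mu_u mpsi; apply: measurable_div_powR => //.
apply: measurable_funM; last exact: measurable_diff_comp.
apply: measurable_funM.
  apply: measurableT_comp mg _; apply: measurable_div_powR => //.
  by apply: (measurableT_comp (@normr_measurable R setT)); exact: measurable_diff_comp.
by apply: measurableT_comp measurable_sg _; exact: measurable_diff_comp.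
Qed.

Lemma energy_density_measurable (d : X -> X -> R) (g : R -> R) (f : X -> R) :
  measurable_fun setT (fun z : X * X => d z.1 z.2) ->
  measurable_fun setT (energy g) -> measurable_fun setT f ->
  measurable_fun setT (energy_density d g f).
Proof.
move=> md mH mf; apply: measurable_div_powR => //.
apply: measurableT_comp mH _; apply: measurable_div_powR => //.
by apply: (measurableT_comp (@normr_measurable R setT)); exact: measurable_diff_comp.
Qed.

Lemma tail_density_measurable (d : X -> X -> R) (g : R -> R) (o : X) (v : X -> R) :
  measurable_fun setT (d o) -> measurable_fun setT g -> measurable_fun setT v ->
  measurable_fun setT (tail_density d g o v).
Proof.
move=> md mg mv.
have m1d : measurable_fun setT (fun y => 1 + d o y) by exact: measurable_funD.
apply: measurable_div_powR => //.
by apply: measurableT_comp mg _; apply: measurable_div_powR.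
Qed.

Hypotheses (p1 : 1 < p) (pq : p <= q) (s01 : 0 < s < 1) (Q0 : 0 < Q) (La1 : 1 <= La).

Let La0 : 0 < La. Proof. exact: lt_le_trans La1. Qed.
Let q0 : 0 < q. Proof. by rewrite (lt_le_trans _ pq)// (lt_trans _ p1). Qed.
Let s0 : 0 < s. Proof. by case/andP: s01. Qed.

Variables (d : X -> X -> R) (c : R) (g : R -> R) (o : X) (u : X -> R).
Hypothesis sol : solution d c g o u.
Variable K : R.
Hypotheses (K0 : 0 < K)
  (kernK : forall x, (nint mu (fun y => kern p s Q (d x y))%R <= (K * c)%:E)%E).

Local Notation H := (energy g).
Local Notation kern := (kern p s Q).

Let dc : regular_metric mu Q La d c. Proof. exact: sol_metric sol. Qed.
Let gG : power_growth p q La g. Proof. exact: sol_growth sol. Qed.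
Let mu_u : measurable_fun setT u. Proof. exact: sol_measurable sol. Qed.
Let d0 x y : 0 <= d x y. Proof. exact: rm_ge0 dc _ _. Qed.
Let c0 : 0 < c. Proof. exact: rm_gt0 dc. Qed.
Let H0 t : 0 <= H t. Proof. exact: energy_ge0 gG _. Qed.
Let g0 t : 0 <= g t. Proof. exact: pg_ge0 gG _. Qed.
Let mg : measurable_fun setT g. Proof. exact: measurable_pg gG. Qed.
Let mH : measurable_fun setT H. Proof. exact: measurable_energy gG. Qed.
Let md2 : measurable_fun setT (fun z : X * X => d z.1 z.2).
Proof. exact: rm_measurable dc. Qed.
Let md1 x : measurable_fun setT (fun y => d x y).
Proof. exact: regular_dist1 dc. Qed.

Lemma measurable_flux (psi : X -> R) : measurable_fun setT psi ->
  measurable_fun setT (flux d g u psi).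
Proof. exact: flux_measurable. Qed.

Lemma measurable_energy_density (f : X -> R) : measurable_fun setT f ->
  measurable_fun setT (energy_density d g f).
Proof. exact: energy_density_measurable. Qed.

Lemma measurable_tail_density (v : X -> R) : measurable_fun setT v ->
  measurable_fun setT (tail_density d g o v).
Proof. exact: tail_density_measurable. Qed.

Lemma energy_density_ge0 f z : 0 <= energy_density d g f z.
Proof. by rewrite mulr_ge0 ?invr_ge0 ?powR_ge0. Qed.

Lemma tail_density_ge0 v z : 0 <= tail_density d g o v z.
Proof. by rewrite mulr_ge0 ?invr_ge0 ?powR_ge0. Qed.

Lemma fluxC psi x y : flux d g u psi (y, x) = flux d g u psi (x, y).
Proof.
by rewrite /flux/= (rm_sym dc y x) distrC -opprB sgrN -[psi y - _]opprB; ring.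
Qed.

Lemma flux_gt psi x y : u y < u x -> flux d g u psi (x, y) =
  g ((u x - u y) / d x y `^ s) * (psi x - psi y) / d x y `^ (Q + s).
Proof.
move=> uyx; rewrite /flux/= gtr0_sg ?subr_gt0// mulr1 gtr0_norm ?subr_gt0//.
Qed.

Lemma flux_eq0 psi x y : u x = u y -> flux d g u psi (x, y) = 0.
Proof. by move=> uxy; rewrite /flux/= uxy subrr sgr0 mulr0 !mul0r. Qed.

Lemma energy_kernE D x y :
  g (D / d x y `^ s) * D / d x y `^ (Q + s) =
  H (D / d x y `^ s) / d x y `^ Q.
Proof.
rewrite powRD; last by rewrite gt_eqF// addr_gt0.
by rewrite /energy invfM; ring.
Qed.

(** The flux is symmetric, so pairs with [u y <= u x] suffice and [F] may be symmetrized, whence the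
    factor [2]. The positive and negative parts of the flux have equal integrals, so [F] bounding
    one part also bounds any [G] below the other. The two alternatives serve test functions below
    and above a level. *)
Lemma weak_ineq (psi : X -> R) (F G : X * X -> R) :
  measurable_fun setT psi -> (forall x, 3 <= d o x -> psi x = 0) ->
  (nint mu (fun x => H `|psi x|)%R < +oo)%E ->
  (nint (mu \x mu)%E (energy_density d g psi) < +oo)%E ->
  measurable_fun setT F -> measurable_fun setT G ->
  (forall z, 0 <= F z) -> (forall z, 0 <= G z) ->
  ((forall x y, u y <= u x -> flux d g u psi (x, y) <= F (x, y) + F (y, x)) /\
   (forall z, G z <= Num.max (- flux d g u psi z) 0)) \/
  ((forall x y, u y <= u x -> - flux d g u psi (x, y) <= F (x, y) + F (y, x)) /\
   (forall z, G z <= Num.max (flux d g u psi z) 0)) ->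
  (nint (mu \x mu)%E G <= 2%:E * nint (mu \x mu)%E F)%E.
Proof.
move=> mpsi psi0 psi1 psi2 mF mG F0 G0 FG.
have := sol_weak sol mpsi psi0 psi1 psi2.
have mf := measurable_flux mpsi.
have mf1 := measurable_maxr0 mf.
have mf2 : measurable_fun setT (fun z => Num.max (- flux d g u psi z) 0).
  by apply: measurable_maxr0; exact: measurableT_comp.
have <- : nint (mu \x mu)%E (fun z => F z + F (z.2, z.1))%R =
   (2%:E * nint (mu \x mu)%E F)%E.
  rewrite nintD//; last exact: measurable_swap.
  by rewrite nint_swap// -[in RHS]natr1 EFinD ge0_muleDl ?mul1e// lee_fin.
have mFF : measurable_fun setT (fun z => F z + F (z.2, z.1)).
  by apply: measurable_funD => //; exact: measurable_swap.
case: FG => -[fF Gf] E.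
- apply: (@le_trans _ _ (nint (mu \x mu)%E (fun z => Num.max (flux d g u psi z) 0)%R)).
    by rewrite E; exact: le_nint.
  apply: le_nint => // [z|[x y]]; first by rewrite le_max lexx orbT.
  rewrite ge_max addr_ge0// andbT/=; have [uxy|uxy] := leP (u y) (u x).
    exact: fF.
  by rewrite -fluxC addrC fF// ltW.
- apply: (@le_trans _ _ (nint (mu \x mu)%E (fun z => Num.max (- flux d g u psi z) 0)%R)).
    by rewrite -E; exact: le_nint.
  apply: le_nint => // [z|[x y]]; first by rewrite le_max lexx orbT.
  rewrite ge_max addr_ge0// andbT/=; have [uxy|uxy] := leP (u y) (u x).
    exact: fF.
  by rewrite -fluxC addrC fF// ltW.
Qed.

Local Notation negu := (negpart u).
Local Notation posu := (pospart u).
Local Notation T := (tail_density d g o negu).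

Lemma measurable_negpart : measurable_fun setT negu.
Proof. by apply: measurable_maxr0; exact: measurableT_comp. Qed.
Lemma measurable_pospart : measurable_fun setT posu.
Proof. exact: measurable_maxr0. Qed.

Let mneg := measurable_negpart.
Let mpos := measurable_pospart.

(* The set [~~ bad] fills a fixed part of every ball of radius [rho], which replaces the
   Sobolev inequality in the iterations below. *)
Lemma gain_lower (F : X * X -> R) (h : X -> R) (S bad : X -> bool) (rho : R) :
  measurable_fun setT F -> (forall z, 0 <= F z) ->
  measurable_fun setT h -> (forall x, 0 <= h x) ->
  measurable_fun setT S -> measurable_fun setT bad -> 0 < rho ->
  (mu [set y | bad y] <= (c / 2 * rho `^ Q)%:E)%E ->
  (forall x y, S x -> ~~ bad y -> 0 < d x y < rho -> h x / rho `^ Q <= F (x, y)) ->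
  ((c / 2)%:E * nint mu (fun x => if S x then h x else 0)%R <=
    nint (mu \x mu)%E F)%E.
Proof.
move=> mF F0 mh h0 mS mbad rho0 bad_le hF.
have rQ : 0 < rho `^ Q by rewrite powR_gt0.
have mSh : measurable_fun setT (fun x => if S x then h x else 0).
  exact: measurable_fun_ifT.
have Sh0 x : 0 <= (if S x then h x else 0) by case: ifP.
rewrite -nintZ//; last by rewrite ltW// divr_gt0.
apply: nint2_ge => //; first exact: measurable_funM.
  by move=> x; rewrite mulr_ge0// ltW// divr_gt0.
move=> x; case: ifPn => Sx; last by rewrite mulr0 nint_ge0.
pose W y := [&& d x y < rho, 0 < d x y & ~~ bad y].
have mW : measurable_fun setT W.
  apply: measurable_and; first exact: measurable_fun_ltr.
  apply: measurable_and; first exact: measurable_fun_ltr.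
  exact: measurable_neg.
have k0 : 0 <= h x / rho `^ Q by rewrite divr_ge0// ltW.
apply: (@le_trans _ _ (nint mu (fun y => if W y then h x / rho `^ Q else 0)%R)).
  rewrite nint_if_cst//.
  (* The ball has measure at least [c rho ^ Q]; the bad set takes at most half of this and the
     points at distance [0] take nothing. *)
  suff muW : ((c / 2 * rho `^ Q)%:E <= mu [set y | W y])%E.
    apply: le_trans (lee_wpmul2l _ muW); last by rewrite lee_fin.
    rewrite -EFinM lee_fin le_eqVlt; apply/orP; left; apply/eqP.
    by field; rewrite gt_eqF.
  have sub : [set y | (d x y < rho)%R] `<=`
      [set y | W y] `|` ([set y | bad y] `|` [set y | (d x y <= 0)%R]).
    move=> y /= dy; rewrite /W dy/=; case: (boolP (bad y)) => by_; first by right; left.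
    by have [dy0|dy0] := leP (d x y) 0; [right; right|left].
  have mW' := measurable_pred mW.
  have mb' := measurable_pred mbad.
  have m0 : measurable [set y | (d x y <= 0)%R].
    by apply: measurable_pred; exact: measurable_fun_ler.
  have mr : measurable [set y | (d x y < rho)%R].
    by apply: measurable_pred; exact: measurable_fun_ltr.
  have null : mu [set y | (d x y <= 0)%R] = 0%E.
    apply/eqP; rewrite eq_le measure_ge0 andbT.
    apply/lee_addgt0Pr => e e0; rewrite add0e.
    (* Chosen so that [La c r ^ Q = e]. *)
    pose r := (e / (La * c)) `^ Q^-1.
    have r0 : 0 < r by rewrite powR_gt0// divr_gt0// mulr_gt0.
    apply: le_trans (le_measure mu _ _ (_ : _ `<=` [set y | (d x y < r)%R])) _.
    - by rewrite inE.
    - by rewrite inE; apply: measurable_pred; exact: measurable_fun_ltr.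
    - by move=> y /= dy; exact: le_lt_trans r0.
    apply: le_trans (rm_ball_le dc x r0) _.
    rewrite lee_fin -powRrM mulVf ?gt_eqF// powRr1; last by nneg.
    by rewrite le_eqVlt; apply/orP; left; apply/eqP; field; rewrite !gt_eqF.
  have h1 : (mu [set y | (d x y < rho)%R] <= mu [set y | W y] + mu [set y | bad y])%E.
    apply: le_trans (le_measure mu _ _ sub) _; rewrite ?inE//.
      by do 2 apply: measurableU => //.
    have mU : measurable ([set y | bad y] `|` [set y | (d x y <= 0)%R]).
      exact: measurableU.
    apply: le_trans (measureU2 mu mW' mU) _; rewrite leeD2l//.
    by rewrite -[leRHS]adde0 -null; exact: measureU2.
  have h2 := le_trans (rm_ball_ge dc x rho0) (le_trans h1 (leeD2l _ bad_le)).
  have [fin|] := boolP (mu [set y | W y] \is a fin_num); last first.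
    by rewrite ge0_fin_numE// -leNgt leye_eq => /eqP ->; rewrite leey.
  move: h2; rewrite -(fineK fin) -EFinD !lee_fin; lra.
apply: le_nint => //.
- exact: measurable_fun_ifT.
- exact: measurableT_comp mF (measurable_pair1 x).
- by move=> y; case: ifP.
- by move=> y; case: ifPn => // /and3P[dy1 dy0 by_]; apply: hF; rewrite ?dy0.
Qed.

(** Equal to [1] up to radius [r - 1 / l], zero from radius [r] on, and linear with slope [- l] in
    between. *)
Definition cutoff (r l : R) (x : X) : R := Num.min 1 (Num.max 0 (l * (r - d o x))).

Lemma cutoff_ge0 r l x : 0 <= cutoff r l x.
Proof. by rewrite le_min ler01/= le_max lexx. Qed.

Lemma cutoff_le1 r l x : cutoff r l x <= 1.
Proof. by rewrite ge_min lexx. Qed.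

Lemma cutoff_eq0 r l x : 0 <= l -> r <= d o x -> cutoff r l x = 0.
Proof.
move=> l0 rx; by rewrite /cutoff max_l ?min_r// mulr_ge0_le0 ?subr_le0.
Qed.

Lemma cutoff_eq1 r l x : 1 <= l * (r - d o x) -> cutoff r l x = 1.
Proof.
by move=> h; rewrite /cutoff min_l// le_max h orbT.
Qed.

Lemma cutoff_lip r l x y : 0 <= l -> `|cutoff r l x - cutoff r l y| <= l * d x y.
Proof.
move=> l0; rewrite /cutoff.
have minl (a b : R) : `|Num.min 1 a - Num.min 1 b| <= `|a - b|.
  wlog ab : a b / a <= b.
    by move=> W; have [/W//|/ltW/W] := leP a b; rewrite distrC [leRHS]distrC.
  rewrite !ler0_norm ?subr_le0 ?le_min ?ge_min ?ab ?lexx ?orbT//.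
  by have [?|?] := leP 1 a; have [?|?] := leP 1 b; rewrite ?(min_l, min_r)//; lra.
apply: le_trans (minl _ _) _; rewrite ![Num.max 0 _]maxC.
apply: le_trans (maxr0_lip _ _) _; rewrite -mulrBr normrM ger0_norm// ler_wpM2l//.
rewrite (_ : _ - _ = d o y - d o x); last by ring.
have h1 : d o y <= d o x + d x y by exact: rm_triangle dc _ _ _.
have h2 : d o x <= d o y + d y x by exact: rm_triangle dc _ _ _.
by rewrite ler_norml; apply/andP; split; rewrite ?(rm_sym dc x y); move: h1; rewrite ?(rm_sym dc x y); lra.
Qed.

Lemma measurable_cutoff r l : measurable_fun setT (cutoff r l).
Proof.
apply: measurable_minr => //; apply: measurable_maxr => //.
by apply: measurable_funM => //; exact: measurable_funB.
Qed.

Definition super_test (phi : X -> R) (x : X) : R := Num.max (phi x - posu x) 0.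

(* The part of minus the flux of [psi = (phi - u_+)_+] that is not absorbed by the
   energy of [phi]. *)
Definition super_gain (psi : X -> R) (z : X * X) : R := if psi z.2 <= 0 then
  g ((u z.2 - u z.1) / d z.1 z.2 `^ s) * psi z.1 / d z.1 z.2 `^ (Q + s) else 0.

(** The outer [2] comes from the symmetrization in [weak_ineq] and [La 2 ^ q] from [pg_add]. The two
    summands are the energy of the cutoff, integrated against the kernel, and the tail, where [5]
    compares [1 + d o y] with [d x y]. *)
Definition super_const := 2 * (La * 2 `^ q *
  (La ^+ 2 * K + La * 5 `^ (s * (q - 1) + (Q + s)))).

Lemma measurable_super_gain (psi : X -> R) : measurable_fun setT psi ->
  measurable_fun setT (super_gain psi).
Proof.
move=> mpsi; apply: measurable_fun_ifT => //.
- by apply: measurable_fun_ler => //; exact: measurable_snd_comp.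
- apply: measurable_div_powR => //; apply: measurable_funM; last exact: measurable_fst_comp.
  apply: measurableT_comp mg _; apply: measurable_div_powR => //.
  by apply: measurable_funB; [exact: measurable_snd_comp|exact: measurable_fst_comp].
Qed.

(** * Caccioppoli estimate below a level *)

Section super.
Variables (phi : X -> R) (M L : R).
Hypotheses (mphi : measurable_fun setT phi) (M0 : 0 < M) (L1 : 1 <= L).
Hypotheses (phi0 : forall x, 0 <= phi x) (phiM : forall x, phi x <= M).
Hypothesis phiL : forall x y, `|phi x - phi y| <= M * (L * d x y).
Hypothesis phi3 : forall x, 3 <= d o x -> phi x = 0.
Hypothesis tailM : (nint mu T <= (c * g M)%:E)%E.

Local Notation psi := (super_test phi).

Let mpsi : measurable_fun setT psi.
Proof. by apply: measurable_maxr0; exact: measurable_funB. Qed.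

Let posu0 x : 0 <= posu x. Proof. by rewrite le_max lexx orbT. Qed.
Let psi0 x : 0 <= psi x. Proof. by rewrite le_max lexx orbT. Qed.
Let psi_le x : psi x <= phi x.
Proof. by rewrite ge_max phi0 gerBl posu0. Qed.
Let psi3 x : 3 <= d o x -> psi x = 0.
Proof. by move=> x3; apply/eqP; rewrite eq_le psi0 andbT -(phi3 x3) psi_le. Qed.

Let psi_gt0 x : 0 < psi x -> [/\ d o x < 3, 0 <= u x & psi x = phi x - u x].
Proof.
move=> px; have dx : d o x < 3.
  by rewrite ltNge; apply/negP => /psi3 px0; rewrite px0 ltxx in px.
have ux : 0 <= u x by apply: sol_ge0 sol _ _; lra.
split=> //; move: px; rewrite /super_test /pospart [Num.max (u x) 0]max_l// lt_max ltxx orbF.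
by move=> px; rewrite max_l// ltW.
Qed.

Let ga := s * (q - 1) + (Q + s).
Let C1 := La * 2 `^ q * (La ^+ 2 * L `^ q * H M).
Let C2 := La * 2 `^ q * (M * (La * 5 `^ ga)).
Let F (z : X * X) := if 0 < psi z.1 then C1 * kern (d z.1 z.2) + C2 * T z.2 else 0.

Let C10 : 0 <= C1.
Proof.
by rewrite /C1; nneg.
Qed.
Let C20 : 0 <= C2.
Proof. by rewrite /C2; nneg. Qed.
Let T0 y : 0 <= T y. Proof. exact: tail_density_ge0. Qed.

Let F0 z : 0 <= F z.
Proof. by rewrite /F; case: ifP => // _; nneg; exact: kern_ge0. Qed.

Let La2 : 1 <= La * 2 `^ q.
Proof. by rewrite mulr_ege1// -[leLHS](powRr0 2) ler_powR ?ler1n// ltW. Qed.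

(** Only [psi y < psi x] matters, which puts [x] in the support of [psi]. The sign of [u y] then
    decides: a nonnegative [u y] leads to the energy of [phi], a negative one adds the tail. *)
Let flux_le x y : u y <= u x -> flux d g u psi (x, y) <= F (x, y).
Proof.
rewrite le_eqVlt => /predU1P[uxy|uyx]; first by rewrite (flux_eq0 _ (esym uxy)).
rewrite flux_gt//; have [pxy|pyx] := leP (psi x) (psi y).
  apply: le_trans (F0 _).
  by rewrite mulr_le0_ge0 ?invr_ge0 ?powR_ge0// mulr_ge0_le0// subr_le0.
have px : 0 < psi x by exact: le_lt_trans pyx.
have [dx ux psiE] := psi_gt0 px; rewrite /F/= px.
have E1 D : 0 <= D -> D <= phi x - phi y ->
    g (D / d x y `^ s) * D / d x y `^ (Q + s) <=
    La ^+ 2 * L `^ q * H M * kern (d x y).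
  move=> D0 DD; rewrite energy_kernE; apply: (@energy_kern _ p q) => //.
  - exact: ltW.
  - rewrite D0/=; have := phiM x; have := phi0 y; lra.
  - by rewrite (le_trans DD)// (le_trans (ler_norm _))// phiL.
have e0 : 0 <= La ^+ 2 * L `^ q * H M * kern (d x y).
  by nneg; exact: kern_ge0.
have [uy|uy] := leP 0 (u y).
  have py : phi y - u y <= psi y by rewrite /super_test /pospart (max_l uy) le_max lexx.
  (* [psi y < psi x] reads [u x - u y < phi x - phi y], because [psi y >= phi y - u y]; since
     [u y < u x], the difference of [psi] obeys the same bound. Both factors of the flux are thus
     dominated by those of [phi]. *)
  have D1 : u x - u y <= phi x - phi y by lra.
  have D2 : psi x - psi y <= phi x - phi y by lra.
  have D3 : 0 <= phi x - phi y by lra.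
  apply: le_trans (_ : g ((phi x - phi y) / d x y `^ s) * (phi x - phi y)
     / d x y `^ (Q + s) <= _).
    rewrite ler_wpM2r ?invr_ge0 ?powR_ge0// ler_pM//; first lra.
    by apply: pg_homo gG _ _ _; rewrite ler_wpM2r ?invr_ge0 ?powR_ge0.
  apply: le_trans (E1 _ D3 (lexx _)) _.
  apply: ler_wpDr; first by nneg.
  have -> : C1 * kern (d x y) = La * 2 `^ q * (La ^+ 2 * L `^ q * H M * kern (d x y)).
    by rewrite /C1; ring.
  by rewrite ler_peMl.
(* A negative value lies beyond radius [4] while [x] lies within radius [3]. Hence [d x y > 1] and
   [1 + d o y <= 5 d x y], and [u x - u y] splits into a part below [phi x] and the negative part at
   [y]. *)
have dy : 4 <= d o y.
  by rewrite leNgt; apply/negP => /(sol_ge0 sol); rewrite leNgt uy.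
have py : psi y = 0 by apply: psi3; lra.
have phy : phi y = 0 by apply: phi3; lra.
have ny : negu y = - u y by rewrite /negpart max_l// oppr_ge0 ltW.
rewrite py subr0.
have dxy : d o y <= d o x + d x y by exact: rm_triangle dc _ _ _.
have uxp : u x <= phi x by lra.
have pxp : psi x <= phi x by exact: psi_le.
apply: le_trans (_ : La * 2 `^ q * (g (phi x / d x y `^ s) * phi x / d x y `^ (Q + s) +
   M * (g (negu y / d x y `^ s) / d x y `^ (Q + s))) <= _); last first.
  rewrite mulrDr lerD//.
    rewrite /C1 -[leRHS]mulrA ler_wpM2l ?(le_trans ler01 La2)// E1//.
    by rewrite phy subr0.
  rewrite /C2 -[leRHS]mulrA ler_wpM2l ?(le_trans ler01 La2)//.
  rewrite -mulrA ler_wpM2l ?(ltW M0)// (@tail_kern_comp _ p q)//; last by lra.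
  - by rewrite le_max lexx orbT.
  - lra.
  - lra.
  - lra.
rewrite (_ : _ + _ = (g (phi x / d x y `^ s) * phi x + g (negu y / d x y `^ s) * M) /
  d x y `^ (Q + s)); last by ring.
rewrite mulrA ler_wpM2r ?invr_ge0 ?powR_ge0//.
apply: le_trans (_ : La * 2 `^ q * (g (phi x / d x y `^ s) +
   g (negu y / d x y `^ s)) * phi x <= _).
  apply: ler_pM => //.
  apply: le_trans (pg_add La1 gG _ _); last 2 first.
  - by rewrite divr_ge0 ?powR_ge0.
  - by rewrite divr_ge0 ?powR_ge0 ?ny ?oppr_ge0 ?(ltW uy).
  apply: pg_homo gG _ _ _; rewrite -mulrDl ler_wpM2r ?invr_ge0 ?powR_ge0// ny; lra.
rewrite -mulrA ler_wpM2l ?(le_trans ler01 La2)// mulrDl lerD2l ler_wpM2l//.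
Qed.

Local Notation G := (super_gain psi).

Let G0 z : 0 <= G z.
Proof. by rewrite /super_gain; case: ifP => // _; rewrite !mulr_ge0 ?invr_ge0 ?powR_ge0. Qed.

(** No condition [u x < u y] is built into the gain: where it fails, the argument of [g] is
    nonpositive and [g] vanishes there. *)
Let G_le z : G z <= Num.max (- flux d g u psi z) 0.
Proof.
case: z => x y; rewrite /super_gain/=; case: ifPn => [py|_]; last by rewrite le_max lexx orbT.
have {}py : psi y = 0 by apply/eqP; rewrite eq_le py psi0.
have [uxy|uyx] := ltP (u x) (u y).
  by rewrite -fluxC flux_gt// py sub0r mulrN mulNr opprK (rm_sym dc y x) le_max lexx.
rewrite (pg_eq0 gG) ?mul0r ?le_max ?lexx ?orbT//.
by rewrite mulr_le0_ge0 ?invr_ge0 ?powR_ge0// subr_le0.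
Qed.

Let mF : measurable_fun setT F.
Proof.
apply: measurable_fun_ifT => //.
- by apply: measurable_fun_ltr => //; exact: measurable_fst_comp.
- apply: measurable_funD; apply: measurable_funM => //.
    by apply: measurableT_comp md2; exact: measurable_kern.
  by apply: measurable_snd_comp; exact: measurable_tail_density.
Qed.

Let mG : measurable_fun setT G. Proof. exact: measurable_super_gain. Qed.

Let psi_energy0 : (nint mu (fun x => H `|psi x|)%R < +oo)%E.
Proof.
have mb : measurable_fun setT (fun x => d o x < 3) by exact: measurable_fun_ltr.
apply: le_lt_trans (_ : nint mu (fun x => if d o x < 3 then H M else 0)%R < +oo)%E.
  apply: le_nint => //.
  - by apply: measurableT_comp mH _; exact: measurableT_comp.
  - exact: measurable_fun_ifT.
  - move=> x; rewrite ger0_norm//; case: ifPn => [_|]; last first.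
      by rewrite -leNgt => /psi3 ->; rewrite energy0.
    by apply: energy_homo gG _ _ _; exact: le_trans (psi_le x) (phiM x).
rewrite nint_if_cst//; apply: le_lt_trans (lee_wpmul2l _ (rm_ball_le dc _ _)) _ => //.
  by rewrite lee_fin.
by rewrite -EFinM ltry.
Qed.

(** Admissibility of the test function. Differences of [psi] are at most those of [phi] plus those
    of [u], and a pair contributes only if one of its points is within radius [3], where the energy
    of [u] is finite. *)
Let psi_energy : (nint (mu \x mu)%E (energy_density d g psi) < +oo)%E.
Proof.
pose B (z : X * X) := if d o z.1 < 3 then La * 2 `^ q *
  (La ^+ 2 * L `^ q * H M * kern (d z.1 z.2) + energy_density d g u z) else 0.
have k0 : 0 <= La ^+ 2 * L `^ q * H M.
  by nneg.
have A0 : 0 <= La * 2 `^ q by exact: le_trans La2.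
have B0 z : 0 <= B z.
  rewrite /B; case: ifP => // _; rewrite mulr_ge0// addr_ge0 ?energy_density_ge0//.
  by rewrite mulr_ge0 ?kern_ge0.
have mb : measurable_fun setT (fun z : X * X => d o z.1 < 3).
  by apply: measurable_fun_ltr => //; exact: measurable_fst_comp.
have mk : measurable_fun setT (fun z : X * X => kern (d z.1 z.2)).
  by apply: measurableT_comp md2; exact: measurable_kern.
have mB1 : measurable_fun setT (fun z : X * X => if d o z.1 < 3 then
    La ^+ 2 * L `^ q * H M * kern (d z.1 z.2) else 0).
  by apply: measurable_fun_ifT => //; exact: measurable_funM.
have mB2 : measurable_fun setT (fun z : X * X => if d o z.1 < 3 then
    energy_density d g u z else 0).
  by apply: measurable_fun_ifT => //; exact: measurable_energy_density.
have BE : B = (fun z => La * 2 `^ q * ((if d o z.1 < 3 then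
    La ^+ 2 * L `^ q * H M * kern (d z.1 z.2) else 0) +
   (if d o z.1 < 3 then energy_density d g u z else 0))).
  by apply/funext => z; rewrite /B; case: ifP => // _; rewrite addr0 mulr0.
have mB : measurable_fun setT B.
  by rewrite BE; apply: measurable_funM => //; exact: measurable_funD.
have Bfin : (nint (mu \x mu)%E B < +oo)%E.
  rewrite BE nintZ//; last 2 first.
  - exact: measurable_funD.
  - by move=> z; case: ifP => // _; rewrite ?addr0// addr_ge0 ?energy_density_ge0// mulr_ge0 ?kern_ge0.
  rewrite nintD//; last 2 first.
  - by move=> z; case: ifP => // _; rewrite mulr_ge0 ?kern_ge0.
  - by move=> z; case: ifP => // _; rewrite energy_density_ge0.
  rewrite lte_mul_pinfty ?lee_fin// lte_add_pinfty//; last exact: sol_energy sol.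
  apply: le_lt_trans (nint2_le _ (_ : measurable_fun setT (fun x => if d o x < 3 then
     La ^+ 2 * L `^ q * H M * (K * c) else 0)) _ _) _ => //.
  - by apply: measurable_fun_ifT => //; exact: measurable_fun_ltr.
  - by move=> z; case: ifP => // _; rewrite mulr_ge0 ?kern_ge0.
  - move=> x /=; case: ifP => _; last by rewrite /nint integral0.
    rewrite nintZ//; last 2 first.
    + by apply: measurableT_comp (md1 x); exact: measurable_kern.
    + by move=> y; exact: kern_ge0.
    by rewrite (EFinM _ (K * c)) lee_wpmul2l// lee_fin.
  - rewrite nint_if_cst//.
      apply: le_lt_trans (lee_wpmul2l _ (rm_ball_le dc _ _)) _ => //.
        by rewrite lee_fin mulr_ge0// mulr_ge0 ?(ltW K0) ?(ltW c0)//.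
      by rewrite -EFinM ltry.
    + exact: measurable_fun_ltr.
    + by rewrite mulr_ge0// mulr_ge0 ?(ltW K0) ?(ltW c0)//.
apply: le_lt_trans (_ : nint (mu \x mu)%E (fun z => B z + B (z.2, z.1))%R < +oo)%E.
  apply: le_nint.
  - exact: measurable_energy_density.
  - by apply: measurable_funD => //; exact: measurable_swap.
  - exact: energy_density_ge0.
  - have key x y : d o x < 3 -> energy_density d g psi (x, y) <= B (x, y).
      move=> dx; rewrite /B /= dx /energy_density/=.
      have lip : `|psi x - psi y| <= `|phi x - phi y| + `|u x - u y|.
        apply: le_trans (maxr0_lip _ _) _.
        rewrite (_ : _ - _ = phi x - phi y - (posu x - posu y)); last by ring.
        by rewrite (le_trans (ler_normB _ _))// lerD2l maxr0_lip.
      have kE : energy g (`|phi x - phi y| / d x y `^ s) / d x y `^ Q <=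
          La ^+ 2 * L `^ q * H M * kern (d x y).
        apply: (@energy_kern _ p q) => //; first exact: ltW.
        rewrite normr_ge0/= ler_norml; apply/andP; split.
          by have := phiM y; have := phi0 x; lra.
        by have := phiM x; have := phi0 y; lra.
      apply: le_trans (_ : La * 2 `^ q * (energy g (`|phi x - phi y| / d x y `^ s) / d x y `^ Q +
        energy g (`|u x - u y| / d x y `^ s) / d x y `^ Q) <= _).
        rewrite -mulrDl mulrA ler_wpM2r ?invr_ge0 ?powR_ge0//.
        apply: le_trans (energy_add p1 pq La1 gG _ _); rewrite ?divr_ge0 ?powR_ge0//.
        by apply: energy_homo gG _ _ _; rewrite -mulrDl ler_wpM2r ?invr_ge0 ?powR_ge0.
      by rewrite ler_wpM2l// lerD2r.
    move=> [x y] /=; have [dx|dx] := ltP (d o x) 3.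
      by rewrite (le_trans (key _ _ dx))// lerDl.
    have [dy|dy] := ltP (d o y) 3; last first.
      rewrite /energy_density/= !psi3// subrr normr0 mul0r energy0 mul0r.
      by rewrite addr_ge0.
    rewrite (le_trans _ (_ : B (y, x) <= _)) ?lerDr//.
    apply: le_trans (key _ _ dy); rewrite le_eqVlt; apply/orP; left.
    by rewrite /energy_density/= distrC (rm_sym dc).
rewrite nintD//; last exact: measurable_swap.
by rewrite nint_swap// lte_add_pinfty.
Qed.

(** The majorant [F] vanishes unless [psi x > 0], and its integral in [y] is then bounded by a
    constant: the kernel gives [K c] and the tail [c g M]. This is how the right-hand side reduces
    to the measure of the support of [psi]. *)
Lemma super_caccioppoli : (nint (mu \x mu)%E G <=
  (super_const * L `^ q * H M * c)%:E * mu [set x | (0 < psi x)%R])%E.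
Proof.
apply: le_trans (weak_ineq mpsi psi3 psi_energy0 psi_energy mF mG F0 G0 _) _.
  left; split; [move=> x y uyx|exact: G_le].
  by rewrite (le_trans (flux_le uyx))// lerDl.
have mb : measurable_fun setT (fun x => 0 < psi x) by exact: measurable_fun_ltr.
have B0 : 0 <= C1 * (K * c) + C2 * (c * g M).
  by nneg.
apply: le_trans (_ : 2%:E * ((C1 * (K * c) + C2 * (c * g M))%:E *
    mu [set x | (0 < psi x)%R]) <= _)%E.
  rewrite lee_wpmul2l ?lee_fin// -nint_if_cst//.
  apply: nint2_le => //; first exact: measurable_fun_ifT.
  move=> x; rewrite /F/=; case: ifP => _; last by rewrite /nint integral0.
  have mk : measurable_fun setT (fun y => kern (d x y)).
    by apply: measurableT_comp (md1 x); exact: measurable_kern.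
  have mT : measurable_fun setT T by exact: measurable_tail_density.
  rewrite nintD//; last 4 first.
  - exact: measurable_funM.
  - exact: measurable_funM.
  - by move=> y; rewrite mulr_ge0 ?kern_ge0.
  - by move=> y; rewrite mulr_ge0.
  rewrite !nintZ//; last by move=> y; exact: kern_ge0.
  by rewrite EFinD (EFinM C1) (EFinM C2) leeD// lee_wpmul2l// lee_fin.
rewrite muleA lee_wpmul2r// -EFinM lee_fin /C1 /C2 /super_const.
have Lq : 1 <= L `^ q by rewrite -[leLHS](powRr0 L) ler_powR// ltW.
have M_ : H M = M * g M by [].
rewrite [leRHS](_ : _ = 2 * (La * 2 `^ q * (La ^+ 2 * L `^ q * H M) * (K * c)) +
  2 * (La * 2 `^ q * (M * (La * 5 `^ ga)) * (c * g M)) * L `^ q); last first.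
  by rewrite M_; ring.
rewrite mulrDr lerD2l ler_peMr//; nneg.
Qed.

End super.
End solution.

Ltac npos := lazymatch goal with
  | |- is_true (@Order.lt _ _ _ ?b) => lazymatch b with
    | @GRing.mul _ _ _ => apply: mulr_gt0; npos
    | @Algebra.add _ _ _ => apply: addr_gt0; npos
    | @powR _ _ _ => apply: powR_gt0; npos
    | @GRing.exp _ _ _ => apply: exprn_gt0; npos
    | @GRing.inv _ _ => rewrite invr_gt0; npos
    | _ => try done
    end
  end.

Lemma lee_geometric0 (R : realType) (x : \bar R) (a t : R) : 0 <= t < 1 ->
  (forall j, (x <= (a * t ^+ j)%:E)%E) -> (x <= 0)%E.
Proof.
move=> /andP[t0 t1] xt; apply/lee_addgt0Pr => e e0; rewrite add0e.
have /cvgrPdist_lt/(_ _ e0)[n _ /(_ n (leqnn n))] : geometric a t @ \oo --> (0 : R).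
  by apply: cvg_geometric; rewrite ger0_norm.
rewrite sub0r normrN => /ltW an; apply: le_trans (xt n) _.
by rewrite lee_fin (le_trans _ an)// ler_norm.
Qed.

Lemma powRX (R : realType) (x a : R) j : 0 <= x -> (x ^+ j) `^ a = (x `^ a) ^+ j.
Proof. by move=> x0; rewrite -powR_mulrn// powRAC powR_mulrn ?powR_ge0. Qed.

Lemma powR_le1 (R : realType) (x a : R) : 0 <= x <= 1 -> 0 <= a -> x `^ a <= 1.
Proof.
move=> /andP[x0 x1] a0; have := ge0_ler_powR a0 x0 _ x1.
by rewrite powR1; apply; rewrite nnegrE.
Qed.

Lemma powR_lt1 (R : realType) (x a : R) : 0 <= x < 1 -> 0 < a -> x `^ a < 1.
Proof.
move=> /andP[x0 x1] a0; have := gt0_ltr_powR a0 x0 _ x1.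
by rewrite powR1; apply; rewrite nnegrE.
Qed.

(** Solving [(D + 2 ^ a) eps ^ a = t]; the added [2 ^ a] forces [eps <= 1 / 2]. *)
Lemma small_powR (R : realType) (D a t : R) : 0 <= D -> 0 < a -> 0 < t <= 1 ->
  exists2 eps, 0 < eps <= 2^-1 & D * eps `^ a <= t.
Proof.
move=> D0 a0 /andP[t0 t1].
have D2 : 0 < D + 2 `^ a by rewrite ltr_wpDl// powR_gt0.
exists ((t / (D + 2 `^ a)) `^ a^-1).
  have E : 2^-1 = (2^-1 `^ a) `^ a^-1 :> R.
    by rewrite -powRrM mulfV ?gt_eqF// powRr1// invr_ge0.
  rewrite powR_gt0 ?divr_gt0//= [leRHS]E.
  rewrite ge0_ler_powR ?invr_ge0 ?nnegrE ?(ltW a0) ?powR_ge0 ?divr_ge0 ?(ltW t0) ?(ltW D2)//.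
  rewrite powRV// ler_pdivrMr// ler_pdivlMl ?powR_gt0//.
  by rewrite (le_trans (_ : _ <= 2 `^ a)) ?lerDr// ler_piMr ?powR_ge0.
rewrite -powRrM mulVf ?gt_eqF// powRr1 ?divr_ge0 ?(ltW t0) ?(ltW D2)//.
by rewrite mulrA ler_pdivrMr// mulrC ler_wpM2l ?(ltW t0)// lerDl powR_ge0.
Qed.

(** * Lower bounds from smallness in measure, and the weak Harnack inequality *)

Section expansion.
Context {R : realType} {dX : measure_display} {X : measurableType dX}.
Variables (mu : {sigma_finite_measure set X -> \bar R}) (p q s Q La : R).
Hypotheses (p1 : 1 < p) (pq : p <= q) (s01 : 0 < s < 1) (Q0 : 0 < Q) (La1 : 1 <= La).

Let La0 : 0 < La. Proof. exact: lt_le_trans La1. Qed.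
Let p0 : 0 < p. Proof. exact: lt_trans p1. Qed.
Let q0 : 0 < q. Proof. by rewrite (lt_le_trans _ pq). Qed.
Let s0 : 0 < s. Proof. by case/andP: s01. Qed.

(** De Giorgi iteration on the radii [1 + 2 ^ (- j)] and levels [m (1 + 2 ^ (- j))]. The invariant
    is that the bad set [A j] fills at most half of the guaranteed measure [c rho ^ Q] of a ball of
    radius [rho j], as [gain_lower] requires; so [A j] must decay at the rate [th ^ Q] of
    [rho j ^ Q]. *)
Lemma super_de_giorgi : exists2 nu, 0 < nu & forall d c g o u m,
  solution mu p q s Q La d c g o u -> 0 < m ->
  (nint mu (tail_density s Q d g o (negpart u)) <= (c * g m)%:E)%E ->
  (mu [set x | ((d o x < 2) && (u x < 2 * m))%R] <= (nu * c)%:E)%E ->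
  mu [set x | ((d o x < 1) && (u x < m))%R] = 0%E.
Proof.
have [K K0 kernK] := kern_integral mu p1 s01 Q0 La1.
pose Cs := super_const q s Q La K.
have Cs0 : 0 <= Cs by rewrite /Cs /super_const; nneg.
have a0 : 0 < s * p by rewrite mulr_gt0.
(* A step loses [L ^ q] from the slope of the cutoff and [L ^ q] from the gap of the levels, with
   [L = 2 ^ (j + 1)], hence [4 ^ q] more at each step; [th ^ (s p) = 4 ^ (- q)] is the rate of [rho]
   that compensates this exactly. *)
pose th : R := 4 `^ (- (q / (s * p))).
have th0 : 0 < th by rewrite powR_gt0.
have th_a : th `^ (s * p) = (4 `^ q)^-1.
  by rewrite -powRrM mulNr mulfVK ?gt_eqF// powRN.
have thq : th <= 4^-1.
  rewrite /th powRN lef_pV2 ?posrE ?powR_gt0//.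
  rewrite -[leLHS](powRr1 (_ : 0 <= 4))// ler_powR ?ler1n// ler_pdivlMr// mul1r.
  have : s * p <= p by rewrite ler_piMl ?(ltW p0)// ltW//; case/andP: s01.
  by move/le_trans; apply.
have thQ : 0 < th `^ Q <= 1.
  rewrite powR_gt0//= powR_le1 ?(ltW Q0)// (ltW th0)/=.
  by rewrite (le_trans thq)// invf_le1// ler1n.
pose D := 2 * Cs * La ^+ 3 * 2 `^ q * 4 `^ q.
have D0 : 0 <= D by rewrite /D; nneg.
(* [D eps ^ (s p)] is the contraction factor of one step, and must be at most [th ^ Q]. *)
have [eps /andP[eps0 eps2] Deps] := small_powR D0 a0 thQ.
exists (eps `^ Q / 2); first by rewrite divr_gt0// powR_gt0.
move=> d c g o u m sol m0 tail_le A0_le.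
have dc := sol_metric sol; have gG := sol_growth sol; have c0 := rm_gt0 dc.
have mu_u := sol_measurable sol; have mdo := regular_dist1 o dc.
pose A j x := (d o x < 1 + 2 ^- j) && (u x < m * (1 + 2 ^- j)).
have mA j : measurable_fun setT (A j).
  by apply: measurable_and; exact: measurable_fun_ltr.
pose rho j := eps * th ^+ j.
have rho0 j : 0 < rho j by rewrite mulr_gt0// exprn_gt0.
have p2 j : 0 < 2 ^- j :> R by rewrite invr_gt0 exprn_gt0.
have p2S j : 2 ^- j = 2 * 2 ^- j.+1 :> R.
  by rewrite exprS invfM mulrA mulfV ?mul1r ?pnatr_eq0.
have p21 j : 2 ^- j <= 1 :> R by rewrite invf_le1 ?exprn_gt0// exprn_ege1 ?ler1n.
have rho_le j : rho j <= 2 ^- j.+1.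
  rewrite /rho exprS invfM ler_pM ?exprn_ge0 ?(ltW eps0) ?(ltW th0)//.
  rewrite -exprVn lerXn2r ?nnegrE ?invr_ge0 ?(ltW th0)// (le_trans thq)//.
  by rewrite lef_pV2 ?posrE// ler_nat.
have step j : (mu [set x | A j x] <= (c / 2 * rho j `^ Q)%:E)%E ->
    (mu [set x | A j.+1 x] <= (th `^ Q)%:E * mu [set x | A j x])%E.
  move=> Aj; pose k := m * (1 + 2 ^- j); pose L : R := 2 ^+ j.+1.
  have L1 : 1 <= L by rewrite exprn_ege1 ?ler1n.
  have L0 : 0 < L by rewrite exprn_gt0.
  have k0 : 0 < k by rewrite mulr_gt0// addr_gt0.
  pose phi x := k * cutoff d o (1 + 2 ^- j) L x.
  have phi0 x : 0 <= phi x by rewrite mulr_ge0 ?cutoff_ge0 ?ltW.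
  have phik x : phi x <= k by rewrite ler_piMr ?cutoff_le1 ?ltW.
  have phi_out x : 1 + 2 ^- j <= d o x -> phi x = 0.
    by move=> ox; rewrite /phi cutoff_eq0 ?mulr0// ltW.
  have mkm : m <= k by rewrite /k ler_peMr ?(ltW m0)// lerDl ltW.
  have mphi : measurable_fun setT phi.
    by apply: measurable_funM => //; exact: measurable_cutoff sol _ _.
  have SC : (nint (mu \x mu)%E (super_gain s Q d g u (super_test u phi)) <=
     (Cs * L `^ q * energy g k * c)%:E * mu [set x | (0 < super_test u phi x)%R])%E.
    apply: (@super_caccioppoli _ _ _ _ p) => //.
    - exact: sol.
    - by move=> x; exact: kernK dc x.
    - by move=> x y; rewrite -mulrBr normrM gtr0_norm// ler_wpM2l ?(ltW k0)//
        (cutoff_lip sol)// ltW.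
    - move=> x x3; apply: phi_out; apply: le_trans x3; have := p21 j; lra.
    - by apply: le_trans tail_le _; rewrite lee_fin ler_wpM2l ?(ltW c0)// (pg_homo gG).
  have mst : measurable_fun setT (super_test u phi).
    by apply: measurable_maxr0; apply: measurable_funB => //; exact: measurable_pospart sol.
  have st0 x : 0 <= super_test u phi x by rewrite le_max lexx orbT.
  have g0 := pg_ge0 gG.
  (* The gap between two consecutive levels, hence a lower bound of the test function on
     [A j.+1]. *)
  pose del := m / L; have del0 : 0 < del by rewrite divr_gt0.
  pose h := energy g (del / rho j `^ s).
  have h0 : 0 < h by apply: (energy_gt0 gG); rewrite divr_gt0 ?powR_gt0.
  have lower : ((c / 2)%:E * nint mu (fun x => if A j.+1 x then h else 0)%R <=
      nint (mu \x mu)%E (super_gain s Q d g u (super_test u phi)))%E.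
    apply: (gain_lower Q0 La1 sol (h := fun=> h) (rho := rho j) (bad := A j)) => //.
    - exact: measurable_super_gain sol _ mst.
    - move=> z; rewrite /super_gain; case: ifP => // _.
      by rewrite !mulr_ge0 ?invr_ge0 ?powR_ge0.
    - by move=> _; exact: ltW.
    - move=> x y /andP[ox ux] Ajy /andP[dxy0 dxy].
      have oy : d o y < 1 + 2 ^- j.
        apply: le_lt_trans (rm_triangle dc o x y) _.
        have := rho_le j; have := p2S j; lra.
      have uy : k <= u y by move: Ajy; rewrite /A oy/= -leNgt.
      have upos : u y <= pospart u y by rewrite le_max lexx.
      have psy : super_test u phi y <= 0.
        by rewrite ge_max lexx andbT subr_le0 (le_trans (phik y))// (le_trans uy).
      have ux0 : 0 <= u x by apply: (sol_ge0 sol); have := p21 j.+1; lra.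
      have kE : k = m * (1 + 2 ^- j.+1) + del.
        by rewrite /k /del p2S /L; ring.
      have psx : del <= super_test u phi x.
        have -> : super_test u phi x = k - u x.
          rewrite /super_test /pospart [Num.max (u x) 0]max_l//.
          rewrite /phi cutoff_eq1 ?mulr1 ?max_l//; first lra.
          apply: (@le_trans _ _ (L * 2 ^- j.+1)); first by rewrite /L mulfV// gt_eqF// exprn_gt0.
          by rewrite ler_wpM2l ?(ltW L0)//; have := p2S j; lra.
        lra.
      rewrite /super_gain/= psy.
      have dss : (rho j `^ s)^-1 <= (d x y `^ s)^-1.
        by rewrite lef_pV2 ?posrE ?powR_gt0// ge0_ler_powR ?nnegrE ?(ltW s0) ?(ltW dxy0) ?(ltW dxy) ?(ltW (rho0 j)).
      have dsQ : (rho j `^ (Q + s))^-1 <= (d x y `^ (Q + s))^-1.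
        by rewrite lef_pV2 ?posrE ?powR_gt0// ge0_ler_powR ?nnegrE ?(ltW dxy0) ?(ltW dxy) ?(ltW (rho0 j))// addr_ge0 ?ltW.
      have -> : h / rho j `^ Q = g (del / rho j `^ s) * del / rho j `^ (Q + s).
        rewrite /h /energy powRD ?(gt_eqF (rho0 j)) ?implybT// invfM; ring.
      apply: ler_pM; [by nneg|by nneg| |exact: dsQ].
      apply: ler_pM; [exact: g0|exact: ltW| |exact: psx]; apply: (pg_homo gG).
      apply: ler_pM; [exact: ltW|by nneg| |exact: dss]; lra.
  have sub : [set x | (0 < super_test u phi x)%R] `<=` [set x | A j x].
    move=> x /=; rewrite /super_test lt_max ltxx orbF subr_gt0 => px.
    have upos : u x <= pospart u x by rewrite le_max lexx.
    have pos0 : 0 <= pospart u x by rewrite le_max lexx orbT.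
    rewrite /A; apply/andP; split; last exact: le_lt_trans (lt_le_trans px (phik x)).
    by rewrite ltNge; apply/negP => /phi_out phx; move: px; rewrite phx ltNge pos0.
  move: lower; rewrite nint_if_cst ?(ltW h0)// muleA -EFinM => lower.
  have := le_trans lower SC.
  have mAj : measurable [set x | A j x] := measurable_pred (mA j).
  have mst' : measurable [set x | (0 < super_test u phi x)%R].
    by apply: measurable_pred; exact: measurable_fun_ltr.
  (* The three factors [La] come from [k <= 2 m], from [m = L del], and from the lower growth that
     turns [rho ^ (- s)] into the gain [rho ^ (- s p)]. *)
  have Hk : energy g k <= La ^+ 3 * 2 `^ q * L `^ q * rho j `^ (s * p) * h.
    apply: (@le_trans _ _ (energy g (2 * m))).
      apply: (energy_homo gG); rewrite /k mulrC ler_wpM2r ?(ltW m0)//.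
      by have := p21 j; lra.
    apply: le_trans (energy_upper p1 pq gG _ (ltW m0)) _; first by rewrite ler1n.
    have mE : m = L * del by rewrite /del mulrCA mulfV ?mulr1// gt_eqF.
    rewrite {1}mE.
    apply: le_trans (ler_wpM2l _ (energy_upper p1 pq gG L1 (ltW del0))) _; first by nneg.
    have r1 : 1 <= (rho j `^ s)^-1.
      rewrite invf_ge1 ?powR_gt0// powR_le1 ?(ltW s0)// (ltW (rho0 j))/=.
      exact: le_trans (rho_le j) (p21 _).
    have := energy_lower p1 gG r1 (ltW del0).
    rewrite -powRV ?(ltW (rho0 j))// -powRrM powRV ?(ltW (rho0 j))// mulrC.
    rewrite ler_pdivrMr ?powR_gt0//.
    rewrite powRV ?(ltW (rho0 j))// [_^-1 * del]mulrC -/h => hh.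
    apply: le_trans (ler_wpM2l _ (ler_wpM2l _ hh)) _; [by nneg|by nneg|].
    by rewrite le_eqVlt; apply/orP; left; apply/eqP; ring.
  have Aj' : (mu [set x | (0 < super_test u phi x)%R] <= mu [set x | A j x])%E.
    by apply: le_measure; rewrite ?inE.
  have C0 : 0 <= Cs * L `^ q * energy g k * c.
    by nneg; exact: energy_ge0 gG _.
  move=> /le_trans/(_ (lee_wpmul2l _ Aj')); rewrite lee_fin => /(_ C0).
  have ch : 0 < c / 2 * h by rewrite mulr_gt0// divr_gt0.
  rewrite -lee_pdivlMl// muleA -EFinM => /le_trans; apply.
  rewrite lee_wpmul2r// lee_fin ler_pdivrMl//.
  apply: (@le_trans _ _ (Cs * L `^ q * (La ^+ 3 * 2 `^ q * L `^ q * rho j `^ (s * p) * h) * c)).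
    by rewrite ler_wpM2r ?(ltW c0)// ler_wpM2l// mulr_ge0 ?powR_ge0.
  have LL : L `^ q * L `^ q * rho j `^ (s * p) = 4 `^ q * eps `^ (s * p).
    rewrite /rho powRM ?exprn_ge0 ?(ltW th0) ?(ltW eps0)// -(powRM q (ltW L0) (ltW L0)).
    have -> : L * L = 4 * (4 ^+ j).
      have e4 : 4 = 2 * 2 :> R by ring.
      by rewrite /L exprS e4 exprMn; ring.
    rewrite powRM ?exprn_ge0// !powRX ?(ltW th0)// th_a exprVn; field.
    by rewrite expf_neq0// gt_eqF ?powR_gt0.
  rewrite (_ : _ * c = Cs * La ^+ 3 * 2 `^ q * (L `^ q * L `^ q * rho j `^ (s * p)) * h * c); last by ring.
  rewrite LL (_ : _ * c = (D * eps `^ (s * p)) * (c / 2 * h)); last by rewrite /D; field.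
  by rewrite [leRHS]mulrC ler_wpM2r// ltW.
have AQ j : (mu [set x | A j x] <= (c / 2 * eps `^ Q * (th `^ Q) ^+ j)%:E)%E.
  have rhoQ i : rho i `^ Q = eps `^ Q * (th `^ Q) ^+ i.
    by rewrite /rho powRM ?exprn_ge0 ?(ltW th0) ?(ltW eps0)// powRX// ltW.
  elim: j => [|j IH].
    apply: le_trans (le_trans A0_le _); last by rewrite lee_fin expr0; lra.
    rewrite le_eqVlt; apply/orP; left; apply/eqP; congr (mu _).
    apply/seteqP; split => x /=; rewrite /A expr0 invr1; rewrite (_ : 1 + 1 = 2 :> R)// ?[m * 2]mulrC//.
  apply: le_trans (step j _) _; first by rewrite rhoQ mulrA.
  apply: le_trans (lee_wpmul2l _ IH) _; first by rewrite lee_fin powR_ge0.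
  by rewrite lee_fin exprS le_eqVlt; apply/orP; left; apply/eqP; ring.
apply/eqP; rewrite eq_le measure_ge0 andbT.
apply: (@lee_geometric0 _ _ (c / 2 * eps `^ Q) (th `^ Q)).
  rewrite powR_ge0/= powR_lt1// (ltW th0)/=.
  by rewrite (le_lt_trans thq)// invf_lt1// ltr1n.
move=> j; apply: le_trans (AQ j); apply: le_measure.
- by rewrite inE; apply: measurable_pred; apply: measurable_and; exact: measurable_fun_ltr.
- by rewrite inE; exact: measurable_pred (mA j).
- move=> x /= /andP[ox ux]; rewrite /A; apply/andP; split; first by have := p2 j; lra.
  by apply: lt_le_trans ux _; rewrite ler_peMr ?(ltW m0)// lerDl ltW.
Qed.

(** By contraposition: if much of the tail sat on [{u >= 6 m}], the gain at level [3 m] would be so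
    large at every point of [{u < 2 m}] that this set would be small, and [super_de_giorgi] would
    make [{u < m}] null in the unit ball. *)
Lemma weak_harnack : exists2 C, 0 < C & forall d c g o u m,
  solution mu p q s Q La d c g o u -> 0 < m ->
  (nint mu (tail_density s Q d g o (negpart u)) <= (c * g m)%:E)%E ->
  mu [set x | ((d o x < 1) && (u x < m))%R] != 0%E ->
  (nint mu (tail_density s Q d g o (pospart u)) <= (C * (c * g m))%:E)%E.
Proof.
have [K K0 kernK] := kern_integral mu p1 s01 Q0 La1.
have [nu nu0 DG] := super_de_giorgi.
pose Cs := super_const q s Q La K.
have Cs0 : 0 < Cs.
  by rewrite /Cs /super_const !mulr_gt0 ?powR_gt0// addr_gt0 ?mulr_gt0 ?exprn_gt0 ?powR_gt0.
pose ga := s * (q - 1) + (Q + s).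
(* Compares the density at [y] with the gain from [x]: [3] from [d x y <= 3 (1 + d o y)], and [2]
   from [u y <= 2 (u y - u x)], valid when [u x < 3 m] and [u y >= 6 m]. *)
pose C1 := La ^+ 2 * 3 `^ ga * 2 `^ (q - 1).
have C10 : 0 < C1 by rewrite /C1 !mulr_gt0 ?exprn_gt0 ?powR_gt0.
pose C2 := La ^+ 2 * 6 `^ (q - 1) * (La + K).
have C20 : 0 < C2 by rewrite /C2 !mulr_gt0 ?exprn_gt0 ?powR_gt0// addr_gt0.
(* Chosen so that the closing estimate of the measure of [{u < 2 m}] is exactly [nu c]. *)
pose K2 := C1 * Cs * La ^+ 2 * 3 `^ q * 3 `^ Q / nu.
have K20 : 0 < K2 by rewrite /K2; npos.
exists (K2 + C2); first by rewrite addr_gt0.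
move=> d c g o u m sol m0 tail_le /eqP mu_n0.
have dc := sol_metric sol; have gG := sol_growth sol; have c0 := rm_gt0 dc.
have mu_u := sol_measurable sol; have mdo := regular_dist1 o dc.
have g0 := pg_ge0 gG; have d0 := rm_ge0 dc.
have gm0 : 0 < g m by exact: pg_gt0 gG _ _.
set N := tail_density s Q d g o (pospart u).
have mN : measurable_fun setT N.
  by apply: (measurable_tail_density sol); exact: measurable_pospart sol.
have N0 y : 0 <= N y by exact: (tail_density_ge0 sol).
pose N' y := if 6 * m <= u y then N y else 0.
have mN' : measurable_fun setT N'.
  by apply: measurable_fun_ifT => //; exact: measurable_fun_ler.
have N'0 y : 0 <= N' y by rewrite /N'; case: ifP.
pose W y := La * g (6 * m) * ((if d o y < 1 then 1 else 0) + kern p s Q (d o y)).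
have mk : measurable_fun setT (fun y => kern p s Q (d o y)).
  by apply: measurableT_comp mdo; exact: measurable_kern.
have mif : measurable_fun setT (fun y => if d o y < 1 then 1 else 0 : R).
  by apply: measurable_fun_ifT => //; exact: measurable_fun_ltr.
have mW : measurable_fun setT W by apply: measurable_funM => //; exact: measurable_funD.
have if0 y : 0 <= (if d o y < 1 then 1 else 0 : R) by case: ifP.
have W0 y : 0 <= W y.
  by apply: mulr_ge0; [nneg|apply: addr_ge0 => //; exact: kern_ge0].
have NW y : N y <= N' y + W y.
  rewrite /N'; case: ifPn => [_|]; first by rewrite lerDl.
  rewrite -ltNge add0r => uy.
  have e1 : 1 <= 1 + d o y by rewrite lerDl.
  have e0 : 0 < 1 + d o y by rewrite (lt_le_trans _ e1).
  have e1s a : 0 <= a -> 1 <= (1 + d o y) `^ a.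
    by move=> a0; rewrite -[leLHS](powRr0 (1 + d o y)) ler_powR.
  pose b := ((1 + d o y) `^ s)^-1.
  have b01 : 0 <= b <= 1.
    by rewrite /b invr_ge0 powR_ge0/= invf_le1 ?powR_gt0// e1s// ltW.
  have N1 : N y <= La * b `^ (p - 1) * g (6 * m) / (1 + d o y) `^ (Q + s).
    rewrite /N /tail_density ler_wpM2r ?invr_ge0 ?powR_ge0//.
    apply: le_trans (pg_small La1 gG b01 _); last by nneg.
    apply: (pg_homo gG); rewrite mulrC ler_wpM2l ?invr_ge0 ?powR_ge0//.
    by rewrite /pospart ge_max (ltW uy)/= mulr_ge0 ?(ltW m0).
  apply: le_trans N1 _.
  rewrite /W (_ : _ / _ = La * g (6 * m) * (b `^ (p - 1) / (1 + d o y) `^ (Q + s))); last by ring.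
  rewrite ler_wpM2l ?mulr_ge0 ?(ltW La0)//.
  have [y1|y1] := ltP (d o y) 1.
    rewrite ler_wpDr ?kern_ge0// mulr_ile1 ?powR_ge0 ?invr_ge0 ?powR_ge0//.
      by rewrite powR_le1// subr_ge0 ltW.
    by rewrite invf_le1 ?powR_gt0// e1s// addr_ge0 ?ltW.
  (* The exponents add up to [s (p - 1) + (Q + s) = s p + Q], that of the kernel at infinity. *)
  rewrite add0r /kern ltNge y1/= /b -powRV ?(ltW e0)// -powRrM powRV ?(ltW e0)//.
  rewrite -invfM -powRD ?(gt_eqF e0) ?implybT// powRN lef_pV2 ?posrE ?powR_gt0//; last first.
    by rewrite (lt_le_trans _ y1).
  have -> : s * (p - 1) + (Q + s) = s * p + Q by ring.
  rewrite ge0_ler_powR ?nnegrE ?(ltW e0) ?d0// ?lerDr//.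
  by rewrite addr_ge0 ?mulr_ge0 ?ltW.
have Wle : (nint mu W <= (C2 * (c * g m))%:E)%E.
  have k0 : 0 <= La * g (6 * m) by nneg.
  have kk y : 0 <= kern p s Q (d o y) by exact: kern_ge0.
  rewrite nintZ//; [|exact: measurable_funD|by move=> y; rewrite addr_ge0].
  rewrite nintD// nint_if//; last exact: measurable_fun_ltr.
  apply: le_trans (lee_wpmul2l _ (leeD (rm_ball_le dc o ltr01) (kernK _ _ dc o))) _.
    by rewrite lee_fin.
  rewrite -EFinD -EFinM lee_fin powR1 mulr1.
  have g6 : g (6 * m) <= La * 6 `^ (q - 1) * g m.
    by apply: (pg_upper gG); rewrite ?ler1n ?ltW.
  apply: (@le_trans _ _ (La * (La * 6 `^ (q - 1) * g m) * (La * c + K * c))).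
    rewrite ler_wpM2r ?ler_wpM2l ?(ltW La0)// addr_ge0 ?mulr_ge0 ?(ltW La0) ?(ltW c0) ?(ltW K0)//.
  by rewrite /C2 le_eqVlt; apply/orP; left; apply/eqP; ring.
(* The contradiction hypothesis is that the tail is large; it remains to reach the smallness
   condition of [super_de_giorgi]. *)
rewrite leNgt; apply/negP => Nlt; apply: mu_n0; apply: (DG _ _ _ _ _ _ sol m0 tail_le).
have N'ge : ((K2 * (c * g m))%:E <= nint mu N')%E.
  rewrite leNgt; apply/negP => N'lt; move: Nlt; apply/negP; rewrite -leNgt.
  apply: le_trans (le_nint _ _ _ _ NW) _ => //; first exact: measurable_funD.
  by rewrite nintD// mulrDl EFinD leeD// ltW.
pose phi x := 3 * m * cutoff d o 3 1 x.
have m30 : 0 < 3 * m by rewrite mulr_gt0.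
have phi0 x : 0 <= phi x by rewrite mulr_ge0 ?cutoff_ge0 ?ltW.
have phik x : phi x <= 3 * m by rewrite ler_piMr ?cutoff_le1 ?ltW.
have phi_out x : 3 <= d o x -> phi x = 0.
  by move=> ox; rewrite /phi cutoff_eq0 ?mulr0.
have mphi : measurable_fun setT phi.
  by apply: measurable_funM => //; exact: measurable_cutoff sol _ _.
have SC : (nint (mu \x mu)%E (super_gain s Q d g u (super_test u phi)) <=
   (Cs * 1 `^ q * energy g (3 * m) * c)%:E * mu [set x | (0 < super_test u phi x)%R])%E.
  apply: (@super_caccioppoli _ _ _ _ p) => //.
  - exact: sol.
  - by move=> x; exact: kernK dc x.
  - by move=> x y; rewrite -mulrBr normrM gtr0_norm// ler_wpM2l ?(ltW m30)// (cutoff_lip sol).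
  - exact: phi_out.
  - apply: le_trans tail_le _; rewrite lee_fin ler_wpM2l ?(ltW c0)// (pg_homo gG)//.
    by rewrite ler_peMl ?(ltW m0)// ler1n.
have mst : measurable_fun setT (super_test u phi).
  by apply: measurable_maxr0; apply: measurable_funB => //; exact: measurable_pospart sol.
have st0 x : 0 <= super_test u phi x by rewrite le_max lexx orbT.
have mgain := measurable_super_gain sol mst.
have gain0 z : 0 <= super_gain s Q d g u (super_test u phi) z.
  by rewrite /super_gain; case: ifP => // _; nneg; exact: st0.
have st_pos x : 0 < super_test u phi x -> [/\ d o x < 3, 0 <= u x & u x < 3 * m].
  rewrite /super_test lt_max ltxx orbF subr_gt0 => px.
  have upos : u x <= pospart u x by rewrite le_max lexx.
  have pos0 : 0 <= pospart u x by rewrite le_max lexx orbT.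
  have ox : d o x < 3.
    by rewrite ltNge; apply/negP => /phi_out phx; move: px; rewrite phx ltNge pos0.
  split=> //; first by apply: (sol_ge0 sol); lra.
  by apply: le_lt_trans (lt_le_trans px (phik x)).
have gain_ge x y : super_test u phi x / C1 * N' y <=
    super_gain s Q d g u (super_test u phi) (x, y).
  have [px|] := ltP 0 (super_test u phi x); last first.
    move=> px; apply: le_trans (gain0 _).
    by rewrite mulr_le0_ge0// mulr_le0_ge0 ?invr_ge0 ?(ltW C10).
  have [ox ux0 ux3] := st_pos _ px.
  rewrite /N'; case: ifPn => [uy|_]; last by rewrite mulr0.
  have uypos : pospart u y = u y by rewrite /pospart max_l//; lra.
  have py : super_test u phi y <= 0.
    by rewrite ge_max lexx andbT subr_le0 uypos (le_trans (phik y))//; lra.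
  have dxy : 0 < d x y.
    rewrite lt_neqAle d0 andbT eq_sym; apply/eqP => /(rm_eq0 dc) xy.
    by move: uy; rewrite -xy; lra.
  rewrite /super_gain/= py mulrAC ler_pdivrMr//.
  have dle : d x y <= 3 * (1 + d o y).
    have := rm_triangle dc x o y; rewrite (rm_sym dc x o); have := d0 o y; lra.
  have uy0 : 0 <= u y by lra.
  have D0 : 0 < 1 + d o y by rewrite ltr_wpDr.
  have T1 : N y <= La * 3 `^ ga * (g (u y / d x y `^ s) / d x y `^ (Q + s)).
    rewrite /N /tail_density uypos.
    by apply: (tail_kern_comp s01 Q0 gG uy0 _ D0 dxy dle); rewrite ler1n.
  have T2 : g (u y / d x y `^ s) <= La * 2 `^ (q - 1) * g ((u y - u x) / d x y `^ s).
    have ds : 0 <= (u y - u x) / d x y `^ s by rewrite divr_ge0 ?powR_ge0//; lra.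
    apply: le_trans (pg_upper gG _ ds); last by rewrite ler1n.
    apply: (pg_homo gG); rewrite mulrA ler_wpM2r ?invr_ge0 ?powR_ge0//; lra.
  rewrite mulrC (_ : _ * C1 = (La * 3 `^ ga * (La * 2 `^ (q - 1) *
    g ((u y - u x) / d x y `^ s) / d x y `^ (Q + s))) * super_test u phi x); last first.
    by rewrite /C1; ring.
  rewrite ler_wpM2r//; apply: le_trans T1 _.
  by rewrite ler_wpM2l ?mulr_ge0 ?(ltW La0) ?powR_ge0// ler_wpM2r ?invr_ge0 ?powR_ge0.
pose k := K2 * (c * g m) / C1.
have k0 : 0 < k by rewrite /k; npos.
have lower : (nint mu (fun x => super_test u phi x * k)%R <=
    nint (mu \x mu)%E (super_gain s Q d g u (super_test u phi)))%E.
  apply: nint2_ge; [exact: mgain| |exact: gain0| |].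
  - by apply: measurable_funM; [exact: mst|exact: measurable_cst].
  - by move=> x; apply: mulr_ge0; [exact: st0|exact: ltW].
  move=> x; have psx : 0 <= super_test u phi x / C1 by rewrite divr_ge0 ?(ltW C10) ?st0.
  apply: (@le_trans _ _ (nint mu (fun y => super_test u phi x / C1 * N' y)%R)).
    rewrite (nintZ _ mN' psx N'0); apply: le_trans (lee_wpmul2l _ N'ge); last by rewrite lee_fin.
    by rewrite -EFinM lee_fin /k le_eqVlt; apply/orP; left; apply/eqP; ring.
  apply: le_nint.
  - by apply: measurable_funM; [exact: measurable_cst|exact: mN'].
  - exact: measurableT_comp mgain (measurable_pair1 x).
  - by move=> y; apply: mulr_ge0; [exact: psx|exact: N'0].
  - exact: gain_ge.
have mA : measurable_fun setT (fun x => (d o x < 2) && (u x < 2 * m)).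
  by apply: measurable_and; exact: measurable_fun_ltr.
have mk0 : 0 < m * k by rewrite mulr_gt0.
have low2 : ((m * k)%:E * mu [set x | ((d o x < 2) && (u x < 2 * m))%R] <=
    nint mu (fun x => super_test u phi x * k)%R)%E.
  rewrite -nint_if_cst ?(ltW mk0)//; apply: le_nint.
  - exact: measurable_fun_ifT.
  - by apply: measurable_funM; [exact: mst|exact: measurable_cst].
  - by move=> x; case: ifP => // _; rewrite ltW.
  - move=> x; case: ifPn => [/andP[ox ux]|_]; last by rewrite mulr_ge0 ?st0 ?ltW.
    rewrite ler_wpM2r ?(ltW k0)// /super_test.
    have ux0 : 0 <= u x by apply: (sol_ge0 sol); lra.
    rewrite /phi cutoff_eq1 ?mulr1 ?mul1r; last by lra.
    by rewrite /pospart (max_l ux0) le_max; apply/orP; left; lra.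
have B3 : (mu [set x | (0 < super_test u phi x)%R] <= (La * c * 3 `^ Q)%:E)%E.
  apply: le_trans (rm_ball_le dc o _) => //; apply: le_measure; rewrite ?inE.
  - by apply: measurable_pred; exact: measurable_fun_ltr.
  - by apply: measurable_pred; exact: measurable_fun_ltr.
  - by move=> x /= /st_pos[].
have := le_trans low2 (le_trans lower SC).
have Ck0 : 0 <= Cs * 1 `^ q * energy g (3 * m) * c.
  by nneg; exact: energy_ge0 gG _.
move=> /le_trans/(_ (lee_wpmul2l _ B3)); rewrite lee_fin => /(_ Ck0).
rewrite -lee_pdivlMl// -!EFinM => /le_trans; apply; rewrite lee_fin ler_pdivrMl//.
have E3 : energy g (3 * m) <= La * 3 `^ q * energy g m.
  by apply: (energy_upper p1 pq gG); rewrite ?ler1n ?ltW.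
apply: (@le_trans _ _ (Cs * 1 `^ q * (La * 3 `^ q * energy g m) * c * (La * c * 3 `^ Q))).
  have c1 : 0 <= La * c * 3 `^ Q by nneg.
  by rewrite ler_wpM2r// ler_wpM2r ?(ltW c0)// ler_wpM2l// mulr_ge0 ?powR_ge0 ?ltW.
rewrite powR1 /k /K2 /energy le_eqVlt; apply/orP; left; apply/eqP; field.
by rewrite !gt_eqF.
Qed.

End expansion.

Lemma subrX_le (R : realDomainType) (a b : R) n : 0 <= b <= a ->
  a ^+ n.+1 - b ^+ n.+1 <= n.+1%:R * a ^+ n * (a - b).
Proof.
move=> /andP[b0 ba]; have a0 := le_trans b0 ba.
elim: n => [|n IH]; first by rewrite expr0 !expr1 mulr1 mul1r.
rewrite (_ : _ - _ = a * (a ^+ n.+1 - b ^+ n.+1) + b ^+ n.+1 * (a - b)); last first.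
  by rewrite !exprS; ring.
rewrite (_ : n.+2%:R * a ^+ n.+1 * (a - b) =
    a * (n.+1%:R * a ^+ n * (a - b)) + a ^+ n.+1 * (a - b)); last first.
  by rewrite !exprS -[n.+2%:R]natr1; ring.
by rewrite lerD ?ler_wpM2l ?ler_wpM2r ?subr_ge0// lerXn2r ?nnegrE.
Qed.

(** * Caccioppoli estimate above a level *)

Section sub.
Context {R : realType} {dX : measure_display} {X : measurableType dX}.
Variables (mu : {sigma_finite_measure set X -> \bar R}) (p q s Q La : R).
Hypotheses (p1 : 1 < p) (pq : p <= q) (s01 : 0 < s < 1) (Q0 : 0 < Q) (La1 : 1 <= La).

Let La0 : 0 < La. Proof. exact: lt_le_trans La1. Qed.
Let q1 : 1 < q. Proof. exact: lt_le_trans pq. Qed.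
Let q0 : 0 < q. Proof. exact: lt_trans q1. Qed.
Let s0 : 0 < s. Proof. by case/andP: s01. Qed.

Variables (d : X -> X -> R) (c : R) (g : R -> R) (o : X) (u : X -> R).
Hypothesis sol : solution mu p q s Q La d c g o u.
Variable K : R.
Hypotheses (K0 : 0 < K)
  (kernK : forall x, (nint mu (fun y => kern p s Q (d x y))%R <= (K * c)%:E)%E).

Local Notation H := (energy g).
Local Notation kern := (kern p s Q).
Local Notation P := (tail_density s Q d g o (pospart u)).

Let dc : regular_metric mu Q La d c. Proof. exact: sol_metric sol. Qed.
Let gG : power_growth p q La g. Proof. exact: sol_growth sol. Qed.
Let mu_u : measurable_fun setT u. Proof. exact: sol_measurable sol. Qed.
Let d0 x y : 0 <= d x y. Proof. exact: rm_ge0 dc _ _. Qed.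
Let c0 : 0 < c. Proof. exact: rm_gt0 dc. Qed.
Let H0 t : 0 <= H t. Proof. exact: energy_ge0 gG _. Qed.
Let g0 t : 0 <= g t. Proof. exact: pg_ge0 gG _. Qed.
Let mg : measurable_fun setT g. Proof. exact: measurable_pg gG. Qed.
Let mH : measurable_fun setT H. Proof. exact: measurable_energy gG. Qed.
Let md2 : measurable_fun setT (fun z : X * X => d z.1 z.2).
Proof. exact: rm_measurable dc. Qed.
Let md1 x : measurable_fun setT (fun y => d x y).
Proof. exact: regular_dist1 dc. Qed.
Let kern0 t : 0 <= kern t. Proof. exact: kern_ge0. Qed.
Let P0 y : 0 <= P y. Proof. exact: (tail_density_ge0 sol). Qed.
Let mP : measurable_fun setT P.
Proof. by apply: (measurable_tail_density sol); exact: measurable_pospart sol. Qed.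

Definition excess (k : R) (x : X) : R := Num.max (u x - k) 0.

Lemma excess_ge0 k x : 0 <= excess k x. Proof. by rewrite le_max lexx orbT. Qed.

Lemma excess_homo k k' x : k <= k' -> excess k' x <= excess k x.
Proof.
by move=> kk; rewrite /excess ge_max !le_max lexx orbT andbT lerD2l lerN2 kk.
Qed.

Lemma measurable_excess k : measurable_fun setT (excess k).
Proof. by apply: measurable_maxr0; exact: measurable_funB. Qed.

(** The power satisfies [n + 1 >= q], so that [eta ^ n] absorbs the factor [eta ^ (- (q - 1))] that
    arises in [nflux_le]. *)
Definition sub_test (eta : X -> R) (n : nat) (k : R) (x : X) : R :=
  excess k x * eta x ^+ n.+1.

(** The part of the flux over pairs whose second point lies below the level; there the excess at the
    first point is at most [u z.1 - u z.2]. *)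
Definition sub_gain (eta : X -> R) (n : nat) (k : R) (z : X * X) : R :=
  if u z.2 <= k then
    g (excess k z.1 / d z.1 z.2 `^ s) * sub_test eta n k z.1 / d z.1 z.2 `^ (Q + s)
  else 0.

Definition sub_const1 (n : nat) := La * n.+1%:R `^ q * La ^+ 2.
Definition sub_const2 := La * 5 `^ (s * (q - 1) + (Q + s)).

Variables (eta : X -> R) (n : nat) (k t L : R).
Hypotheses (meta : measurable_fun setT eta) (qn : q <= n.+1%:R) (k0 : 0 <= k) (L1 : 1 <= L).
Hypotheses (eta0 : forall x, 0 <= eta x) (eta1 : forall x, eta x <= 1).
Hypothesis etaL : forall x y, `|eta x - eta y| <= L * d x y.
Hypothesis eta_out : forall x, t <= d o x -> eta x = 0.
Hypothesis tL3 : t + L^-1 <= 3.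

Local Notation w := (excess k).
Local Notation psi := (sub_test eta n k).
Local Notation G := (sub_gain eta n k).
Local Notation ga := (s * (q - 1) + (Q + s)).

Let L0 : 0 < L. Proof. exact: lt_le_trans L1. Qed.
Let w0 x : 0 <= w x. Proof. exact: excess_ge0. Qed.
Let mw : measurable_fun setT w. Proof. exact: measurable_excess. Qed.

Let mpsi : measurable_fun setT psi.
Proof. by apply: measurable_funM => //; exact: measurable_funX. Qed.

Let psi0 x : 0 <= psi x. Proof. by rewrite mulr_ge0// exprn_ge0. Qed.

Let psi_le x : psi x <= w x.
Proof. by rewrite ler_piMr// exprn_ile1. Qed.

Let psi_out x : t <= d o x -> psi x = 0.
Proof. by move=> ox; rewrite /sub_test eta_out// expr0n/= mulr0. Qed.

Let t3 : t <= 3.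
Proof. by apply: le_trans tL3; rewrite lerDl invr_ge0 ltW. Qed.

Let psi3 x : 3 <= d o x -> psi x = 0.
Proof. by move=> ox; rewrite psi_out// (le_trans t3). Qed.

Let C1 := sub_const1 n * L `^ q.
Let C2 := sub_const2 * L `^ ga.
Let F (z : X * X) := (if d o z.1 < t + L^-1 then C1 * H (w z.1) * kern (d z.1 z.2) else 0)
  + (if d o z.1 < t then C2 * w z.1 * P z.2 else 0).

Let C10 : 0 <= C1. Proof. by rewrite /C1 /sub_const1; nneg. Qed.
Let C20 : 0 <= C2. Proof. by rewrite /C2 /sub_const2; nneg. Qed.

Let F0 z : 0 <= F z.
Proof. by rewrite /F addr_ge0//; case: ifP => // _; nneg. Qed.

Let D_kern x y : w x * `|eta x - eta y| <= w x /\
  w x * `|eta x - eta y| <= w x * (L * d x y).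
Proof.
split; last by rewrite ler_wpM2l.
rewrite ler_piMr// ler_norml; have := eta0 x; have := eta0 y; have := eta1 x.
by have := eta1 y => *; apply/andP; split; lra.
Qed.

Let E_kern x y : H (w x * `|eta x - eta y| / d x y `^ s) / d x y `^ Q <=
  La ^+ 2 * L `^ q * H (w x) * kern (d x y).
Proof.
have [D1 D2] := D_kern x y; apply: (@energy_kern _ p q) => //.
by rewrite D1 andbT mulr_ge0.
Qed.

(** Minus the flux is positive only if [psi y > psi x] although [u x > u y]. This forces the
    increase of [eta] to outweigh the decrease of the excess, which bounds [u x - u y] by the
    variation of [eta]; so no energy of the excess has to be absorbed. Beyond [t + 1 / L] the point
    [x] enters through the tail, in [F (y, x)]. *)
Let nflux_le x y : u y <= u x -> - flux s Q d g u psi (x, y) <= F (x, y) + F (y, x).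
Proof.
rewrite le_eqVlt => /predU1P[uxy|uyx].
  by rewrite (flux_eq0 _ _ _ _ _ (esym uxy)) oppr0 addr_ge0.
rewrite flux_gt// -mulNr -mulrN opprB.
have [pyx|pxy] := leP (psi y) (psi x).
  apply: le_trans (addr_ge0 (F0 _) (F0 _)).
  by rewrite mulr_le0_ge0 ?invr_ge0 ?powR_ge0// mulr_ge0_le0// subr_le0.
have py : 0 < psi y by exact: le_lt_trans pxy.
have oy : d o y < t.
  by rewrite ltNge; apply/negP => /psi_out py0; rewrite py0 ltxx in py.
have wy : 0 < w y.
  by rewrite lt_neqAle w0 andbT; apply/eqP => wy; move: py; rewrite /sub_test -wy mul0r ltxx.
have uyk : k < u y by move: wy; rewrite /excess lt_max ltxx orbF subr_gt0.
have wyE : w y = u y - k by rewrite /excess max_l// subr_ge0 ltW.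
have wxE : w x = u x - k by rewrite /excess max_l// subr_ge0 ltW// (lt_trans uyk).
have uw : u x - u y = w x - w y by rewrite wxE wyE; ring.
have wxy : 0 < w x - w y by rewrite -uw subr_gt0.
have dxy : 0 < d x y.
  rewrite lt_neqAle d0 andbT eq_sym; apply/eqP => /(rm_eq0 dc) xy.
  by move: uyx; rewrite xy ltxx.
have [ox|ox] := ltP (d o x) (t + L^-1).
  apply: le_trans (_ : F (x, y) <= _); last by rewrite lerDl.
  apply: le_trans (_ : C1 * H (w x) * kern (d x y) <= _); last first.
    by rewrite /F/= ox lerDl; case: ifP => // _; nneg.
  have fy : 0 < eta y.
    rewrite lt_neqAle eta0 andbT; apply/eqP => ey; move: py.
    by rewrite /sub_test -ey expr0n/= mulr0 ltxx.
  have exy : eta x < eta y.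
    rewrite ltNge; apply/negP => eyx; move: pxy; apply/negP; rewrite -leNgt.
    rewrite ler_pM ?exprn_ge0//; first by lra.
    by rewrite lerXn2r ?nnegrE.
  pose D := w x * (eta y - eta x).
  have DE : w x * `|eta x - eta y| = D by rewrite ler0_norm ?opprB// subr_le0 ltW.
  have D0 : 0 <= D by rewrite mulr_ge0// subr_ge0 ltW.
  have EK := E_kern x y; rewrite DE in EK.
  have n0 : 0 < n.+1%:R :> R by rewrite ltr0n.
  (* The mean value bound for the power of [eta]. Positivity of the left-hand side then gives
     [(w x - w y) eta y < (n + 1) D]. *)
  have key : psi y - psi x <= eta y ^+ n * (n.+1%:R * D - (w x - w y) * eta y).
    have := @subrX_le _ (eta y) (eta x) n; rewrite eta0/= ltW// => /(_ isT).
    move=> /(ler_wpM2l (w0 x)) h; rewrite /sub_test.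
    rewrite (_ : _ - _ = w x * (eta y ^+ n.+1 - eta x ^+ n.+1) - (w x - w y) * eta y ^+ n.+1); last by ring.
    apply: le_trans (lerD h (lexx _)) _; rewrite /D exprS.
    by rewrite le_eqVlt; apply/orP; left; apply/eqP; ring.
  have lt : (w x - w y) * eta y < n.+1%:R * D.
    have : 0 < psi y - psi x by rewrite subr_gt0.
    by move=> /lt_le_trans/(_ key); rewrite pmulr_rgt0 ?exprn_gt0// subr_gt0.
  (* With this ratio [u x - u y <= l D], and the upper growth of [g] costs [l ^ (q - 1)], which
     [eta y ^ n] compensates. *)
  pose l := n.+1%:R / eta y.
  have l1 : 1 <= l by rewrite ler_pdivlMr// mul1r (le_trans (eta1 y))// ler1n.
  have gle : g ((u x - u y) / d x y `^ s) <= La * l `^ (q - 1) * g (D / d x y `^ s).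
    apply: le_trans (pg_upper gG l1 _); last by nneg.
    apply: (pg_homo gG); rewrite mulrA ler_wpM2r ?invr_ge0 ?powR_ge0//.
    by rewrite uw /l mulrAC ler_pdivlMr// ltW.
  have pse : psi y - psi x <= eta y ^+ n * (n.+1%:R * D).
    apply: le_trans key _; rewrite ler_wpM2l ?exprn_ge0//.
    by rewrite gerBl mulr_ge0// ltW.
  apply: le_trans (_ : La * l `^ (q - 1) * g (D / d x y `^ s) *
    (eta y ^+ n * (n.+1%:R * D)) / d x y `^ (Q + s) <= _).
    rewrite ler_wpM2r ?invr_ge0 ?powR_ge0// ler_pM// subr_ge0 ltW//.
  have le1 : l `^ (q - 1) * eta y ^+ n * n.+1%:R <= n.+1%:R `^ q.
    rewrite /l powRM ?invr_ge0 ?(ltW n0)// powRV//.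
    rewrite -[leRHS](mulr_powRB1 (ltW n0) q0) mulrC -mulrA ler_wpM2l ?(ltW n0)//.
    rewrite ler_piMr ?powR_ge0// mulrC ler_pdivrMr ?powR_gt0// mul1r -powR_mulrn//.
    by rewrite ger_powR ?fy ?eta1//; have := qn; rewrite -natr1; lra.
  rewrite (_ : _ / _ = La * (l `^ (q - 1) * eta y ^+ n * n.+1%:R) *
     (g (D / d x y `^ s) * D / d x y `^ (Q + s))); last by ring.
  rewrite energy_kernE//.
  apply: le_trans (_ : La * n.+1%:R `^ q * (La ^+ 2 * L `^ q * H (w x) * kern (d x y)) <= _).
    apply: ler_pM EK; [nneg| nneg|].
    by rewrite ler_wpM2l ?(ltW La0).
  by rewrite /C1 /sub_const1 le_eqVlt; apply/orP; left; apply/eqP; ring.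
apply: le_trans (_ : F (y, x) <= _); last by rewrite lerDr.
apply: le_trans (_ : C2 * w y * P x <= _); last first.
  by rewrite /F/= oy lerDr; case: ifP => // _; nneg.
have -> : psi x = 0.
  by apply: psi_out; apply: le_trans ox; rewrite lerDl invr_ge0 ltW.
rewrite subr0.
have oxy : d o x <= d o y + d y x by exact: rm_triangle dc _ _ _.
(* The distance is at least the gap [1 / L]; as [d o y < t <= 3], this yields
   [1 + d o x <= 5 L d x y]. *)
have Ld : 1 <= L * d x y.
  rewrite -ler_pdivrMl// mulr1 (rm_sym dc x y); lra.
have e1 : 1 + d o x <= 5 * L * d x y.
  have h1 : d x y <= L * d x y by rewrite ler_peMl.
  have h2 : d y x = d x y := rm_sym dc y x.
  have := t3; rewrite -mulrA; lra.
have ux0 : 0 <= u x by rewrite (le_trans k0)// ltW// (lt_trans uyk).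
have px : pospart u x = u x by rewrite /pospart max_l.
have T1 : g (u x / d x y `^ s) / d x y `^ (Q + s) <= La * (5 * L) `^ ga * P x.
  rewrite /tail_density px; apply: (tail_kern_comp s01 Q0 gG) => //.
  - by rewrite mulr_ege1// ler1n.
  - by rewrite ltr_wpDr.
apply: le_trans (_ : g (u x / d x y `^ s) / d x y `^ (Q + s) * w y <= _).
  rewrite [leRHS]mulrAC ler_wpM2r ?invr_ge0 ?powR_ge0// ler_pM//.
  have uy0 : 0 <= u y by rewrite (le_trans k0)// ltW.
  by apply: (pg_homo gG); rewrite ler_wpM2r ?invr_ge0 ?powR_ge0// gerBl.
apply: le_trans (ler_wpM2r (w0 y) T1) _.
rewrite powRM ?(ltW L0)// /C2 /sub_const2 le_eqVlt; apply/orP; left; apply/eqP; ring.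
Qed.

Let G0 z : 0 <= G z.
Proof. by rewrite /sub_gain; case: ifP => // _; nneg. Qed.

Let G_le z : G z <= Num.max (flux s Q d g u psi z) 0.
Proof.
case: z => x y; rewrite /sub_gain/=; case: ifPn => [uy|_]; last by rewrite le_max lexx orbT.
have wy : w y = 0 by rewrite /excess max_r// subr_le0.
have py : psi y = 0 by rewrite /sub_test wy mul0r.
have [ux|ux] := leP (u x) k.
  have wx : w x = 0 by rewrite /excess max_r// subr_le0.
  by rewrite wx mul0r (pg0 gG) !mul0r le_max lexx orbT.
have wx : w x = u x - k by rewrite /excess max_l// subr_ge0 ltW.
rewrite flux_gt ?(le_lt_trans uy)// py subr0 le_max; apply/orP; left.
rewrite ler_wpM2r ?invr_ge0 ?powR_ge0// ler_wpM2r//.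
by apply: (pg_homo gG); rewrite wx ler_wpM2r ?invr_ge0 ?powR_ge0//; lra.
Qed.

Let mF : measurable_fun setT F.
Proof.
have md : measurable_fun setT (fun z : X * X => d o z.1).
  exact: measurable_fst_comp (md1 o).
have mwz : measurable_fun setT (fun z : X * X => w z.1) by exact: measurable_fst_comp.
apply: measurable_funD; apply: measurable_fun_ifT => //.
- exact: measurable_fun_ltr.
- apply: measurable_funM; last by apply: measurableT_comp md2; exact: measurable_kern.
  by apply: measurable_funM => //; exact: measurableT_comp mH mwz.
- exact: measurable_fun_ltr.
- apply: measurable_funM; last exact: measurable_snd_comp mP.
  exact: measurable_funM.
Qed.

Lemma measurable_sub_gain : measurable_fun setT G.
Proof.
apply: measurable_fun_ifT => //.
- by apply: measurable_fun_ler => //; exact: measurable_snd_comp.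
- apply: measurable_div_powR => //; apply: measurable_funM; last exact: measurable_fst_comp.
  apply: measurableT_comp mg _; apply: measurable_div_powR => //.
  exact: measurable_fst_comp.
Qed.

Let pos_u x : d o x < 3 -> w x <= u x.
Proof.
move=> ox; have ux : 0 <= u x by apply: (sol_ge0 sol); lra.
by rewrite /excess ge_max ux andbT gerBl.
Qed.

Let psi_energy0 : (nint mu (fun x => H `|psi x|)%R < +oo)%E.
Proof.
apply: le_lt_trans (sol_energy0 sol); apply: le_nint => //.
- by apply: measurableT_comp mH _; exact: measurableT_comp.
- apply: measurable_fun_ifT => //; first exact: measurable_fun_ltr.
  exact: measurableT_comp mH _.
- move=> x; rewrite ger0_norm//; case: ifPn => [ox|]; last first.
    by rewrite -leNgt => /psi3 ->; rewrite energy0.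
  by apply: (energy_homo gG); rewrite (le_trans (psi_le x))// pos_u.
Qed.

(** Here the test function is unbounded, so the variation of the cutoff is weighted by [H (u x)],
    whose integral over the ball of radius [3] is finite by [sol_energy0]. *)
Let psi_energy : (nint (mu \x mu)%E (energy_density s Q d g psi) < +oo)%E.
Proof.
have A0 : 0 <= La * 2 `^ q by nneg.
have C00 : 0 <= La * n.+1%:R `^ q * (La ^+ 2 * L `^ q) by nneg.
pose B1 (z : X * X) := (if d o z.1 < 3 then H (u z.1) else 0) * kern (d z.1 z.2).
pose B2 (z : X * X) := if d o z.1 < 3 then energy_density s Q d g u z else 0.
pose B z := La * 2 `^ q * (La * n.+1%:R `^ q * (La ^+ 2 * L `^ q) * B1 z + B2 z).
have ed0 f z : 0 <= energy_density s Q d g f z by exact: (energy_density_ge0 sol).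
have B10 z : 0 <= B1 z by rewrite /B1 mulr_ge0//; case: ifP.
have B20 z : 0 <= B2 z by rewrite /B2; case: ifP.
have B0 z : 0 <= B z by rewrite /B mulr_ge0// addr_ge0// mulr_ge0.
have mbz : measurable_fun setT (fun z : X * X => d o z.1 < 3).
  by apply: measurable_fun_ltr => //; exact: measurable_fst_comp (md1 o).
have mif : measurable_fun setT (fun x => if d o x < 3 then H (u x) else 0).
  by apply: measurable_fun_ifT => //; [exact: measurable_fun_ltr|exact: measurableT_comp mH _].
have mB1 : measurable_fun setT B1.
  apply: measurable_funM; first exact: (measurable_fst_comp mif).
  by apply: measurableT_comp md2; exact: measurable_kern.
have mB2 : measurable_fun setT B2.
  by apply: measurable_fun_ifT => //; exact: (measurable_energy_density sol).
have mCB : measurable_fun setT (fun z => La * n.+1%:R `^ q * (La ^+ 2 * L `^ q) * B1 z).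
  exact: measurable_funM.
have mB : measurable_fun setT B.
  by apply: measurable_funM => //; exact: measurable_funD.
have Bfin : (nint (mu \x mu)%E B < +oo)%E.
  rewrite nintZ//; [|exact: measurable_funD|by move=> z; rewrite addr_ge0// mulr_ge0].
  rewrite nintD//; last by move=> z; rewrite mulr_ge0.
  rewrite nintZ// lte_mul_pinfty ?lee_fin// lte_add_pinfty//; last exact: sol_energy sol.
  rewrite lte_mul_pinfty ?lee_fin//.
  apply: le_lt_trans (nint2_le mB1 (_ : measurable_fun setT (fun x => K * c *
     (if d o x < 3 then H (u x) else 0))) B10 _) _.
  - exact: measurable_funM.
  - move=> x /=; rewrite /B1/= nintZ//; last 2 first.
    + by apply: measurableT_comp (md1 x); exact: measurable_kern.
    + by case: ifP.
    rewrite muleC EFinM; apply: lee_wpmul2r; first by rewrite lee_fin; case: ifP.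
    exact: kernK.
  - rewrite nintZ//; last 2 first.
    + by rewrite mulr_ge0 ?ltW.
    + by move=> x; case: ifP.
    rewrite lte_mul_pinfty ?lee_fin ?mulr_ge0 ?ltW//; exact: sol_energy0 sol.
apply: le_lt_trans (_ : nint (mu \x mu)%E (fun z => B z + B (z.2, z.1))%R < +oo)%E.
  apply: le_nint.
  - exact: (measurable_energy_density sol).
  - by apply: measurable_funD => //; exact: measurable_swap.
  - exact: ed0.
  - have key x y : d o x < 3 -> energy_density s Q d g psi (x, y) <= B (x, y).
      move=> dx; rewrite /B /B1 /B2 /= dx.
      have lip : `|psi x - psi y| <= n.+1%:R * (w x * `|eta x - eta y|) + `|u x - u y|.
        rewrite (_ : _ - _ = w x * (eta x ^+ n.+1 - eta y ^+ n.+1) +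
          eta y ^+ n.+1 * (w x - w y)); last by rewrite /sub_test; ring.
        apply: le_trans (ler_normD _ _) _; apply: lerD.
          rewrite normrM ger0_norm// mulrCA ler_wpM2l//.
          have XX (a b : R) : 0 <= b <= a -> a <= 1 ->
              `|a ^+ n.+1 - b ^+ n.+1| <= n.+1%:R * `|a - b|.
            move=> /andP[b0 ba] a1; have a0 := le_trans b0 ba.
            rewrite !ger0_norm ?subr_ge0// ?lerXn2r ?nnegrE//.
            apply: le_trans (subrX_le n _) _; first by rewrite b0.
            by rewrite ler_wpM2r ?subr_ge0// ler_piMr// exprn_ile1.
          have [exy|eyx] := leP (eta y) (eta x); first by rewrite XX ?eta0 ?eta1 ?exy.
          by rewrite distrC [`|eta x - _|]distrC XX ?eta0 ?eta1 ?ltW.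
        rewrite normrM ger0_norm ?exprn_ge0// -[leRHS]mul1r ler_pM ?exprn_ge0 ?exprn_ile1//.
        apply: le_trans (maxr0_lip _ _) _.
        by rewrite (_ : _ - _ = u x - u y)//; ring.
      have kE : H (n.+1%:R * (w x * `|eta x - eta y|) / d x y `^ s) / d x y `^ Q <=
          La * n.+1%:R `^ q * (La ^+ 2 * L `^ q) * (H (u x) * kern (d x y)).
        have h1 : H (n.+1%:R * (w x * `|eta x - eta y|) / d x y `^ s) <=
            La * n.+1%:R `^ q * H (w x * `|eta x - eta y| / d x y `^ s).
          rewrite -mulrA; apply: (energy_upper p1 pq gG); first by rewrite ler1n.
          by nneg.
        apply: le_trans (ler_wpM2r _ h1) _; first by nneg.
        rewrite -[leLHS]mulrA -[leRHS]mulrA ler_wpM2l//; first by nneg.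
        apply: le_trans (E_kern x y) _.
        rewrite mulrA ler_wpM2r// ler_wpM2l//; first by nneg.
        by apply: (energy_homo gG); exact: pos_u.
      apply: le_trans (_ : La * 2 `^ q * (H (n.+1%:R * (w x * `|eta x - eta y|) / d x y `^ s)
         / d x y `^ Q + H (`|u x - u y| / d x y `^ s) / d x y `^ Q) <= _).
        rewrite -mulrDl mulrA ler_wpM2r ?invr_ge0 ?powR_ge0//.
        apply: le_trans (energy_add p1 pq La1 gG _ _); rewrite ?divr_ge0 ?powR_ge0 ?mulr_ge0//.
        by apply: (energy_homo gG); rewrite -mulrDl ler_wpM2r ?invr_ge0 ?powR_ge0.
      by rewrite ler_wpM2l// lerD2r.
    move=> [x y] /=; have [dx|dx] := ltP (d o x) 3.
      by rewrite (le_trans (key _ _ dx))// lerDl.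
    have [dy|dy] := ltP (d o y) 3; last first.
      rewrite /energy_density/= !psi3// subrr normr0 mul0r energy0 mul0r.
      by rewrite addr_ge0.
    rewrite (le_trans _ (_ : B (y, x) <= _)) ?lerDr//.
    apply: le_trans (key _ _ dy); rewrite le_eqVlt; apply/orP; left.
    by rewrite /energy_density/= distrC (rm_sym dc).
rewrite nintD//; last exact: measurable_swap.
by rewrite nint_swap// lte_add_pinfty.
Qed.

Lemma sub_caccioppoli (tau : R) : 0 <= tau -> (nint mu P <= tau%:E)%E ->
  (nint (mu \x mu)%E G <= 2%:E * nint mu (fun x => if d o x < t + L^-1 then
     sub_const1 n * L `^ q * K * c * H (w x) + sub_const2 * L `^ ga * tau * w x else 0)%R)%E.
Proof.
move=> tau0 tauP.
apply: le_trans (weak_ineq sol mpsi psi3 psi_energy0 psi_energy mF measurable_sub_gain F0 G0 _) _.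
  by right; split; [exact: nflux_le|exact: G_le].
rewrite lee_wpmul2l ?lee_fin//.
apply: nint2_le => //.
  apply: measurable_fun_ifT => //; first exact: measurable_fun_ltr.
  apply: measurable_funD; apply: measurable_funM => //.
  exact: measurableT_comp mH mw.
move=> x; have mk : measurable_fun setT (fun y => kern (d x y)).
  by apply: measurableT_comp (md1 x); exact: measurable_kern.
have E : (nint mu (fun y => F (x, y))%R <=
  ((if (d o x < t + L^-1)%R then (C1 * H (w x) * (K * c))%R else 0%R) +
   (if (d o x < t)%R then (C2 * w x * tau)%R else 0%R))%:E)%E.
  rewrite /F/= nintD//; last 4 first.
  - by apply: measurable_fun_ifT => //; exact: measurable_funM.
  - by apply: measurable_fun_ifT => //; exact: measurable_funM.
  - by move=> y; case: ifP => // _; nneg.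
  - by move=> y; case: ifP => // _; nneg.
  rewrite EFinD leeD//.
    case: ifP => _; last by rewrite /nint integral0.
    rewrite nintZ//; last by nneg.
    by rewrite (EFinM _ (K * c)) lee_wpmul2l ?lee_fin//; nneg.
  case: ifP => _; last by rewrite /nint integral0.
  rewrite nintZ//; last by nneg.
  by rewrite (EFinM _ tau) lee_wpmul2l ?lee_fin//; nneg.
apply: le_trans E _; rewrite lee_fin.
case: ifPn => [_|].
  rewrite lerD//.
    by rewrite /C1 le_eqVlt; apply/orP; left; apply/eqP; ring.
  case: ifP => _; last by rewrite -/C2; nneg.
  by rewrite /C2 le_eqVlt; apply/orP; left; apply/eqP; ring.
rewrite -leNgt => tx; rewrite ifF ?addr0//; apply/negbTE; rewrite -leNgt.
by apply: le_trans tx; rewrite lerDl invr_ge0 ltW.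
Qed.

End sub.

Lemma nint_markov (R : realType) (dT : measure_display) (T : measurableType dT)
    (mu : {measure set T -> \bar R}) (b : T -> bool) (f : T -> R) (a : R) :
  measurable_fun setT b -> measurable_fun setT f -> 0 <= a -> (forall x, 0 <= f x) ->
  (forall x, b x -> a <= f x) -> (a%:E * mu [set x | b x] <= nint mu f)%E.
Proof.
move=> mb mf a0 f0 bf; rewrite -nint_if_cst//; apply: le_nint => //.
- exact: measurable_fun_ifT.
- by move=> x; case: ifP.
- by move=> x; case: ifPn => // /bf.
Qed.

(** * Local boundedness with an explicit dependence on the gap of the radii *)

Section boundedness.
Context {R : realType} {dX : measure_display} {X : measurableType dX}.
Variables (mu : {sigma_finite_measure set X -> \bar R}) (p q s Q La : R).
Hypotheses (p1 : 1 < p) (pq : p <= q) (s01 : 0 < s < 1) (Q0 : 0 < Q) (La1 : 1 <= La).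

Let La0 : 0 < La. Proof. exact: lt_le_trans La1. Qed.
Let p0 : 0 < p. Proof. exact: lt_trans p1. Qed.
Let q1 : 1 < q. Proof. exact: lt_le_trans pq. Qed.
Let q0 : 0 < q. Proof. exact: lt_trans q1. Qed.
Let s0 : 0 < s. Proof. by case/andP: s01. Qed.

(** De Giorgi iteration on the radii [t + 2 ^ (- j) / L] and levels [k (1 - 2 ^ (- j))] for the
    energies [Y j]. The condition [Y j <= B0 th ^ j] is kept because it makes the set above an
    intermediate level small enough for [gain_lower] at radius [rho j]. *)
Lemma sub_de_giorgi : exists nu ga : R, [/\ 0 < nu, 0 <= ga & forall d c g o u k t L,
  solution mu p q s Q La d c g o u -> 0 < k -> 1 <= L -> t + L^-1 <= 3 ->
  (nint mu (tail_density s Q d g o (pospart u)) <= (c * g k)%:E)%E ->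
  (nint mu (fun x => if d o x < t + L^-1 then energy g (pospart u x) else 0)%R <=
    (nu * L `^ (- ga) * (c * energy g k))%:E)%E ->
  mu [set x | ((d o x < t) && (k < u x))%R] = 0%E].
Proof.
have [K K0 kernK] := kern_integral mu p1 s01 Q0 La1.
pose n := Num.truncn q.
have qn : q <= n.+1%:R by rewrite ltW// real_truncnS_gt// num_real.
pose g0 := s * (q - 1) + (Q + s).
have g00 : 0 < g0 by rewrite addr_gt0 ?addr_gt0 ?mulr_gt0// subr_gt0.
(* Bounds both losses as powers of the slope: [q] from the energy of the cutoff, and [g0 + (q - 1)]
   from the tail term. *)
pose gam := g0 + q.
have gam0 : 0 < gam by rewrite addr_gt0.
pose S1 := sub_const1 q La n; pose S2 := sub_const2 q s Q La.
have S10 : 0 < S1 by rewrite /S1 /sub_const1; npos; rewrite ltr0n.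
have S20 : 0 < S2 by rewrite /S2 /sub_const2; npos.
pose C3 := S1 * K + S2 * La.
have C30 : 0 < C3 by rewrite /C3; npos.
pose a := s * p.
have a0 : 0 < a by rewrite mulr_gt0.
(* With [rho j = eps L ^ (- be) 2 ^ (- be j)], the gain [rho j ^ a] cancels the powers of [L] and of
   [2 ^ j] in the loss [Lj ^ gam]. *)
pose be := gam / a.
have be1 : 1 <= be.
  rewrite ler_pdivlMr// mul1r /a /gam; have sp : s * p <= p.
    by rewrite ler_piMl ?(ltW p0)// ltW//; case/andP: s01.
  by rewrite (le_trans sp)// (le_trans pq)// lerDr ltW.
have be0 : 0 < be by rewrite (lt_le_trans _ be1).
pose tau : R := 2 `^ (- be).
have tau0 : 0 < tau by rewrite powR_gt0.
have tau2 : tau <= 2^-1.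
  by rewrite /tau powRN lef_pV2 ?posrE ?powR_gt0// -[leLHS](powRr1 (_ : 0 <= 2))// ler_powR// ler1n.
have tau_a : tau `^ a = (2 `^ gam)^-1.
  by rewrite -powRrM mulNr mulfVK ?gt_eqF// powRN.
(* [tau ^ Q] is the rate of [rho j ^ Q]; the extra [2 ^ (- q)] pays for Markov's inequality, which
   loses [2 ^ q] per step because the levels approach each other. *)
pose th := tau `^ Q * (2 `^ q)^-1.
have th01 : 0 < th <= 1.
  rewrite mulr_gt0 ?powR_gt0 ?invr_gt0 ?powR_gt0//= mulr_ile1 ?powR_ge0 ?invr_ge0 ?powR_ge0//.
    by rewrite powR_le1 ?(ltW Q0)// (ltW tau0) (le_trans tau2)// invf_le1// ler1n.
  by rewrite invf_le1 ?powR_gt0// -[leLHS](powRr0 2) ler_powR ?ler1n ?ltW.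
have /andP[th0 th1] := th01.
pose D := 4 * La * C3 * 4 `^ gam.
have D0 : 0 <= D by rewrite ltW// /D; npos.
have [eps /andP[eps0 eps2] Deps] := small_powR D0 a0 th01.
(* These make the hypothesis on the energy exactly [Y 0 <= B0], where
   [eL ^ Q = eps ^ Q L ^ (- be Q)]. *)
exists (eps `^ Q / (2 * La * 4 `^ q)), (be * Q); split.
- by npos.
- by nneg.
move=> d c g o u k t L sol k0 L1 tL3 tail_le Y0_le.
have dc := sol_metric sol; have gG := sol_growth sol; have c0 := rm_gt0 dc.
have mu_u := sol_measurable sol; have mdo := regular_dist1 o dc.
have gge0 := pg_ge0 gG; have Hge0 := energy_ge0 gG.
have L0 : 0 < L by rewrite (lt_le_trans _ L1).
have Hk0 : 0 < energy g k by exact: energy_gt0 gG _ _.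
pose rad j := t + 2 ^- j / L; pose lev j := k * (1 - 2 ^- j).
pose v j := excess u (lev j).
pose f j x := if d o x < rad j then energy g (v j x) else 0.
pose Y j := nint mu (f j).
have p2 j : 0 < 2 ^- j :> R by rewrite invr_gt0 exprn_gt0.
have p2S j : 2 ^- j = 2 * 2 ^- j.+1 :> R.
  by rewrite exprS invfM mulrA mulfV ?mul1r ?pnatr_eq0.
have p21 j : 2 ^- j <= 1 :> R by rewrite invf_le1 ?exprn_gt0// exprn_ege1 ?ler1n.
have mv j : measurable_fun setT (v j) by exact: measurable_excess sol _.
have mf j : measurable_fun setT (f j).
  apply: measurable_fun_ifT => //; first exact: measurable_fun_ltr.
  by apply: measurableT_comp (mv j); exact: measurable_energy gG.
have f0 j x : 0 <= f j x by rewrite /f; case: ifP.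
pose eL := eps * L `^ (- be).
have eL0 : 0 < eL by rewrite mulr_gt0// powR_gt0.
pose rho j := eL * tau ^+ j.
have rho0 j : 0 < rho j by rewrite mulr_gt0// exprn_gt0.
have rho_le j : rho j <= 2 ^- j / L / 2.
  rewrite [leRHS](_ : _ = 2^-1 * L^-1 * 2^-1 ^+ j); last by rewrite exprVn; ring.
  apply: ler_pM; [by nneg|by nneg| |].
    apply: ler_pM => //; [by nneg|by nneg|].
    by rewrite powRN lef_pV2 ?posrE ?powR_gt0// -[leLHS](powRr1 (ltW L0)) ler_powR.
  by rewrite lerXn2r ?nnegrE ?invr_ge0 ?(ltW tau0).
pose B0 := c / 2 * eL `^ Q * (energy g k / (La * 4 `^ q)).
have pw4 j : (2 ^+ j.+2) `^ q = 4 `^ q * (2 `^ q) ^+ j :> R.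
  by rewrite !exprS mulrA powRM ?exprn_ge0// powRX//; congr (_ `^ _ * _); ring.
have rhoQ j : rho j `^ Q = eL `^ Q * (tau `^ Q) ^+ j.
  by rewrite /rho powRM ?exprn_ge0 ?(ltW tau0) ?(ltW eL0)// powRX// ltW.
have thj j : (2 `^ q) ^+ j * th ^+ j = (tau `^ Q) ^+ j.
  by rewrite -exprMn /th mulrCA mulfV ?mulr1// gt_eqF// powR_gt0.
have step j : (Y j <= (B0 * th ^+ j)%:E)%E -> (Y j.+1 <= th%:E * Y j)%E.
  move=> Yj; pose Lj := 2 ^+ j.+2 * L.
  have Lj1 : 1 <= Lj by rewrite mulr_ege1// exprn_ege1 ?ler1n.
  have Lj0 : 0 < Lj by rewrite (lt_le_trans _ Lj1).
  have LjV : Lj^-1 = 2 ^- j / L / 4.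
    by rewrite /Lj !exprS; field; rewrite expf_neq0//= gt_eqF.
  (* Then [t' + 1 / Lj] is [rad j] and [t' - 1 / Lj] is [rad j.+1]: the cutoff is [1] on the next
     ball and its margin fits in the present one. *)
  pose t' := t + 2 ^- j / L * (3 / 4).
  have t'E : t' + Lj^-1 = rad j by rewrite LjV /t' /rad; field; rewrite expf_neq0//= gt_eqF.
  have rad3 : rad j <= 3.
    by apply: le_trans tL3; rewrite lerD2l ler_piMl ?invr_ge0 ?(ltW L0).
  pose kt := lev j + 2 ^- j / 4 * k.
  have lev0 i : 0 <= lev i by rewrite mulr_ge0 ?(ltW k0)// subr_ge0.
  have dk0 : 0 < 2 ^- j / 4 * k by rewrite mulr_gt0// divr_gt0.
  have levkt : lev j <= kt by rewrite lerDl ltW.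
  have ktlev : kt <= lev j.+1.
    by rewrite /kt /lev [2 ^- j]p2S; have := p2 j.+1; have := k0; nra.
  have kt0 : 0 <= kt by rewrite (le_trans _ levkt).
  pose eta := cutoff d o t' Lj.
  have meta : measurable_fun setT eta by exact: measurable_cutoff sol _ _.
  have SC : (nint (mu \x mu)%E (sub_gain s Q d g u eta n kt) <= 2%:E * nint mu
    (fun x => if d o x < t' + Lj^-1 then
     S1 * Lj `^ q * K * c * energy g (excess u kt x) +
     S2 * Lj `^ g0 * (c * g k) * excess u kt x else 0)%R)%E.
    apply: (sub_caccioppoli p1 pq s01 Q0 La1 sol K0) => //.
    - by move=> x; exact: kernK dc x.
    - by move=> x; exact: cutoff_ge0.
    - by move=> x; exact: cutoff_le1.
    - by move=> x y; apply: (cutoff_lip sol); exact: ltW.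
    - by move=> x; apply: cutoff_eq0; exact: ltW.
    - by rewrite t'E.
    - by nneg.
  have Lq : Lj `^ q <= Lj `^ gam by rewrite ler_powR// lerDr ltW.
  have Lg : Lj `^ g0 * Lj `^ (q - 1) <= Lj `^ gam.
    by rewrite -powRD ?(gt_eqF Lj0) ?implybT// ler_powR// /gam; lra.
  have loss : (nint mu (fun x => if d o x < t' + Lj^-1 then
     S1 * Lj `^ q * K * c * energy g (excess u kt x) +
     S2 * Lj `^ g0 * (c * g k) * excess u kt x else 0)%R <=
     (c * C3 * Lj `^ gam)%:E * Y j)%E.
    rewrite -nintZ//; last by nneg.
    have mex : measurable_fun setT (excess u kt) by exact: measurable_excess sol _.
    have ex0 x : 0 <= excess u kt x by exact: excess_ge0.
    apply: le_nint.
    - apply: measurable_fun_ifT => //; first exact: measurable_fun_ltr.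
      apply: measurable_funD; apply: measurable_funM => //.
      by apply: measurableT_comp mex; exact: measurable_energy gG.
    - exact: measurable_funM.
    - by move=> x; case: ifP => // _; nneg.
    - move=> x; rewrite t'E /f; case: ifP => _; last by rewrite mulr0.
      have exv : excess u kt x <= v j x by exact: excess_homo.
      have Hexv := energy_homo gG exv.
      have v0 : 0 <= v j x by exact: excess_ge0.
      have gw : g k * excess u kt x <= La * Lj `^ (q - 1) * energy g (v j x).
        have [w0|w0] := leP (u x) kt.
          have -> : excess u kt x = 0 by rewrite /excess max_r// subr_le0.
          by rewrite mulr0; nneg.
        have vE : v j x = u x - lev j.
          by rewrite /v /excess max_l// subr_ge0 (le_trans levkt)// ltW.
        have kv : k <= Lj * v j x.
          have h1 : 2 ^- j / 4 * k <= v j x by rewrite vE; rewrite /kt in w0; lra.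
          have h2 : k <= 2 ^+ j.+2 * v j x.
            rewrite -ler_pdivrMl ?exprn_gt0//; apply: le_trans h1; rewrite !exprS.
            by rewrite le_eqVlt; apply/orP; left; apply/eqP; field; rewrite expf_neq0.
          apply: le_trans h2 _; rewrite ler_wpM2r// /Lj ler_peMr// exprn_ge0//.
        apply: (@le_trans _ _ (La * Lj `^ (q - 1) * g (v j x) * v j x)).
          rewrite ler_pM//; apply: le_trans (pg_upper gG Lj1 v0).
          exact: pg_homo gG _ _ kv.
        by rewrite /energy le_eqVlt; apply/orP; left; apply/eqP; ring.
      have E1 : S1 * Lj `^ q * K * c * energy g (excess u kt x) <=
          S1 * K * c * (Lj `^ gam * energy g (v j x)).
        rewrite (_ : _ * energy _ _ = S1 * K * c * (Lj `^ q * energy g (excess u kt x))); last by ring.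
        rewrite ler_wpM2l//; first by nneg.
        by rewrite ler_pM// powR_ge0.
      have E2 : S2 * Lj `^ g0 * (c * g k) * excess u kt x <=
          S2 * La * c * (Lj `^ gam * energy g (v j x)).
        rewrite (_ : _ * excess _ _ _ = S2 * c * Lj `^ g0 * (g k * excess u kt x)); last by ring.
        apply: le_trans (ler_wpM2l _ gw) _; first by nneg.
        rewrite [leLHS](_ : _ = S2 * La * c * (Lj `^ g0 * Lj `^ (q - 1) * energy g (v j x))); last by ring.
        rewrite ler_wpM2l//; first by nneg.
        by rewrite ler_wpM2r.
      apply: le_trans (lerD E1 E2) _.
      by rewrite /C3 le_eqVlt; apply/orP; left; apply/eqP; ring.
  pose bad y := (d o y < rad j) && (kt < u y).
  have mbad : measurable_fun setT bad.
    by apply: measurable_and; exact: measurable_fun_ltr.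
  have bad_le : (mu [set y | bad y] <= (c / 2 * rho j `^ Q)%:E)%E.
    have kd : energy g k <= La * (2 ^+ j.+2) `^ q * energy g (2 ^- j / 4 * k).
      rewrite {1}(_ : k = 2 ^+ j.+2 * (2 ^- j / 4 * k)); last first.
        by rewrite !exprS; field; rewrite expf_neq0.
      by apply: (energy_upper p1 pq gG); rewrite ?(ltW dk0)// exprn_ege1 ?ler1n.
    have C0 : 0 < La * (2 ^+ j.+2) `^ q by npos.
    have mk : ((energy g k / (La * (2 ^+ j.+2) `^ q))%:E * mu [set y | bad y] <= Y j)%E.
      apply: nint_markov => //; first by nneg.
      move=> y /andP[oy uy]; rewrite /f oy ler_pdivrMr// mulrC.
      apply: le_trans kd _; rewrite ler_wpM2l ?(ltW C0)//; apply: (energy_homo gG).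
      by rewrite /v /excess le_max; apply/orP; left; rewrite /kt in uy; lra.
    have := le_trans mk Yj; rewrite -lee_pdivlMl; last by npos.
    move=> /le_trans; apply; rewrite -EFinM lee_fin.
    rewrite le_eqVlt; apply/orP; left; apply/eqP.
    rewrite rhoQ -thj pw4 /B0; field.
    by rewrite !gt_eqF ?expf_neq0 ?powR_gt0// gt_eqF ?powR_gt0.
  have st0 x : 0 <= sub_test u eta n kt x.
    by rewrite mulr_ge0 ?excess_ge0 ?exprn_ge0 ?cutoff_ge0.
  pose h x := La^-1 * (rho j `^ a)^-1 * energy g (v j.+1 x).
  have mh : measurable_fun setT h.
    apply: measurable_funM => //; apply: measurableT_comp (mv j.+1).
    exact: measurable_energy gG.
  have h0 x : 0 <= h x by rewrite /h; nneg.
  pose S x := (d o x < rad j.+1) && (lev j.+1 < u x).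
  have mS : measurable_fun setT S.
    by apply: measurable_and; exact: measurable_fun_ltr.
  have lower : ((c / 2)%:E * nint mu (fun x => if S x then h x else 0)%R <=
      nint (mu \x mu)%E (sub_gain s Q d g u eta n kt))%E.
    apply: (gain_lower Q0 La1 sol (rho := rho j) (bad := bad)) => //.
    - by apply: (measurable_sub_gain sol).
    - move=> z; rewrite /sub_gain; case: ifP => // _; rewrite mulr_ge0 ?invr_ge0 ?powR_ge0//.
      by rewrite mulr_ge0.
    - move=> x y /andP[ox ux] bady /andP[dxy0 dxy].
      have oy : d o y < rad j.
        apply: le_lt_trans (rm_triangle dc o x y) _.
        have := rho_le j; move: ox; rewrite /rad [2 ^- j]p2S.
        by rewrite -[2 * 2 ^- j.+1 / L]mulrA => ? ?; lra.
      have uy : u y <= kt by move: bady; rewrite /bad oy/= -leNgt.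
      rewrite /sub_gain/= uy.
      have eta1 : eta x = 1.
        rewrite /eta cutoff_eq1//; apply: (@le_trans _ _ (Lj * Lj^-1)).
          by rewrite mulfV// gt_eqF.
        rewrite ler_wpM2l ?(ltW Lj0)// LjV /t'; move: ox; rewrite /rad [2 ^- j]p2S.
        by rewrite -![2 * 2 ^- j.+1 / L]mulrA => ?; lra.
      rewrite /sub_test eta1 expr1n mulr1.
      have wv : v j.+1 x <= excess u kt x by exact: excess_homo.
      have v0 : 0 <= v j.+1 x by exact: excess_ge0.
      have dss : (rho j `^ s)^-1 <= (d x y `^ s)^-1.
        by rewrite lef_pV2 ?posrE ?powR_gt0// ge0_ler_powR ?nnegrE ?(ltW s0) ?(ltW dxy0) ?(ltW dxy) ?(ltW (rho0 j)).
      have dsQ : (rho j `^ (Q + s))^-1 <= (d x y `^ (Q + s))^-1.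
        by rewrite lef_pV2 ?posrE ?powR_gt0// ge0_ler_powR ?nnegrE ?(ltW dxy0) ?(ltW dxy) ?(ltW (rho0 j))// addr_ge0 ?ltW.
      apply: (@le_trans _ _ (g (v j.+1 x / rho j `^ s) * v j.+1 x / rho j `^ (Q + s))); last first.
        apply: ler_pM; [by nneg|by nneg| |exact: dsQ].
        apply: ler_pM; [exact: gge0|exact: v0| |exact: wv]; apply: (pg_homo gG).
        by apply: ler_pM; [exact: v0|nneg|exact: wv|exact: dss].
      have -> : g (v j.+1 x / rho j `^ s) * v j.+1 x / rho j `^ (Q + s) =
          energy g ((rho j `^ s)^-1 * v j.+1 x) / rho j `^ Q.
        rewrite /energy powRD ?(gt_eqF (rho0 j)) ?implybT// invfM [v j.+1 x / _]mulrC; ring.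
      rewrite ler_wpM2r ?invr_ge0 ?powR_ge0// /h.
      have r1 : 1 <= (rho j `^ s)^-1.
        rewrite invf_ge1 ?powR_gt0// powR_le1 ?(ltW s0)// (ltW (rho0 j))/=.
        apply: le_trans (rho_le j) _; rewrite -mulrA mulr_ile1//; first by nneg.
        by rewrite -invfM invf_le1 ?mulr_gt0// mulr_ege1// ler1n.
      rewrite -mulrA ler_pdivrMl// -[(rho j `^ a)^-1]powRV ?(ltW (rho0 j))//.
      rewrite /a powRrM powRV ?(ltW (rho0 j))//.
      exact: (energy_lower p1 gG r1 v0).
  have SY : nint mu (fun x => if S x then h x else 0)%R =
      ((La^-1 * (rho j `^ a)^-1)%:E * Y j.+1)%E.
    rewrite -nintZ//; last by nneg.
    congr nint; apply/funext => x; rewrite /S /f /h.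
    have [ox|ox] := boolP (d o x < rad j.+1); last by rewrite mulr0.
    rewrite andTb; case: ifPn => //; rewrite -leNgt => ul.
    by rewrite /v /excess max_r ?subr_le0// energy0 mulr0.
  have ch : 0 < c / 2 * (La^-1 * (rho j `^ a)^-1) by npos.
  have := le_trans lower (le_trans SC (lee_wpmul2l _ loss)).
  rewrite lee_fin => /(_ (ler0n _ _)).
  rewrite SY muleA -EFinM -lee_pdivlMl// => /le_trans; apply.
  rewrite !muleA -!EFinM lee_wpmul2r//; first exact: nint_ge0.
  rewrite lee_fin; apply: le_trans Deps.
  have LL : Lj `^ gam * rho j `^ a = 4 `^ gam * eps `^ a.
    have L4 : Lj = 4 * 2 ^+ j * L by rewrite /Lj !exprS; ring.
    rewrite L4 !powRM ?mulr_ge0 ?exprn_ge0 ?(ltW L0) ?(ltW eps0) ?powR_ge0 ?(ltW tau0)//.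
    rewrite !powRX ?(ltW tau0)// tau_a.
    rewrite -powRrM mulNr mulfVK ?gt_eqF// powRN exprVn; field.
    by rewrite !gt_eqF ?exprn_gt0 ?powR_gt0.
  rewrite [leLHS](_ : _ = 4 * La * C3 * (Lj `^ gam * rho j `^ a)); last first.
    by field; rewrite !gt_eqF ?powR_gt0.
  by rewrite LL /D le_eqVlt; apply/orP; left; apply/eqP; ring.
have YB j : (Y j <= (B0 * th ^+ j)%:E)%E.
  elim: j => [|j IH].
    apply: (le_trans _ (le_trans Y0_le _)).
      rewrite le_eqVlt; apply/orP; left; apply/eqP; congr nint.
      apply/funext => x; rewrite /f /rad /v /lev expr0 invr1 subrr mulr0 mul1r.
      by rewrite /excess subr0.
    rewrite lee_fin expr0 /B0 /eL powRM ?powR_ge0 ?(ltW eps0)// -powRrM mulNr.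
    by rewrite le_eqVlt; apply/orP; left; apply/eqP; field; rewrite !gt_eqF ?powR_gt0.
  apply: le_trans (step j IH) _.
  apply: le_trans (lee_wpmul2l _ IH) _; first by rewrite lee_fin ltW.
  by rewrite -EFinM lee_fin exprS le_eqVlt; apply/orP; left; apply/eqP; ring.
have mA : measurable_fun setT (fun x => (d o x < t) && (k < u x)).
  by apply: measurable_and; exact: measurable_fun_ltr.
apply/eqP; rewrite eq_le measure_ge0 andbT.
apply: (@lee_geometric0 _ _ (La / energy g k * B0) (tau `^ Q)).
  rewrite powR_ge0/= powR_lt1// (ltW tau0)/=.
  by rewrite (le_lt_trans tau2)// invf_lt1// ltr1n.
move=> j; have C0 : 0 < La * (2 `^ q) ^+ j by npos.
(* Where [u > k] the excess over [lev j] is at least [2 ^ (- j) k]. The loss [2 ^ (q j)] is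
   compensated by [th ^ j], so the bound still tends to [0] like [tau ^ (Q j)]. *)
have mk : ((energy g k / (La * (2 `^ q) ^+ j))%:E *
    mu [set y | ((d o y < t) && (k < u y))%R] <= Y j)%E.
  apply: nint_markov => //; first by nneg.
  move=> y /andP[oy uy]; rewrite /f ifT; last first.
    by apply: lt_le_trans oy _; rewrite lerDl; nneg.
  rewrite ler_pdivrMr// mulrC -powRX//.
  have kd : energy g k <= La * (2 ^+ j) `^ q * energy g (2 ^- j * k).
    rewrite {1}(_ : k = 2 ^+ j * (2 ^- j * k)); last first.
      by field; rewrite expf_neq0.
    apply: (energy_upper p1 pq gG); first by rewrite exprn_ege1 ?ler1n.
    by nneg.
  apply: le_trans kd _; rewrite ler_wpM2l//; first by nneg.
  apply: (energy_homo gG); rewrite /v /excess /lev le_max; apply/orP; left.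
  by rewrite mulrBr mulr1 [k * _]mulrC; lra.
have := le_trans mk (YB j); rewrite -lee_pdivlMl; last by npos.
move=> /le_trans; apply; rewrite -EFinM lee_fin -thj.
by rewrite le_eqVlt; apply/orP; left; apply/eqP; field; rewrite !gt_eqF ?exprn_gt0 ?powR_gt0.
Qed.

End boundedness.

(** * The Harnack inequality *)

Section harnack.
Context {R : realType} {dX : measure_display} {X : measurableType dX}.
Variables (mu : {sigma_finite_measure set X -> \bar R}) (p q s Q La : R).
Hypotheses (p1 : 1 < p) (pq : p <= q) (s01 : 0 < s < 1) (Q0 : 0 < Q) (La1 : 1 <= La).

Let La0 : 0 < La. Proof. exact: lt_le_trans La1. Qed.
Let s0 : 0 < s. Proof. by case/andP: s01. Qed.

(* Iterating on the radii [2 - 2^-i], the dependence on the gap is only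
   polynomial in [2^i], hence absorbed by the geometric factor [th]. *)
Lemma harnack : exists2 C, 0 < C & forall d c g o u m,
  solution mu p q s Q La d c g o u -> 0 < m ->
  (nint mu (tail_density s Q d g o (negpart u)) <= (c * g m)%:E)%E ->
  mu [set x | ((d o x < 1) && (u x < m))%R] != 0%E ->
  mu [set x | ((d o x < 1) && (C * m < u x))%R] = 0%E.
Proof.
have [K' K'0 WH] := weak_harnack mu p1 pq s01 Q0 La1.
have [nu [ga [nu0 ga0 DG]]] := sub_de_giorgi mu p1 pq s01 Q0 La1.
have p10 : 0 < p - 1 by rewrite subr_gt0.
have q1 : 1 < q by exact: lt_le_trans pq.
(* The lower growth has exponent [p - 1], so raising [g] by the factor [2 ^ (ga (i + 1))] takes a
   multiple [G2 ^ (i + 1)] of the level. *)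
pose g2 := ga / (p - 1).
have g20 : 0 <= g2 by rewrite divr_ge0 ?(ltW p10).
pose G2 : R := 2 `^ g2.
have G20 : 0 < G2 by rewrite powR_gt0.
have G21 : 1 <= G2 by rewrite -[leLHS](powRr0 2) ler_powR ?ler1n.
(* Makes [th G2 = 1 / 2], so that the levels added along the iteration sum geometrically. *)
pose th := (2 * G2)^-1.
have th0 : 0 < th by rewrite invr_gt0 mulr_gt0.
have th1 : th <= 2^-1.
  by rewrite lef_pV2 ?posrE ?mulr_gt0// ler_peMr.
pose e0 := s * (q - 1) + (Q + s).
pose C6 := La * 3 `^ e0.
have C60 : 0 < C6 by rewrite /C6; npos.
(* The two summands in brackets serve the energy and the tail hypotheses of [sub_de_giorgi]; the
   final [1] ensures [lam i >= 1]. *)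
pose A := La * (C6 * K' / (nu * th) + K') + 1.
have A0 : 0 < A by rewrite /A; npos.
pose lam (i : nat) := A `^ (p - 1)^-1 * G2 ^+ i.+1.
have lam0 i : 0 < lam i by rewrite /lam; npos.
(* The fixed point of the recursion: [th C7 G2 ^ (i + 1) + lam i = C7 G2 ^ i]. *)
pose C7 := 2 * (A `^ (p - 1)^-1 * G2).
have C70 : 0 < C7 by rewrite /C7; npos.
exists (C7 + 1); first by rewrite addr_gt0.
move=> d c g o u m sol m0 tail_le mu_n0.
have N_le := WH _ _ _ _ _ _ sol m0 tail_le mu_n0.
have dc := sol_metric sol; have gG := sol_growth sol; have c0 := rm_gt0 dc.
have mu_u := sol_measurable sol; have mdo := regular_dist1 o dc.
have gge0 := pg_ge0 gG; have Hge0 := energy_ge0 gG; have dge0 := rm_ge0 dc.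
have gm0 : 0 < g m by exact: pg_gt0 gG _ _.
set N := tail_density s Q d g o (pospart u) in N_le.
have mpos := measurable_pospart sol.
have mN : measurable_fun setT N by exact: measurable_tail_density sol _ mpos.
have N0 y : 0 <= N y by exact: tail_density_ge0 sol _ _.
have pos0 x : 0 <= pospart u x by rewrite le_max lexx orbT.
have mltd r : measurable_fun setT (fun x => d o x < r) by exact: measurable_fun_ltr.
have mHp : measurable_fun setT (fun x => energy g (pospart u x)).
  by apply: measurableT_comp mpos; exact: measurable_energy gG.
pose rad i : R := 2 - 2 ^- i.
have p2 j : 0 < 2 ^- j :> R by rewrite invr_gt0 exprn_gt0.
have p2S j : 2 ^- j = 2 * 2 ^- j.+1 :> R.
  by rewrite exprS invfM mulrA mulfV ?mul1r ?pnatr_eq0.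
have radS i : rad i + (2 ^+ i.+1)^-1 = rad i.+1.
  by rewrite /rad [X in 2 - X + _]p2S; ring.
have rad2 i : rad i <= 2 by rewrite gerBl ltW.
have lam1 i : 1 <= lam i.
  rewrite /lam mulr_ege1 ?exprn_ege1// -[leLHS](powRr0 A) ler_powR ?invr_ge0 ?(ltW p10)//.
  by rewrite /A lerDr; nneg.
have glam i : (C6 * K' / (nu * th) + K') * ((2 ^+ i.+1) `^ ga * g m) <= g (lam i * m).
  have lami : lam i `^ (p - 1) = A * (2 ^+ i.+1) `^ ga.
    rewrite /lam powRM ?powR_ge0 ?exprn_ge0 ?(ltW G20)// -powRrM mulVf ?gt_eqF// powRr1 ?(ltW A0)//.
    rewrite powRX ?(ltW G20)// -powRrM /g2 divfK ?gt_eqF//.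
    by rewrite powRX.
  have := pg_lower gG (lam1 i) (ltW m0); rewrite lami => h.
  have Apos : 0 <= (2 ^+ i.+1) `^ ga * g m by nneg.
  rewrite -(ler_pM2l La0); apply: le_trans h.
  by rewrite [leLHS]mulrA -[leRHS]mulrA ler_wpM2r// /A lerDl.
have stepS (S : R) i : 0 <= S ->
    mu [set x | ((d o x < rad i.+1) && (S < u x))%R] = 0%E ->
    mu [set x | ((d o x < rad i) && (th * S + lam i * m < u x))%R] = 0%E.
  move=> S0 US; pose k := th * S + lam i * m; pose L : R := 2 ^+ i.+1.
  have L1 : 1 <= L by rewrite exprn_ege1 ?ler1n.
  have lm0 : 0 < lam i * m by rewrite mulr_gt0.
  have k0 : 0 < k by rewrite ltr_wpDl// mulr_ge0// ltW.
  have gk : (C6 * K' / (nu * th) + K') * (L `^ ga * g m) <= g k.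
    apply: le_trans (glam i) _; apply: (pg_homo gG).
    by rewrite lerDr mulr_ge0// ltW.
  have Lga : 1 <= L `^ ga by rewrite -[leLHS](powRr0 L) ler_powR.
  have gm1 : g m <= L `^ ga * g m by rewrite ler_peMl// ltW.
  apply: (DG _ _ _ _ _ _ _ _ sol k0 L1).
  - by rewrite radS (le_trans (rad2 _))// ler_nat.
  - apply: le_trans N_le _; rewrite lee_fin mulrCA ler_wpM2l ?(ltW c0)//.
    apply: (le_trans _ gk); apply: ler_pM; [by nneg|by nneg| |exact: gm1].
    by rewrite lerDr; nneg.
  - rewrite radS.
    pose F x := if (d o x < rad i.+1) && (u x <= S) then energy g (pospart u x) else 0.
    have mb : measurable_fun setT (fun x => (d o x < rad i.+1) && (u x <= S)).
      by apply: measurable_and => //; exact: measurable_fun_ler.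
    have mF : measurable_fun setT F by exact: measurable_fun_ifT.
    have -> : nint mu (fun x => if d o x < rad i.+1 then energy g (pospart u x) else 0)%R =
        nint mu F.
      apply: ge0_ae_eq_integral => //.
      - by apply/measurable_EFinP; exact: measurable_fun_ifT.
      - exact/measurable_EFinP.
      - by move=> x _; rewrite lee_fin; case: ifP.
      - by move=> x _; rewrite lee_fin /F; case: ifP.
      - exists [set x | ((d o x < rad i.+1) && (S < u x))%R]; split => //.
          by apply: measurable_pred; apply: measurable_and => //; exact: measurable_fun_ltr.
        move=> x /=; apply: contra_notP => h _; rewrite /F.
        case: (ltP (d o x) (rad i.+1)) h => //= ox h; rewrite ifT// leNgt.
        exact/negP.
    (* One factor of [H(u_+) = u_+ g(u_+)] is bounded by [S] and the other by the tail density. The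
       result is linear in [S], matching the factor [k >= th S] of [H(k)]; the remaining constants
       are absorbed by [g k >= g (lam i m)]. *)
    apply: (@le_trans _ _ (nint mu (fun x => S * C6 * N x)%R)).
      apply: le_nint => //; first exact: measurable_funM.
        by move=> x; rewrite /F; case: ifP.
      move=> x; rewrite /F; case: ifPn => [/andP[ox uS]|_]; last by nneg.
      have ox2 := lt_le_trans ox (rad2 _).
      have e1 : 0 < 1 + d o x by rewrite ltr_wpDr.
      have tk : g (pospart u x / 1 `^ s) / 1 `^ (Q + s) <= C6 * N x.
        by apply: (tail_kern_comp s01 Q0 gG) => //; [rewrite ler1n|lra].
      rewrite !powR1 !divr1 in tk.
      rewrite -mulrA; apply: ler_pM => //.
      by rewrite ge_max uS.
    rewrite nintZ//; last by nneg.
    apply: le_trans (lee_wpmul2l _ N_le) _; first by rewrite lee_fin; nneg.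
    rewrite -EFinM lee_fin /energy.
    have thk : th * S <= k by rewrite lerDl ltW.
    rewrite powRN.
    have LL0 : 0 < L `^ ga by rewrite (lt_le_trans _ Lga).
    rewrite (_ : nu / _ * _ = (nu * c / L `^ ga * g k) * k); last by ring.
    apply: le_trans (ler_wpM2l _ thk); last by nneg.
    have h : C6 * K' / (nu * th) * (L `^ ga * g m) <= g k.
      apply: (le_trans _ gk); rewrite ler_wpM2r//; first by nneg.
      by rewrite lerDl ltW.
    rewrite (_ : _ * (_ * _) = nu * c / L `^ ga *
      (C6 * K' / (nu * th) * (L `^ ga * g m)) * (th * S)); last first.
      by field; rewrite !gt_eqF.
    rewrite ler_wpM2r//; first by nneg.
    by rewrite ler_wpM2l//; nneg.
(* A qualitative bound, from radius [3] to radius [2] with gap [1]. It depends on [u], but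
   disappears from the estimate because [th ^ j S] tends to [0]. *)
have [S S0 US] : exists2 S, 0 < S & mu [set x | ((d o x < 2) && (S < u x))%R] = 0%E.
  have := sol_energy0 sol; set Y := nint mu _ => Yoo.
  have Y0 : (0 <= Y)%E by apply: nint_ge0 => x; case: ifP.
  have Yfin : Y \is a fin_num by rewrite ge0_fin_numE.
  have [k0 k00 gk0] := pg_unbounded p1 La1 gG (fine Y / (nu * c) + K' * g m).
  have fY : 0 <= fine Y by exact: fine_ge0.
  exists (Num.max k0 1); first by rewrite lt_max k00.
  set k := Num.max k0 1.
  have k1 : 1 <= k by rewrite le_max lexx orbT.
  have gk : fine Y / (nu * c) + K' * g m <= g k.
    by apply: (le_trans gk0); apply: (pg_homo gG); rewrite le_max lexx.
  have nuc : 0 < nu * c by rewrite mulr_gt0.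
  apply: (DG _ _ _ _ _ _ _ 1 sol) => //.
  - by rewrite (lt_le_trans _ k1).
  - by rewrite invr1; lra.
  - apply: le_trans N_le _; rewrite lee_fin mulrCA ler_wpM2l ?(ltW c0)//.
    by apply: (le_trans _ gk); rewrite lerDr; nneg.
  - rewrite invr1 powR1 mulr1.
    apply: (@le_trans _ _ Y).
      apply: le_nint => //; first exact: measurable_fun_ifT.
      + by apply: measurable_fun_ifT => //; apply: measurableT_comp mu_u; exact: measurable_energy gG.
      + by move=> x; case: ifP.
      + move=> x; rewrite (_ : 2 + 1 = 3 :> R); last by ring.
        case: ifP => // ox.
        by rewrite /pospart max_l//; apply: (sol_ge0 sol); lra.
    rewrite -(fineK Yfin) lee_fin /energy.
    have h : fine Y / (nu * c) <= g k by apply: (le_trans _ gk); rewrite lerDl; nneg.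
    rewrite mulrA -ler_pdivrMl// mulrC; apply: le_trans h _.
    by rewrite ler_peMl.
have claim j i :
    mu [set x | ((d o x < rad i) && (th ^+ j * S + C7 * G2 ^+ i * m < u x))%R] = 0%E.
  elim: j i => [|j IH] i.
    apply/eqP; rewrite eq_le measure_ge0 andbT -[leRHS]US; apply: le_measure.
    - by rewrite inE; apply: measurable_pred; apply: measurable_and => //; exact: measurable_fun_ltr.
    - by rewrite inE; apply: measurable_pred; apply: measurable_and => //; exact: measurable_fun_ltr.
    - move=> x /= /andP[ox Sx]; apply/andP; split; first exact: lt_le_trans (rad2 i).
      by apply: le_lt_trans Sx; rewrite expr0 mul1r lerDl; nneg.
  have := stepS _ i _ (IH i.+1).
  rewrite (_ : th * _ + lam i * m = th ^+ j.+1 * S + C7 * G2 ^+ i * m); last first.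
    by rewrite /lam /C7 /th !exprS; field; rewrite gt_eqF.
  by apply; nneg.
have [j thj] : exists j, th ^+ j * S <= m.
  have /cvgrPdist_lt/(_ _ m0)[n _ /(_ n (leqnn n))] : geometric S th @ \oo --> (0 : R).
    by apply: cvg_geometric; rewrite gtr0_norm// (le_lt_trans th1)// invf_lt1// ltr1n.
  rewrite sub0r normrN => /ltW an; exists n; apply: le_trans an.
  by rewrite mulrC; exact: ler_norm.
apply/eqP; rewrite eq_le measure_ge0 andbT -[leRHS](claim j 0%N); apply: le_measure.
- by rewrite inE; apply: measurable_pred; apply: measurable_and => //; exact: measurable_fun_ltr.
- by rewrite inE; apply: measurable_pred; apply: measurable_and => //; exact: measurable_fun_ltr.
- move=> x /= /andP[ox Cx]; rewrite /rad expr0 invr1 (_ : 2 - 1 = 1 :> R)//; last by ring.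
  rewrite ox/=; apply: le_lt_trans Cx; rewrite mulr1 mulrDl mul1r addrC.
  by rewrite lerD2l.
Qed.

End harnack.

(** * The Heisenberg group as a regular metric space *)

Section heis_geometry.
Context {R : realType} {n : nat}.
Implicit Types x y z : heis R n.

Let hsq x : R := \sum_(i < n + n) x ord0 (lshift 1 i) ^+ 2.
Let sympl x y : R := \sum_(i < n) (heis_x x i * heis_y y i - heis_y x i * heis_x y i).

Lemma heis_hsqE x : \sum_(i < n + n) x ord0 (lshift 1 i) ^+ 2 =
  \sum_(i < n) (heis_x x i ^+ 2 + heis_y x i ^+ 2).
Proof. by rewrite big_split_ord/= -big_split. Qed.

Let hsq_ge0 x : 0 <= hsq x.
Proof. by apply: sumr_ge0 => i _; exact: sqr_ge0. Qed.

Lemma heis_norm_ge0 x : 0 <= heis_norm x. Proof. exact: powR_ge0. Qed.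

Lemma heis_norm_pow4 x : heis_norm x ^+ 4 = hsq x ^+ 2 + heis_t x ^+ 2.
Proof.
rewrite -powR_mulrn ?heis_norm_ge0// -powRrM mulVf ?pnatr_eq0// powRr1//.
by rewrite addr_ge0 ?sqr_ge0.
Qed.

Lemma heis_norm_le x (r : R) : 0 <= r ->
  (heis_norm x <= r) = (hsq x ^+ 2 + heis_t x ^+ 2 <= r ^+ 4).
Proof. by move=> r0; rewrite -heis_norm_pow4 ler_pXn2r ?nnegrE ?heis_norm_ge0. Qed.

Lemma heis_norm_lt x (r : R) : 0 <= r ->
  (heis_norm x < r) = (hsq x ^+ 2 + heis_t x ^+ 2 < r ^+ 4).
Proof. by move=> r0; rewrite -heis_norm_pow4 ltr_pXn2r ?nnegrE ?heis_norm_ge0. Qed.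

Lemma heis_normN x : heis_norm (- x) = heis_norm x.
Proof.
rewrite /heis_norm /heis_t mxE sqrrN; congr ((_ ^+ 2 + _) `^ _).
by apply: eq_bigr => i _; rewrite mxE sqrrN.
Qed.

(* Bessel's inequality for the orthogonal pair formed by the horizontal part
   of [y] and its image under the complex structure. *)
Lemma heis_bessel x y :
  (\sum_(i < n) (heis_x x i * heis_x y i + heis_y x i * heis_y y i)) ^+ 2 +
  sympl x y ^+ 2 <= hsq x * hsq y.
Proof.
set be := \sum_(i < n) _; set om := sympl x y; pose S := be ^+ 2 + om ^+ 2.
set A := hsq x; set B := hsq y.
have B0 : 0 <= B by exact: hsq_ge0.
have [B_0|Bn0] := eqVneq B 0.
  have y0 i : heis_x y i = 0 /\ heis_y y i = 0.
    move: B_0; rewrite /B /hsq heis_hsqE => /eqP; rewrite psumr_eq0; last first.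
      by move=> j _; rewrite addr_ge0 ?sqr_ge0.
    move/allP/(_ i); rewrite mem_index_enum => /(_ isT)/=.
    by rewrite paddr_eq0 ?sqr_ge0// !sqrf_eq0 => /andP[/eqP-> /eqP->].
  rewrite B_0 mulr0 /be /om /sympl !big1 ?expr0n ?addr0//.
    by move=> i _; have [-> ->] := y0 i; rewrite !mulr0 subr0.
  by move=> i _; have [-> ->] := y0 i; rewrite !mulr0 addr0.
have {Bn0} Bp : 0 < B by rewrite lt_neqAle eq_sym Bn0.
pose a i := B * heis_x x i - (be * heis_x y i + om * heis_y y i).
pose b i := B * heis_y x i - (be * heis_y y i - om * heis_x y i).
have : 0 <= \sum_(i < n) (a i ^+ 2 + b i ^+ 2).
  by apply: sumr_ge0 => i _; rewrite addr_ge0 ?sqr_ge0.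
have -> : \sum_(i < n) (a i ^+ 2 + b i ^+ 2) =
    B ^+ 2 * A - 2 * B * be * be - 2 * B * om * om + S * B.
  have -> : B ^+ 2 * A = \sum_(i < n) B ^+ 2 * (heis_x x i ^+ 2 + heis_y x i ^+ 2).
    by rewrite /A /hsq heis_hsqE mulr_sumr.
  have -> : S * B = \sum_(i < n) S * (heis_x y i ^+ 2 + heis_y y i ^+ 2).
    by rewrite -mulr_sumr -heis_hsqE.
  have -> : 2 * B * be * be = \sum_(i < n) (2 * B * be) *
      (heis_x x i * heis_x y i + heis_y x i * heis_y y i) by rewrite -mulr_sumr.
  have -> : 2 * B * om * om = \sum_(i < n) (2 * B * om) *
      (heis_x x i * heis_y y i - heis_y x i * heis_x y i) by rewrite -mulr_sumr.
  rewrite -!sumrN -!big_split/=; apply: eq_bigr => i _.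
  by rewrite /a /b /S; ring.
have -> : B ^+ 2 * A - 2 * B * be * be - 2 * B * om * om + S * B = B * (A * B - S).
  by rewrite /S; ring.
by rewrite pmulr_rge0// subr_ge0.
Qed.

(** The triangle inequality of the Euclidean plane; Cauchy-Schwarz comes from Lagrange's
    identity. *)
Lemma sqr_triangle (a b c d p q : R) : 0 <= p -> 0 <= q ->
  a ^+ 2 + b ^+ 2 <= p ^+ 2 -> c ^+ 2 + d ^+ 2 <= q ^+ 2 ->
  (a + c) ^+ 2 + (b + d) ^+ 2 <= (p + q) ^+ 2.
Proof.
move=> p0 q0 h1 h2.
have h3 : (a * c + b * d) ^+ 2 <= (p * q) ^+ 2.
  rewrite exprMn; apply: le_trans (ler_pM _ _ h1 h2); rewrite ?addr_ge0 ?sqr_ge0//.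
  rewrite -subr_ge0 (_ : _ - _ = (a * d - b * c) ^+ 2) ?sqr_ge0//; ring.
have h4 : a * c + b * d <= p * q.
  have pq0 : 0 <= p * q by rewrite mulr_ge0.
  rewrite leNgt; apply/negP => lt; move: h3; apply/negP; rewrite -ltNge.
  by rewrite ltr_pXn2r ?nnegrE ?(ltW (le_lt_trans pq0 lt)).
rewrite [leLHS](_ : _ = (a ^+ 2 + b ^+ 2) + (c ^+ 2 + d ^+ 2) + 2 * (a * c + b * d)); last by ring.
rewrite [leRHS](_ : _ = p ^+ 2 + q ^+ 2 + 2 * (p * q)); last by ring.
by rewrite lerD ?lerD// ler_pM2l.
Qed.

(** The squared norm of [x] is the length of the plane vector with entries [hsq x] and [heis_t x].
    For the product this vector is the sum of those of [x] and [y] and of [(2 be, sympl / 2)], whose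
    length is at most twice the product of the norms by [heis_bessel]. The three bounds add up to a
    square. *)
Lemma heis_norm_triangle x y :
  heis_norm (heis_mul x y) <= heis_norm x + heis_norm y.
Proof.
have x0 := heis_norm_ge0 x; have y0 := heis_norm_ge0 y.
rewrite heis_norm_le ?addr_ge0//.
set P := heis_norm x; set T := heis_norm y.
set be := \sum_(i < n) (heis_x x i * heis_x y i + heis_y x i * heis_y y i).
have -> : hsq (heis_mul x y) = hsq x + hsq y + 2 * be.
  rewrite /hsq !heis_hsqE /be mulr_sumr -!big_split/=; apply: eq_bigr => i _.
  by rewrite heis_xM heis_yM; ring.
rewrite heis_tM -/(sympl x y).
have hP : hsq x ^+ 2 + heis_t x ^+ 2 <= (P ^+ 2) ^+ 2.
  by rewrite -exprM -heis_norm_pow4.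
have hT : hsq y ^+ 2 + heis_t y ^+ 2 <= (T ^+ 2) ^+ 2.
  by rewrite -exprM -heis_norm_pow4.
have sub (a b t : R) : 0 <= t -> a ^+ 2 + b ^+ 2 <= t ^+ 2 -> a <= t.
  move=> t0 h; rewrite leNgt; apply/negP => ta.
  have : t ^+ 2 < a ^+ 2 by rewrite ltr_pXn2r ?nnegrE// ltW// (le_lt_trans t0).
  have := sqr_ge0 b; lra.
have hx : hsq x <= P ^+ 2 by apply: sub hP; exact: sqr_ge0.
have hy : hsq y <= T ^+ 2 by apply: sub hT; exact: sqr_ge0.
have PT0 : 0 <= 2 * (P * T) by rewrite mulr_ge0// mulr_ge0.
have hb : (2 * be) ^+ 2 + (2^-1 * sympl x y) ^+ 2 <= (2 * (P * T)) ^+ 2.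
  have := heis_bessel x y; rewrite -/be.
  have h : hsq x * hsq y <= P ^+ 2 * T ^+ 2 by rewrite ler_pM.
  have := sqr_ge0 (sympl x y); rewrite !exprMn; lra.
have h1 := sqr_triangle (sqr_ge0 _) (sqr_ge0 _) hP hT.
have h2 := sqr_triangle (addr_ge0 (sqr_ge0 _) (sqr_ge0 _)) PT0 h1 hb.
by apply: le_trans h2 _; rewrite le_eqVlt; apply/orP; left; apply/eqP; ring.
Qed.

Lemma heis_mulgV x : heis_mul x (heis_inv x) = 0.
Proof.
have := @heis_mulVg R n (heis_inv x); rewrite /heis_inv opprK//.
Qed.

Lemma heis_dist_triangle x y z : heis_dist x z <= heis_dist x y + heis_dist y z.
Proof.
rewrite /heis_dist; have -> : heis_mul (heis_inv x) z =
    heis_mul (heis_mul (heis_inv x) y) (heis_mul (heis_inv y) z).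
  by rewrite -heis_mulA (heis_mulA y) heis_mulgV heis_mul0g.
exact: heis_norm_triangle.
Qed.

Lemma heis_t_mulV x y : heis_t (heis_mul (heis_inv x) y) =
  heis_t y - (heis_t x + 2^-1 * sympl x y).
Proof.
rewrite heis_tM /heis_inv [heis_t (- x)]mxE -/(heis_t x).
rewrite (_ : \sum_(i < n) _ = - sympl x y); first by ring.
rewrite /sympl -sumrN; apply: eq_bigr => i _.
by rewrite [heis_x (- x) i]mxE [heis_y (- x) i]mxE -/(heis_x x i) -/(heis_y x i); ring.
Qed.

Lemma heis_coord_mulV x y (i : 'I_(n + n)) :
  heis_mul (heis_inv x) y ord0 (lshift 1 i) = y ord0 (lshift 1 i) - x ord0 (lshift 1 i).
Proof. by rewrite [LHS]row_mxEl !mxE addrC. Qed.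

Lemma heis_distC x y : heis_dist x y = heis_dist y x.
Proof.
rewrite /heis_dist -heis_normN /heis_norm; congr ((_ ^+ 2 + _ ^+ 2) `^ _).
  by apply: eq_bigr => i _; rewrite mxE !heis_coord_mulV opprB.
rewrite [LHS]mxE -/(heis_t _) !heis_t_mulV.
rewrite (_ : sympl y x = - sympl x y); first by ring.
by rewrite /sympl -sumrN; apply: eq_bigr => i _; ring.
Qed.

Lemma heis_dist_eq0 x y : heis_dist x y = 0 -> x = y.
Proof.
move=> d0; have : hsq (heis_mul (heis_inv x) y) ^+ 2 +
    heis_t (heis_mul (heis_inv x) y) ^+ 2 = 0.
  by rewrite -heis_norm_pow4 -/(heis_dist x y) d0 expr0n.
move/eqP; rewrite paddr_eq0 ?sqr_ge0// !sqrf_eq0 => /andP[/eqP h1 /eqP h2].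
have xy i : x ord0 (lshift 1 i) = y ord0 (lshift 1 i).
  move/eqP: h1; rewrite psumr_eq0 => [|j _]; last exact: sqr_ge0.
  move/allP/(_ i); rewrite mem_index_enum => /(_ isT)/=.
  by rewrite sqrf_eq0 heis_coord_mulV subr_eq0 => /eqP.
apply/rowP => j; have [i ->|i ->] := @split_ordP (n + n) 1 j; first exact: xy.
rewrite (ord1 i); move: h2; rewrite heis_t_mulV.
rewrite (_ : sympl x y = 0) => [|]; last first.
  by rewrite /sympl big1// => k _; rewrite /heis_x /heis_y !xy; ring.
by rewrite mulr0 addr0 => /eqP; rewrite subr_eq0 => /eqP.
Qed.

Lemma measurable_heis_dist :
  measurable_fun setT (fun z : heis R n * heis R n => heis_dist z.1 z.2).
Proof.
have m1 i : measurable_fun setT (fun z : heis R n * heis R n => z.1 ord0 i).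
  exact: measurableT_comp (measurable_coord i) measurable_fst.
have m2 i : measurable_fun setT (fun z : heis R n * heis R n => z.2 ord0 i).
  exact: measurableT_comp (measurable_coord i) measurable_snd.
apply: (measurableT_comp (measurable_powR _)).
apply: measurable_funD.
  apply: measurable_funX; apply: measurable_sum => i; apply: measurable_funX.
  rewrite (_ : (fun _ => _) = (fun z : heis R n * heis R n =>
     z.2 ord0 (lshift 1 i) - z.1 ord0 (lshift 1 i))); first exact: measurable_funB.
  by apply/funext => z; rewrite heis_coord_mulV.
apply: measurable_funX.
rewrite (_ : (fun _ => _) = (fun z : heis R n * heis R n =>
   heis_t z.2 - (heis_t z.1 + 2^-1 * sympl z.1 z.2))); last first.
  by apply/funext => z; rewrite heis_t_mulV.
apply: measurable_funB; first exact: m2.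
apply: measurable_funD; first exact: m1.
apply: measurable_funM => //; apply: measurable_sum => i.
by apply: measurable_funB; apply: measurable_funM; exact: m1 || exact: m2.
Qed.

End heis_geometry.

(* A box sheared along its last coordinate by an affine function of the
   others has the volume of the box. *)
Section sheared_box.
Context {R : realType}.

Definition sheared_box K (l : 'I_K) (a c : 'I_K -> R) (b rho h : R) : set 'rV[R]_K :=
  [set v | (forall i, i != l -> `|v ord0 i - a i| < rho) /\
           `|v ord0 l - (b + \sum_i c i * v ord0 i)| < h].

Lemma measurable_sheared_box K (l : 'I_K) a c b rho h :
  measurable (sheared_box l a c b rho h).
Proof.
rewrite (_ : sheared_box _ _ _ _ _ _ =
  (\bigcap_(i in [set: 'I_K]) [set v : 'rV[R]_K | (i == l) || (`|v ord0 i - a i| < rho)]) `&`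
  [set v | `|v ord0 l - (b + \sum_i c i * v ord0 i)| < h]); last first.
  apply/seteqP; split => v [h1 h2]; split => // i; have := h1 i.
    by case: eqVneq => //= _ + _; exact.
  by case: eqVneq => //= _ + _; exact.
apply: measurableI.
  apply: fin_bigcap_measurable => // i _; have [->|il] := eqVneq i l.
    by rewrite (_ : [set _ | _] = setT)//; apply/seteqP; split.
  apply: measurable_pred.
  apply: measurable_fun_ltr => //; apply: measurableT_comp (@normr_measurable R setT) _.
  by apply: measurable_funB => //; exact: measurable_coord.
apply: measurable_pred; apply: measurable_fun_ltr => //.
apply: measurableT_comp (@normr_measurable R setT) _.
apply: measurable_funB; first exact: measurable_coord.
apply: measurable_funD => //; apply: measurable_sum => i.
by apply: measurable_funM => //; exact: measurable_coord.
Qed.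

(** Coordinates are added in front in [lebesgue_rV], so slicing at the first one leaves a sheared
    box whose offset [b] has moved by [c ord0 * x]. All nonempty slices have the same volume. *)
Lemma sheared_box_measure K (l : 'I_K) a c b (rho h : R) : val l = K.-1 ->
  0 <= rho -> 0 <= h -> c l = 0 ->
  lebesgue_rV K (sheared_box l a c b rho h) = ((2 * rho) ^+ K.-1 * (2 * h))%:E.
Proof.
elim: K l a c b => [|[|K] IH] l a c b lK rho0 h0 cl; first by case: l lK {cl}.
  have l0 : l = ord0 by rewrite ord1.
  rewrite {}l0 in lK cl *; pose A (i : 'I_1) := ball b h.
  rewrite (_ : sheared_box _ _ _ _ _ _ = [set v | forall i, A i (v ord0 i)]).
    rewrite lebesgue_rV_box => [|i]; last exact: measurable_ball.
    by rewrite big_ord_recl big_ord0 mule1 /A lebesgue_measure_ball// expr0 mul1r mulr_natl.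
  apply/seteqP; split => v /=; rewrite /sheared_box /A /=.
    move=> [_]; rewrite big_ord_recl big_ord0 addr0 cl mul0r addr0 => vb i.
    by rewrite (ord1 i) /ball/= distrC.
  move=> /(_ ord0); rewrite /ball/= => vb; split; first by move=> i; rewrite ord1 eqxx.
  by rewrite big_ord_recl big_ord0 addr0 cl mul0r addr0 distrC.
have [l' lE] : exists l' : 'I_K.+1, l = lift ord0 l'.
  have := unliftP ord0 l; case=> [j|] lj; [by exists j|by move: lK; rewrite lj].
have l'K : val l' = K.+1.-1 by move: lK; rewrite lE /= /bump/=; case.
pose a' (i : 'I_K.+1) := a (lift ord0 i); pose c' (i : 'I_K.+1) := c (lift ord0 i).
have c'l : c' l' = 0 by rewrite /c' -lE.
rewrite [LHS]/= /lebesgue_rV_succ /pushforward.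
set S := _ @^-1` _.
have SE x : xsection S x = if `|x - a ord0| < rho then
   sheared_box l' a' c' (b + c ord0 * x) rho h else set0.
  apply/seteqP; split => v; rewrite /xsection /= ?inE.
    rewrite /S /= => -[h1 h2].
    have := h1 ord0; rewrite lE => /(_ isT); rewrite rV_cons0/= => ->.
    split=> [i il|].
      have := h1 (lift ord0 i); rewrite rV_consS; apply.
      by rewrite lE (inj_eq lift_inj).
    move: h2; rewrite lE rV_consS/= big_ord_recl rV_cons0/= addrA.
    by under eq_bigr do rewrite rV_consS.
  case: ifPn => // xr [h1 h2]; split=> [i il|].
    have [j ij|i0] := unliftP ord0 i.
      by rewrite ij rV_consS/=; apply: h1; move: il; rewrite lE ij (inj_eq lift_inj).
    by rewrite i0 rV_cons0.
  rewrite lE rV_consS/= big_ord_recl rV_cons0/= addrA.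
  by under eq_bigr do rewrite rV_consS.
rewrite /product_measure1 /=.
rewrite (_ : (\int[_]_x _)%E = nint lebesgue_measure (fun x : measurableTypeR R =>
   if `|x - a ord0| < rho then (2 * rho) ^+ K * (2 * h) else 0)%R).
  have m : measurable_fun setT (fun x : measurableTypeR R => `|x - a ord0| < rho).
    apply: measurable_fun_ltr => //; apply: measurableT_comp (@normr_measurable R setT) _.
    exact: measurable_funB.
  rewrite nint_if_cst//; last by nneg.
  rewrite (_ : [set x | _] = ball (a ord0) rho); last first.
    by apply/seteqP; split => x; rewrite /ball/= distrC.
  transitivity (((2 * rho) ^+ K * (2 * h))%:E * (rho *+ 2)%:E)%E.
    by congr (_ * _)%E; exact: lebesgue_measure_ball.
  by rewrite -EFinM exprS; congr (_%:E); rewrite -mulr_natl; ring.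
apply: eq_integral => x _ /=; rewrite SE; case: ifP => _.
  exact: IH.
by rewrite measure0.
Qed.

End sheared_box.

(** * Volume of Heisenberg balls *)

Section heis_ball.
Context {R : realType} {n : nat}.
Implicit Types x y : heis R n.

Let last : 'I_(n + n + 1) := rshift (n + n) ord0.

(** Coefficients of half the symplectic form with [x]: left translation shears the last coordinate
    by this linear form. *)
Let coef x (i : 'I_(n + n + 1)) : R :=
  match fintype.split i with
  | inl j => match fintype.split j with
             | inl k => - (2^-1 * heis_y x k)
             | inr k => 2^-1 * heis_x x k
             end
  | inr _ => 0
  end.

Let coef_sum x y : \sum_i coef x i * y ord0 i = 2^-1 *
  \sum_(i < n) (heis_x x i * heis_y y i - heis_y x i * heis_x y i).
Proof.
rewrite big_split_ord/= [X in _ + X]big1 ?addr0; last first.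
  by move=> i _; rewrite /coef (unsplitK (inr i)) mul0r.
rewrite big_split_ord/= mulr_sumr -big_split/=; apply: eq_bigr => i _.
rewrite /coef (unsplitK (inl (lshift n i))) (unsplitK (inl i)).
by rewrite (unsplitK (inl (rshift n i))) (unsplitK (inr i)) /heis_x /heis_y; ring.
Qed.

Let box x := sheared_box last (fun i => x ord0 i) (coef x) (heis_t x).

Let boxE x (rho h : R) y : box x rho h y <->
  (forall i, `|heis_mul (heis_inv x) y ord0 (lshift 1 i)| < rho) /\
  `|heis_t (heis_mul (heis_inv x) y)| < h.
Proof.
rewrite heis_t_mulV /box /sheared_box/= coef_sum; split=> -[h1 h2]; split => //.
  by move=> i; rewrite heis_coord_mulV; apply: h1; rewrite /last -val_eqE/= ltn_eqF// addn0.
move=> i il; have [j ij|j ij] := @split_ordP (n + n) 1 i.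
  by rewrite ij -heis_coord_mulV.
by move: il; rewrite ij (ord1 j) eqxx.
Qed.

Let box_measure x (rho h : R) : 0 <= rho -> 0 <= h ->
  heis_measure R n (box x rho h) = ((2 * rho) ^+ (n + n) * (2 * h))%:E.
Proof.
move=> rho0 h0; rewrite sheared_box_measure ?addn1//=.
  by rewrite /last/= addn0 addn1.
by rewrite /coef (unsplitK (inr ord0)).
Qed.

Lemma measurable_heis_ball x (r : R) : measurable [set y | heis_dist x y < r].
Proof.
apply: measurable_pred; apply: measurable_fun_ltr => //.
exact: measurableT_comp measurable_heis_dist (measurable_pair1 x).
Qed.

(** The ball lies in the translated box of half-widths [r] and [r ^ 2], of volume
    [(2 r) ^ (2 n) (2 r ^ 2)]. *)
Lemma heis_ball_le x (r : R) : 0 < r ->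
  (heis_measure R n [set y | (heis_dist x y < r)%R] <=
    (2 ^+ (n + n).+1 * r ^+ (heis_dim n))%:E)%E.
Proof.
move=> r0; rewrite [leRHS](_ : _ = heis_measure R n (box x r (r ^+ 2))); last first.
  rewrite box_measure ?ltW ?exprn_gt0//; congr (_%:E).
  rewrite exprMn exprS /heis_dim (_ : 2 * n + 2 = n + n + 2)%N; last by rewrite mul2n addnn.
  rewrite (exprD r _ 2); move: (2 ^+ (n + n)) (r ^+ (n + n)) => A B; ring.
apply: le_measure; rewrite ?inE.
- exact: measurable_heis_ball.
- exact: measurable_sheared_box.
- move=> y /=; rewrite /heis_dist heis_norm_lt ?ltW// => yr.
  set v := heis_mul (heis_inv x) y in yr *; apply/boxE; rewrite -/v.
  have S0 : 0 <= \sum_(i < n + n) v ord0 (lshift 1 i) ^+ 2.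
    by apply: sumr_ge0 => i _; exact: sqr_ge0.
  have e4 : r ^+ 4 = (r ^+ 2) ^+ 2 by rewrite -exprM.
  split=> [i|].
    rewrite -ltr_sqr ?nnegrE ?normr_ge0 ?ltW// real_normK ?num_real//.
    rewrite -ltr_sqr ?nnegrE ?sqr_ge0// -e4; apply: le_lt_trans yr.
    rewrite ler_wpDr ?sqr_ge0// ler_sqr ?nnegrE ?sqr_ge0//.
    by rewrite (bigD1 i)//= lerDl sumr_ge0// => j _; exact: sqr_ge0.
  rewrite -ltr_sqr ?nnegrE ?normr_ge0 ?sqr_ge0// real_normK ?num_real// -e4.
  by apply: le_lt_trans yr; rewrite lerDr sqr_ge0.
Qed.

Lemma heis_ball_ge : exists2 c : R, 0 < c & forall x (r : R), 0 < r ->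
  ((c * r ^+ (heis_dim n))%:E <= heis_measure R n [set y | (heis_dist x y < r)%R])%E.
Proof.
(* The box of half-widths [k r] and [(k r) ^ 2] fits in the ball because [(N ^ 2 + 1) k ^ 4 <= 1]
   for [N = 2 n] and [k = 1 / (N + 1)]. *)
pose k : R := (n.*2.+1)%:R^-1.
have k0 : 0 < k by rewrite invr_gt0 ltr0n.
exists ((2 * k) ^+ (n + n) * (2 * k ^+ 2)); first by npos.
move=> x r r0; rewrite [leLHS](_ : _ = heis_measure R n (box x (k * r) ((k * r) ^+ 2))); last first.
  rewrite box_measure ?mulr_ge0 ?exprn_ge0 ?mulr_ge0 ?(ltW k0) ?(ltW r0)//; congr (_%:E).
  rewrite !exprMn /heis_dim (_ : 2 * n + 2 = n + n + 2)%N; last by rewrite mul2n addnn.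
  rewrite (exprD r _ 2); move: (2 ^+ (n + n)) (k ^+ (n + n)) (r ^+ (n + n)) => A B D; ring.
apply: le_measure; rewrite ?inE.
- exact: measurable_sheared_box.
- exact: measurable_heis_ball.
- move=> y /boxE[h1 h2]; rewrite /= /heis_dist heis_norm_lt ?ltW//.
  set v := heis_mul _ _ in h1 h2 *.
  have kr0 : 0 < k * r by rewrite mulr_gt0.
  have t1 : heis_t v ^+ 2 < (k * r) ^+ 4.
    rewrite -[4%N]/(2 * 2)%N exprM -[heis_t v ^+ 2]real_normK ?num_real//.
    by rewrite ltr_sqr ?nnegrE ?exprn_ge0 ?(ltW kr0).
  have s1 : \sum_(i < n + n) v ord0 (lshift 1 i) ^+ 2 <= (n.*2)%:R * (k * r) ^+ 2.
    rewrite -addnn mulr_natl -[X in (k * r) ^+ 2 *+ X]card_ord -sumr_const.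
    apply: ler_sum => i _; rewrite -[leLHS]real_normK ?num_real//.
    by rewrite ler_sqr ?nnegrE ?(ltW kr0)// ltW.
  have S0 : 0 <= \sum_(i < n + n) v ord0 (lshift 1 i) ^+ 2.
    by apply: sumr_ge0 => i _; exact: sqr_ge0.
  have s2 : (\sum_(i < n + n) v ord0 (lshift 1 i) ^+ 2) ^+ 2 <=
      ((n.*2)%:R * (k * r) ^+ 2) ^+ 2.
    by rewrite ler_sqr ?nnegrE// mulr_ge0 ?exprn_ge0 ?(ltW kr0).
  apply: lt_le_trans (ler_ltD s2 t1) _.
  have -> : ((n.*2)%:R * (k * r) ^+ 2) ^+ 2 + (k * r) ^+ 4 =
     ((n.*2)%:R ^+ 2 + 1) * k ^+ 4 * r ^+ 4 by ring.
  rewrite ler_piMl ?exprn_ge0 ?(ltW r0)//.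
  rewrite /k exprVn ler_pdivrMr ?exprn_gt0 ?ltr0n// mul1r.
  rewrite -[n.*2.+1%:R]natr1; have : 0 <= (n.*2)%:R :> R by [].
  move: (n.*2)%:R => N N0.
  rewrite -subr_ge0 (_ : _ - _ = N ^+ 4 + 4 * N ^+ 3 + 5 * N ^+ 2 + 4 * N); last by ring.
  by rewrite !addr_ge0 ?mulr_ge0 ?exprn_ge0.
Qed.

End heis_ball.

(** * Power growth from the bounds on [t g(t) / G(t)] *)

Section growth_function.
Context {R : realType} (p q : R) (g : R -> R).
Hypothesis gG : growth_function p q g.

Local Notation G := (primitiveG g).

Let g_ge0 t : 0 <= t -> 0 <= g t.
Proof.
rewrite le_eqVlt => /predU1P[<-|t0]; first by rewrite (growth0 gG).
by rewrite ltW// -(growth0 gG) (growth_increasing gG).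
Qed.

Let g_gt0 t : 0 < t -> 0 < g t.
Proof. by move=> t0; rewrite -(growth0 gG) (growth_increasing gG). Qed.

Let p0 : 0 < p. Proof. exact: lt_trans (growth_p_gt1 gG). Qed.

Lemma growth_pq : p <= q.
Proof. by have /andP[] := growth_bounds gG ltr01; exact: le_trans. Qed.

Let q0 : 0 < q. Proof. exact: lt_le_trans growth_pq. Qed.

(* A nonpositive value of [G] would make the quotient [t g(t) / G(t)], which
   is at least [p], nonpositive (zero if [G t = 0]). *)
Let primitiveG_gt0 t : 0 < t -> 0 < G t.
Proof.
move=> t0; have /andP[+ _] := growth_bounds gG t0.
rewrite ltNge => h; apply/negP => G0; move: h; apply/negP; rewrite -ltNge.
by apply: le_lt_trans p0; rewrite mulr_ge0_le0 ?invr_le0// mulr_ge0 ?g_ge0 ?ltW.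
Qed.

Lemma primitiveG0 : G 0 = 0.
Proof. by rewrite /primitiveG set_itv1 Rintegral_set1. Qed.

Lemma primitiveG_bounds t : 0 <= t -> p * G t <= energy g t <= q * G t.
Proof.
rewrite le_eqVlt => /predU1P[<-|t0].
  by rewrite primitiveG0 /energy mul0r !mulr0 lexx.
by have := growth_bounds gG t0; rewrite ler_pdivlMr ?ler_pdivrMr ?primitiveG_gt0.
Qed.

Let derivable_primitiveG t : 0 < t -> derivable G t 1 /\ derive1 G t = g t.
Proof.
move=> t0; apply: (@continuous_FTC1_closed R g 0 t (t + 1)) => //.
- by rewrite ltrDl.
- apply: continuous_compact_integrable; first exact: segment_compact.
  apply: continuous_subspaceW (growth_continuous gG).
  exact: subset_itvl.
- have /continuous_within_itvcyP[+ _] := growth_continuous gG.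
  by apply; rewrite in_itv/= t0.
Qed.

(** The bounds [p G <= t g <= q G] give this derivative a sign for [a = p] and for [a = q], so
    [G t / t ^ p] increases and [G t / t ^ q] decreases. *)
Let is_derive_powerG (a t : R) : 0 < t ->
  is_derive t 1 (fun x => G x * x `^ (- a)) (t `^ (- a - 1) * (t * g t - a * G t)).
Proof.
move=> t0; have [dG DG] := derivable_primitiveG t0.
have h1 : is_derive t 1 G (g t) by rewrite -DG derive1E; exact: derivableP.
have h2 := is_derive1_powR (- a) t0.
apply: is_derive_eq (is_deriveM h1 h2) _.
rewrite /GRing.scale/= [t `^ - a](_ : _ = t `^ (- a - 1) * t); first ring.
by rewrite -[X in _ * X]powRr1 ?ltW// -powRD ?subrK// (gt_eqF t0) implybT.
Qed.

Let powerG_within (a b c : R) : 0 < b ->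
  {within `[b, c], continuous (fun x => G x * x `^ (- a))}.
Proof.
move=> b0; apply: derivable_within_continuous => x.
rewrite in_itv/= => /andP[bx _].
by have [] := is_derive_powerG a (lt_le_trans b0 bx).
Qed.

Let powerG_le l t : 1 <= l -> 0 < t -> G (l * t) <= l `^ q * G t.
Proof.
move=> l1 t0; have l0 : 0 < l by exact: lt_le_trans l1.
have tlt : t <= l * t by rewrite ler_pMl.
have h x : x \in `]t, (l * t)[ -> 0 < x.
  by rewrite in_itv/= => /andP[/(lt_trans t0)].
have : G (l * t) * (l * t) `^ (- q) <= G t * t `^ (- q).
  apply: (@ler0_derive1_nincr _ (fun x => G x * x `^ (- q)) t (l * t)) => //.
  - by move=> x /h x0; have [] := is_derive_powerG q x0.
  - move=> x /h x0; rewrite derive1E; have -> := @derive_val _ _ _ _ _ _ _ (is_derive_powerG q x0).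
    rewrite mulr_ge0_le0 ?powR_ge0// subr_le0.
    by have /andP[] := primitiveG_bounds (ltW x0).
  - exact: powerG_within.
rewrite (powRM _ (ltW l0) (ltW t0)) !powRN mulrA ler_pM2r ?invr_gt0 ?powR_gt0//.
by rewrite ler_pdivrMr ?powR_gt0// [G t * _]mulrC.
Qed.

Let powerG_ge l t : 1 <= l -> 0 < t -> l `^ p * G t <= G (l * t).
Proof.
move=> l1 t0; have l0 : 0 < l by exact: lt_le_trans l1.
have tlt : t <= l * t by rewrite ler_pMl.
have h x : x \in `]t, (l * t)[ -> 0 < x.
  by rewrite in_itv/= => /andP[/(lt_trans t0)].
have : G t * t `^ (- p) <= G (l * t) * (l * t) `^ (- p).
  apply: (@ger0_derive1_ndecr _ (fun x => G x * x `^ (- p)) t (l * t)) => //.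
  - by move=> x /h x0; have [] := is_derive_powerG p x0.
  - move=> x /h x0; rewrite derive1E; have -> := @derive_val _ _ _ _ _ _ _ (is_derive_powerG p x0).
    rewrite mulr_ge0 ?powR_ge0// subr_ge0.
    by have /andP[] := primitiveG_bounds (ltW x0).
  - exact: powerG_within.
rewrite (powRM _ (ltW l0) (ltW t0)) !powRN mulrA ler_pM2r ?invr_gt0 ?powR_gt0//.
by rewrite ler_pdivlMr ?powR_gt0// mulrC.
Qed.

(** The power bounds pass from [G] to [t g(t)] at the cost of the ratio [q / p], and then to [g] by
    dividing out [l t]. Composing with [Num.max t 0] gives the extension by [0] to negative
    arguments that [pg_eq0] demands. *)
Lemma growth_function_power :
  power_growth p q (q / p) (fun t => g (Num.max t 0)).
Proof.
have mono : {in `[0, +oo[ &, {homo g : x y / x <= y}}.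
  move=> x y; rewrite !in_itv/= !andbT => x0 _.
  rewrite le_eqVlt => /predU1P[->//|xy]; exact/ltW/(growth_increasing gG).
have key (l t : R) : 1 <= l -> 0 <= t -> l `^ (p - 1) * g t <= q / p * g (l * t) /\
    g (l * t) <= q / p * l `^ (q - 1) * g t.
  move=> l1; have l0 : 0 < l by exact: lt_le_trans l1.
  rewrite le_eqVlt => /predU1P[<-|t0]; first by rewrite mulr0 (growth0 gG) !mulr0.
  have lt0 : 0 < l * t by rewrite mulr_gt0.
  have /andP[pG qG] := primitiveG_bounds (ltW t0).
  have /andP[pG' qG'] := primitiveG_bounds (ltW lt0).
  have pw (a : R) : l `^ a = l * l `^ (a - 1).
    by rewrite -[X in X * _]powRr1 ?ltW// -powRD ?subrKC// (gt_eqF l0) implybT.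
  split.
    rewrite -(ler_pM2l (mulr_gt0 p0 lt0)).
    rewrite [leLHS](_ : _ = p * (l `^ p * energy g t)); last first.
      by rewrite /energy (pw p); ring.
    rewrite [leRHS](_ : _ = q * energy g (l * t)); last first.
      by rewrite /energy; field; exact: lt0r_neq0.
    apply: le_trans (_ : p * (l `^ p * (q * G t)) <= _).
      by rewrite ler_pM2l// ler_wpM2l ?powR_ge0.
    rewrite [leLHS](_ : _ = q * (p * (l `^ p * G t))); last by ring.
    rewrite ler_pM2l//; apply: le_trans pG'; rewrite ler_pM2l//; exact: powerG_ge.
  rewrite -(ler_pM2l (mulr_gt0 p0 lt0)).
  rewrite [leRHS](_ : _ = q * (l `^ q * energy g t)); last first.
    by rewrite /energy (pw q); field; exact: lt0r_neq0.
  rewrite -mulrA -/(energy g (l * t)).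
  apply: le_trans (_ : p * (q * G (l * t)) <= _); first by rewrite ler_pM2l.
  rewrite mulrCA ler_pM2l//; apply: le_trans (_ : p * (l `^ q * G t) <= _).
    by rewrite ler_pM2l//; exact: powerG_le.
  by rewrite mulrCA ler_wpM2l ?powR_ge0.
split.
- move=> x y xy; apply: mono; last by rewrite ge_max !le_max xy lexx !orbT.
    by rewrite in_itv/= andbT le_max lexx orbT.
  by rewrite in_itv/= andbT le_max lexx orbT.
- by move=> t t0; rewrite max_r// (growth0 gG).
- by move=> t t0; rewrite max_l ?ltW// g_gt0.
- move=> l t l1 t0; have l0 : 0 <= l by exact: le_trans l1.
  by rewrite !max_l ?mulr_ge0//; have [] := key _ _ l1 t0.
- move=> l t l1 t0; have l0 : 0 <= l by exact: le_trans l1.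
  by rewrite !max_l ?mulr_ge0//; have [] := key _ _ l1 t0.
Qed.

Lemma growth_invK y : 0 <= y -> 0 <= growth_inv g y /\ g (growth_inv g y) = y.
Proof.
move=> y0.
have [x x0 gx] : exists2 x, 0 <= x & g x = y.
  have /cvgryPge/(_ y) := growth_infty gG.
  move=> [M [_ MP]]; pose b := Num.max (M + 1) 0.
  have b0 : 0 <= b by rewrite le_max lexx orbT.
  have yb : y <= g b by apply: MP; rewrite lt_max ltrDl ltr01.
  have [||c] := @IVT R g 0 b y b0.
  - apply: continuous_subspaceW (growth_continuous gG); exact: subset_itvl.
  - by rewrite (growth0 gG) ge_min y0 le_max yb orbT.
  by rewrite in_itv/= => /andP[c0 _]; exists c.
have sj : set_surj `[0, +oo[ [set y] g.
  by move=> z ->; exists x => //=; rewrite in_itv/= x0.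
split.
  have := @surjpinv_image_sub _ _ (fun=> 0) _ _ _ sj (growth_inv g y).
  by rewrite /= in_itv/= andbT; apply; exists y.
by have := @surjpK _ _ (fun=> 0) _ _ _ sj y; apply; rewrite inE.
Qed.

End growth_function.

(** * Null sets *)

Section null_sets.
Context d (T : measurableType d) (R : realType) (mu : {measure set T -> \bar R}).

Import HBNNSimple.

(* [f] and [h] need not be measurable. *)
Lemma le_integral_null (Z : set T) (f h : T -> \bar R) :
  measurable Z -> mu Z = 0%E -> (forall x, (0 <= f x)%E) ->
  (forall x, (0 <= h x)%E) -> (forall x, ~ Z x -> (f x <= h x)%E) ->
  (\int[mu]_x f x <= \int[mu]_x h x)%E.
Proof.
move=> mZ Z0 f0 h0 fh; have mZc : measurable (~` Z) by exact: measurableC.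
(* The integral is a supremum over simple functions. One lying below [f] keeps its integral when set
   to [0] on [Z], and then lies below [h]. *)
rewrite (ge0_integralTE mu f0) /=; apply: ge_ereal_sup => _ [phi /= phif <-].
rewrite -integralT_nnsfun (ge0_negligible_integral mZ)//=; last 2 first.
- by apply/measurable_EFinP; exact: measurable_funPT.
- by move=> x _; rewrite lee_fin.
rewrite integral_mkcond setTD.
rewrite (_ : _ \_ _ = (fun x => (proj_nnsfun phi mZc x)%:E)); last first.
  by rewrite -mrestrict; apply/funext => x; rewrite /patch; case: ifP.
rewrite integralT_nnsfun (ge0_integralTE mu h0)/=.
apply: ereal_sup_ubound; exists (proj_nnsfun phi mZc) => //= x.
rewrite mindicE; case: (boolP (x \in ~` Z)) => [|_]; last by rewrite mulr0.
by rewrite mulr1 inE => /= nZ; apply: le_trans (phif x) (fh _ nZ).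
Qed.

Lemma eq_integral_null (Z : set T) (f h : T -> \bar R) :
  measurable Z -> mu Z = 0%E -> (forall x, (0 <= f x)%E) ->
  (forall x, (0 <= h x)%E) -> (forall x, ~ Z x -> f x = h x) ->
  (\int[mu]_x f x = \int[mu]_x h x)%E.
Proof.
move=> mZ Z0 f0 h0 fh; apply/eqP; rewrite eq_le; apply/andP; split.
  by apply: (le_integral_null mZ Z0) => // x /fh ->.
by apply: (le_integral_null mZ Z0) => // x /fh ->.
Qed.

(** The factor [K] is moved to [f], because [h] may fail to be measurable and constants are pulled
    out only of integrals of measurable functions. *)
Lemma nint_le_null (Z : set T) (f : T -> R) (h : T -> \bar R) (K : R) :
  measurable Z -> mu Z = 0%E -> measurable_fun setT f -> 0 < K ->
  (forall x, 0 <= f x) -> (forall x, (0 <= h x)%E) ->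
  (forall x, ~ Z x -> ((f x)%:E <= K%:E * h x)%E) ->
  (nint mu f <= K%:E * \int[mu]_x h x)%E.
Proof.
move=> mZ Z0 mf K0 f0 h0 fh.
rewrite (_ : f = (fun x => K * (K^-1 * f x))); last first.
  by apply/funext => x; rewrite mulrA divff ?mul1r// gt_eqF.
rewrite (nintZ _ _ (ltW K0)); last 2 first.
- exact: measurable_funM.
- by move=> x; rewrite mulr_ge0 ?invr_ge0 ?(ltW K0).
rewrite lee_pmul2l//; apply: (le_integral_null mZ Z0) => // x.
  by rewrite lee_fin mulr_ge0 ?invr_ge0 ?(ltW K0).
by move=> /fh; rewrite EFinM lee_pdivrMl.
Qed.

Lemma integral_lt_null (Z : set T) (h : T -> \bar R) (f : T -> R) (K : R) :
  measurable Z -> mu Z = 0%E -> measurable_fun setT f -> 0 <= K ->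
  (forall x, 0 <= f x) -> (forall x, (0 <= h x)%E) ->
  (forall x, ~ Z x -> (h x <= (K * f x)%:E)%E) -> (nint mu f < +oo)%E ->
  (\int[mu]_x h x < +oo)%E.
Proof.
move=> mZ Z0 mf K0 f0 h0 hf foo.
apply: le_lt_trans (_ : nint mu (fun x => K * f x)%R < +oo)%E.
  by apply: (le_integral_null mZ Z0) => // x; rewrite lee_fin mulr_ge0.
by rewrite nintZ// lte_mul_pinfty.
Qed.

Lemma nint_pos_null (Z : set T) (f : T -> R) (h : T -> \bar R) (K : R) :
  measurable Z -> mu Z = 0%E -> measurable_fun setT f -> 0 < K ->
  (forall x, (0 <= h x)%E) ->
  (forall x, ~ Z x -> h x = (Num.max (f x / K) 0)%:E) ->
  nint mu (fun x => Num.max (f x) 0) = (K%:E * \int[mu]_x h x)%E.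
Proof.
move=> mZ Z0 mf K0 h0 hf.
rewrite (_ : (fun x => _) = (fun x => K * Num.max (f x / K) 0)); last first.
  by apply/funext => x; rewrite maxr_pMr ?(ltW K0)// mulr0 mulrC divfK// gt_eqF.
rewrite (nintZ _ _ (ltW K0)); last 2 first.
- by apply: measurable_maxr0; exact: measurable_funM.
- by move=> x; rewrite le_max lexx orbT.
congr (_ * _)%E; apply: (eq_integral_null mZ Z0) => // x; last by move/hf ->.
by rewrite lee_fin le_max lexx orbT.
Qed.

Lemma borel_representative (u : T -> R) (N : set T) :
  (forall Y : set R, measurable Y -> completed_algebra_gen mu (u @^-1` Y)) ->
  mu.-negligible N -> exists Z, [/\ measurable Z, mu Z = 0%E, N `<=` Z &
    measurable_fun setT (fun x => if x \in Z then 0 else u x)].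
Proof.
move=> mu_u Nn; pose t k : R := if unpickle k is Some a then ratr (a : rat) else 0.
have /choice[A HA] k : exists A, [/\ measurable A, A `<=` [set x | u x < t k] &
    mu.-negligible ([set x | u x < t k] `\` A)].
  have [A mA [M Mn AM]] := mu_u _ (measurable_itv `]-oo, t k[).
  have E : A `|` M = [set x | u x < t k].
    by rewrite AM; apply/seteqP; split => x /=; rewrite in_itv.
  exists A; split=> //; rewrite -E; first exact: subsetUl.
  by apply: negligibleS Mn => x [[]].
have [Z [mZ Z0 NZ]] : mu.-negligible (N `|` \bigcup_k ([set x | u x < t k] `\` A k)).
  by apply: negligibleU => //; apply: negligible_bigcup => k; have [] := HA k.
exists Z; split=> //; first by apply: subset_trans NZ; exact: subsetUl.
apply: (measurability _ (RGenInftyO.measurableE R)) => _ [_ [a ->] <-]; rewrite setTI.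
rewrite (_ : _ @^-1` _ = (\bigcup_(k in [set k | t k < a]) (A k `\` Z)) `|`
  (if 0 < a then Z else set0)); last first.
  apply/seteqP; split=> x /=; rewrite in_itv/=.
    case: ifPn; rewrite ?inE ?notin_setE => Zx xa; first by right; rewrite xa.
    left; have [b] := rat_in_itvoo xa; rewrite in_itv/= => /andP[ub ba].
    have tb : t (pickle b) = ratr b by rewrite /t pickleK.
    exists (pickle b); first by rewrite /= tb.
    split=> //.
    apply: contrapT => Ax; apply: Zx; apply: NZ; right; exists (pickle b) => //.
    by split=> //=; rewrite tb.
  move=> [[k /= ka [Ax Zx]]|].
    rewrite (negbTE (_ : x \notin Z)) ?notin_setE//.
    by have [_ /(_ _ Ax)/= uk _] := HA k; exact: lt_trans ka.
  by case: ifPn => // a0 Zx; rewrite (_ : x \in Z) ?inE.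
apply: measurableU; last by case: ifP.
apply: bigcup_measurable => k _; apply: measurableD => //.
by have [] := HA k.
Qed.

End null_sets.

Lemma measurable_nullX d (T : measurableType d) (R : realType)
    (mu : {sigma_finite_measure set T -> \bar R}) (Z : set T) :
  measurable Z -> mu Z = 0%E ->
  measurable (Z `*` setT `|` setT `*` Z) /\
  (mu \x mu)%E (Z `*` setT `|` setT `*` Z) = 0%E.
Proof.
move=> mZ Z0; have m1 : measurable (Z `*` [set: T]) by exact: measurableX.
have m2 : measurable ([set: T] `*` Z) by exact: measurableX.
split; first exact: measurableU.
apply/eqP; rewrite eq_le measure_ge0 andbT.
apply: le_trans (measureU2 _ m1 m2) _.
have e : ((mu \x mu) (Z `*` [set: T]) + (mu \x mu) ([set: T] `*` Z) <= 0)%E.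
  rewrite (product_measure1E mu mu mZ measurableT).
  rewrite (product_measure1E mu mu measurableT mZ).
  have h (y : \bar R) : (mu Z * y = 0)%E by rewrite Z0 mul0e.
  by rewrite h muleC h adde0.
exact: e.
Qed.

Lemma power_growth_scale (R : realType) (p q La La' k : R) (g : R -> R) :
  0 < k -> La <= La' -> power_growth p q La g ->
  power_growth p q La' (fun t => g (t / k)).
Proof.
move=> k0 LL gG; have g0 t : 0 <= g t.
  have [t0|t0] := leP t 0; first by rewrite (pg_eq0 gG).
  exact/ltW/(pg_gt0 gG).
split.
- by move=> x y xy; apply: (pg_homo gG); rewrite ler_pM2r ?invr_gt0.
- by move=> t t0; apply: (pg_eq0 gG); rewrite mulr_le0_ge0 ?invr_ge0 ?(ltW k0).
- by move=> t t0; apply: (pg_gt0 gG); rewrite divr_gt0.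
- move=> l t l1 t0; rewrite -(mulrA l t); apply: le_trans (pg_upper gG l1 _) _.
    by rewrite divr_ge0 ?(ltW k0).
  by rewrite ler_wpM2r// ler_wpM2r ?powR_ge0.
- move=> l t l1 t0; rewrite -(mulrA l t); apply: le_trans (pg_lower gG l1 _) _.
    by rewrite divr_ge0 ?(ltW k0).
  by rewrite ler_wpM2r.
Qed.

(** * Rescaling to the unit ball *)

Section rescaling.
Context {R : realType} {n : nat} (p q s La c0 r : R) (g : R -> R)
  (Omega : set (heis R n)) (u : heis R n -> R) (xi0 : heis R n) (Z : set (heis R n)).

Local Notation mu := (heis_measure R n).
Local Notation Q := ((heis_dim n)%:R : R).
Local Notation G := (primitiveG g).
Local Notation g0 := (fun t => g (Num.max t 0)).
Local Notation v := (fun x => if x \in Z then 0 else u x).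

Definition scaled_dist (x y : heis R n) : R := heis_dist x y / r.
(** Dividing the argument by [r ^ s] compensates for dividing the distance by [r], so [g] is
    evaluated at the same quotients as before and only powers of [r] come out as factors. *)
Definition scaled_growth (t : R) : R := g (Num.max (t / r `^ s) 0).

Hypotheses (s01 : 0 < s < 1) (r0 : 0 < r) (gG : growth_function p q g).
Hypotheses (La1 : 1 <= La) (Lapq : q / p <= La) (c00 : 0 < c0).
Hypothesis Lac : 2 ^+ (n + n).+1 <= La * c0.
Hypothesis ballc : forall x (t : R), 0 < t ->
  ((c0 * t ^+ (heis_dim n))%:E <= mu [set y | (heis_dist x y < t)%R])%E.
Hypotheses (mZ : measurable Z) (Z0 : mu Z = 0%E) (mv : measurable_fun setT v).
Hypothesis uZ : forall x, ~ Z x -> heis_dist xi0 x < 4 * r -> 0 <= u x.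
Hypothesis sub : compactly_contained (heis_ball xi0 (4 * r)) Omega.
Hypothesis weak : weak_solution s g Omega u.

Local Notation d' := scaled_dist.
Local Notation g' := scaled_growth.
Local Notation c' := (c0 * r ^+ heis_dim n).

Let s0 : 0 < s. Proof. by case/andP: s01. Qed.
Let p0 : 0 < p. Proof. exact: lt_trans (growth_p_gt1 gG). Qed.
Let q0 : 0 < q. Proof. exact: lt_le_trans (growth_pq gG). Qed.
Let rs0 : 0 < r `^ s. Proof. exact: powR_gt0. Qed.
Let d0 x y : 0 <= @heis_dist R n x y. Proof. exact: heis_norm_ge0. Qed.
Let pg0 : power_growth p q (q / p) g0. Proof. exact: growth_function_power. Qed.

Lemma power_growth_scaled : power_growth p q La g'.
Proof. exact: power_growth_scale rs0 Lapq pg0. Qed.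

Let pg' := power_growth_scaled.

Let g'0 t : 0 <= g' t. Proof. exact: pg_ge0 pg' _. Qed.
Let g00 t : 0 <= g0 t. Proof. exact: (pg_ge0 pg0). Qed.
Let mg' : measurable_fun setT g'. Proof. exact: measurable_pg pg'. Qed.

Lemma regular_scaled_dist : regular_metric mu Q La d' c'.
Proof.
have ballE x t : 0 < t ->
    [set y | scaled_dist x y < t] = [set y | heis_dist x y < t * r].
  by move=> t0; apply/seteqP; split => y; rewrite /= /scaled_dist ltr_pdivrMr.
split.
- by move=> x y; rewrite divr_ge0 ?(ltW r0).
- move=> x y /eqP; rewrite mulf_eq0 invr_eq0 (gt_eqF r0) orbF => /eqP.
  exact: heis_dist_eq0.
- by move=> x y; rewrite /scaled_dist heis_distC.
- by move=> x y z; rewrite /scaled_dist -mulrDl ler_pM2r ?invr_gt0// heis_dist_triangle.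
- by apply: measurable_funM => //; exact: measurable_heis_dist.
- by rewrite mulr_gt0 ?exprn_gt0.
- move=> x t t0; rewrite ballE//; apply: le_trans (ballc x (mulr_gt0 t0 r0)).
  by rewrite lee_fin powR_mulrn ?(ltW t0)// exprMn -mulrA [r ^+ _ * _]mulrC.
- move=> x t t0; rewrite ballE//; apply: le_trans (heis_ball_le x (mulr_gt0 t0 r0)) _.
  rewrite lee_fin powR_mulrn ?(ltW t0)// exprMn [t ^+ _ * _]mulrC !mulrA.
  by rewrite ler_wpM2r ?exprn_ge0 ?(ltW t0)// ler_wpM2r ?exprn_ge0 ?(ltW r0).
Qed.

Let md' : measurable_fun setT (fun z : heis R n * heis R n => d' z.1 z.2).
Proof. exact: rm_measurable regular_scaled_dist. Qed.

Let md1 (x : heis R n) : measurable_fun setT (fun y : heis R n => heis_dist x y).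
Proof. exact: measurableT_comp measurable_heis_dist (measurable_pair1 x). Qed.

Let scaled_powR a x y : d' x y `^ a = heis_dist x y `^ a / r `^ a.
Proof. by rewrite /scaled_dist powRM ?invr_ge0 ?(ltW r0)// powRV// ltW. Qed.

Let scaled_quot (a k : R) : a / (k / r `^ s) / r `^ s = a / k.
Proof. by rewrite invf_div mulrA mulrAC mulfK ?gt_eqF. Qed.

Lemma energy_density_scaled w z : energy_density s Q d' g' w z = r `^ s * r `^ Q *
  (energy g0 (`|w z.1 - w z.2| / heis_dist z.1 z.2 `^ s) / heis_dist z.1 z.2 `^ Q).
Proof.
rewrite /energy_density /energy /scaled_growth !scaled_powR scaled_quot !invf_div.
ring.
Qed.

Lemma flux_scaled w psi z : flux s Q d' g' w psi z = r `^ (Q + s) *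
  (g (`|w z.1 - w z.2| / heis_dist z.2 z.1 `^ s) *
   ((w z.1 - w z.2) / `|w z.1 - w z.2|) * (psi z.1 - psi z.2) /
   heis_dist z.2 z.1 `^ (Q + s)).
Proof.
rewrite /flux /scaled_growth !scaled_powR scaled_quot invf_div max_l; last first.
  by rewrite mulr_ge0 ?invr_ge0 ?powR_ge0.
rewrite (heis_distC z.2) (_ : (_ - _) / `|_ - _| = Num.sg (w z.1 - w z.2)); first ring.
have [->|w0] := eqVneq (w z.1 - w z.2) 0; first by rewrite sgr0 mul0r.
by rewrite [X in X / _]numEsg mulfK ?normr_eq0.
Qed.

(** The constant depends on [r]; it is used only to transfer the finiteness of integrals, never in
    an estimate. *)
Let growth_comparable : exists2 K : R, 0 < K &
  forall t, 0 <= t -> g' t <= K * g0 t /\ g0 t <= K * g' t.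
Proof.
pose k := 1 + r `^ s + (r `^ s)^-1.
have k1 : 1 <= k by rewrite /k -addrA lerDl addr_ge0 ?invr_ge0 ?(ltW rs0).
have rk : r `^ s <= k by rewrite /k -addrA addrCA lerDl addr_ge0 ?invr_ge0 ?(ltW rs0).
have irk : (r `^ s)^-1 <= k by rewrite /k lerDr addr_ge0// ltW.
exists (La * k `^ (q - 1)).
  by rewrite mulr_gt0 ?powR_gt0 ?(lt_le_trans ltr01).
move=> t t0; split.
  apply: le_trans (_ : g0 (k * t) <= _).
    by apply: (pg_homo pg0); rewrite mulrC ler_wpM2r.
  apply: le_trans (pg_upper pg0 k1 t0) _.
  by rewrite ler_wpM2r// ler_wpM2r ?powR_ge0.
apply: le_trans (_ : g' (k * t) <= _); last exact: pg_upper pg' _ _ k1 t0.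
rewrite (_ : g0 t = g' (r `^ s * t)); last first.
  by rewrite /scaled_growth [_ * t]mulrC mulfK// gt_eqF.
by apply: (pg_homo pg'); rewrite ler_wpM2r.
Qed.

Let g_ge0 t : 0 <= t -> 0 <= g t.
Proof. by move=> t0; have := g00 t; rewrite max_l. Qed.

Let energy_g0 t : 0 <= t -> energy g0 t = energy g t.
Proof. by move=> t0; rewrite /energy max_l. Qed.

Let G_ge0 t : 0 <= t -> 0 <= G t.
Proof.
move=> t0; have /andP[_] := primitiveG_bounds gG t0.
rewrite -(energy_g0 t0) => h; rewrite -(pmulr_rge0 _ q0); apply: le_trans h.
by rewrite mulr_ge0.
Qed.

Let G_le t : 0 <= t -> G t <= p^-1 * energy g0 t.
Proof.
move=> t0; have /andP[+ _] := primitiveG_bounds gG t0.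
by rewrite energy_g0// -ler_pdivlMl.
Qed.

Let G_ge t : 0 <= t -> energy g0 t <= q * G t.
Proof. by move=> t0; have /andP[_] := primitiveG_bounds gG t0; rewrite energy_g0. Qed.

Let scaled_ball x : d' xi0 x < 3 -> heis_ball xi0 (4 * r) x.
Proof.
rewrite ltr_pdivrMr// => h; apply: lt_le_trans h _.
by rewrite ler_pM2r// ler_nat.
Qed.

Let ball_Omega : heis_ball xi0 (4 * r) `<=` Omega.
Proof. by apply: subset_trans sub.2; exact: subset_closure. Qed.

Let inv_powR_le (a b e : R) : 0 < a -> a <= b -> 0 <= e -> (b `^ e)^-1 <= (a `^ e)^-1.
Proof.
move=> a0 ab e0; have b0 : 0 < b by exact: lt_le_trans ab.
rewrite lef_pV2 ?posrE ?powR_gt0//; apply: ge0_ler_powR => //; by rewrite nnegrE ltW.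
Qed.

Let mZZ := measurable_nullX mZ Z0.

Let energy_finite0 :
  (nint mu (fun x => if (d' xi0 x < 3)%R then energy g' (v x) else 0)%R < +oo)%E.
Proof.
have [[_ uO _] _] := weak; have [K K0 gK] := growth_comparable.
pose h := (fun x => (G `|u x|)%:E) \_ Omega.
apply: le_lt_trans (_ : (K * q)%:E * \int[mu]_x h x < +oo)%E; last first.
  by rewrite lte_mul_pinfty ?lee_fin ?mulr_ge0 ?(ltW K0) ?(ltW q0)// -integral_mkcond.
have h0 x : (0 <= h x)%E by rewrite /h /patch; case: ifP; rewrite // lee_fin G_ge0.
apply: (nint_le_null mZ Z0) => //.
- apply: measurable_fun_ifT => //.
    apply: measurable_fun_ltr; last exact: measurable_cst.
    by apply: measurable_funM; [exact: md1|exact: measurable_cst].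
  by apply: measurableT_comp mv; exact: (measurable_energy pg').
- by rewrite mulr_gt0.
- by move=> x; case: ifP => // _; exact: (energy_ge0 pg').
move=> x Zx; case: ifPn => [xd|_]; last by rewrite mule_ge0// lee_fin mulr_ge0 ?ltW.
have xB := scaled_ball xd; rewrite /h patchE (mem_set (ball_Omega xB)).
rewrite (memNset Zx) -EFinM lee_fin.
have u0 : 0 <= u x by exact: uZ.
rewrite ger0_norm// -mulrA; apply: le_trans (_ : K * energy g0 (u x) <= _).
  by rewrite /energy mulrCA ler_wpM2l// (gK _ u0).1.
by rewrite ler_wpM2l ?(ltW K0)// G_ge.
Qed.

Let energy_finite : (nint (mu \x mu)%E
  (fun z => if (d' xi0 z.1 < 3)%R then energy_density s Q d' g' v z else 0)%R < +oo)%E.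
Proof.
have [[_ _ uC] _] := weak.
pose h := (fun z : heis R n * heis R n =>
  (G (`|u z.1 - u z.2| / heis_dist z.2 z.1 `^ s) / heis_dist z.2 z.1 `^ Q)%:E)
  \_ (crossed Omega).
have h0 z : (0 <= h z)%E.
  rewrite /h /patch; case: ifP; rewrite // lee_fin mulr_ge0 ?invr_ge0 ?powR_ge0//.
  by rewrite G_ge0// mulr_ge0 ?invr_ge0 ?powR_ge0.
have k0 : 0 < r `^ s * r `^ Q by rewrite mulr_gt0 ?powR_gt0.
apply: le_lt_trans (_ : (r `^ s * r `^ Q * q)%:E * \int[mu \x mu]_z h z < +oo)%E; last first.
  by rewrite lte_mul_pinfty ?lee_fin ?mulr_ge0 ?(ltW q0) ?powR_ge0// -integral_mkcond.
apply: (nint_le_null mZZ.1 mZZ.2) => //.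
- apply: measurable_fun_ifT => //.
    apply: measurable_fun_ltr; last exact: measurable_cst.
    by apply: (measurable_fst_comp (f := d' xi0)); exact: measurable_funM.
  by apply: energy_density_measurable => //; exact: (measurable_energy pg').
- by rewrite mulr_gt0.
- move=> z; case: ifP => // _; rewrite mulr_ge0 ?invr_ge0 ?powR_ge0//.
  exact: (energy_ge0 pg').
move=> z Zz; case: ifPn => [zd|_]; last by rewrite mule_ge0// lee_fin mulr_ge0 ?ltW.
have /not_orP[Z1 Z2] : ~ (Z z.1 \/ Z z.2).
  by move=> [Z1|Z2]; apply: Zz; [left|right].
have zO : crossed Omega z by left; split => //; apply: ball_Omega; exact: scaled_ball.
rewrite /h patchE (mem_set zO) -EFinM lee_fin energy_density_scaled -[leRHS]mulrA.
rewrite (memNset Z1) (memNset Z2).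
rewrite ler_pM2l// mulrA (heis_distC z.2) ler_wpM2r ?invr_ge0 ?powR_ge0//.
by apply: G_ge; rewrite mulr_ge0 ?invr_ge0 ?powR_ge0.
Qed.

(** The unit-scale ball of radius [3] becomes a ball of radius [3 r], inside the compactly contained
    ball of radius [4 r]; this gives the compact support. *)
Let test_function (psi : heis R n -> R) : measurable_fun setT psi ->
  (forall x, 3 <= d' xi0 x -> psi x = 0) ->
  (nint mu (fun x => energy g' `|psi x|)%R < +oo)%E ->
  (nint (mu \x mu)%E (energy_density s Q d' g' psi) < +oo)%E ->
  HW s g Omega psi /\ compactly_contained [set xi | psi xi != 0] Omega.
Proof.
move=> mpsi psi0 e0 e1; have [K K0 gK] := growth_comparable; split; [split|].
- move=> Y mY; exists (psi @^-1` Y).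
    by rewrite -[_ @^-1` _]setTI; exact: mpsi.
  by exists set0; [exact: negligible_set0|rewrite setU0].
- rewrite integral_mkcond.
  apply: (integral_lt_null (K := p^-1 * K) measurable0 (measure0 mu)) e0 => //.
  + apply: measurableT_comp (measurable_energy pg') _.
    exact: measurableT_comp (@normr_measurable R setT) mpsi.
  + by rewrite mulr_ge0 ?invr_ge0 ?(ltW p0) ?(ltW K0).
  + by move=> x; exact: (energy_ge0 pg').
  + by move=> x; rewrite patchE; case: ifP; rewrite // lee_fin G_ge0.
  move=> x _; rewrite patchE; case: ifP => _; rewrite lee_fin; last first.
    by rewrite !mulr_ge0 ?invr_ge0 ?(ltW p0) ?(ltW K0).
  apply: le_trans (G_le (normr_ge0 _)) _; rewrite -mulrA ler_pM2l ?invr_gt0//.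
  by rewrite /energy mulrCA ler_wpM2l// (gK _ (normr_ge0 _)).2.
- rewrite integral_mkcond.
  have k0 : 0 < r `^ s * r `^ Q by rewrite mulr_gt0 ?powR_gt0.
  apply: (integral_lt_null (K := p^-1 / (r `^ s * r `^ Q)) measurable0
    (measure0 (mu \x mu)%E)) e1 => //.
  + by apply: energy_density_measurable => //; exact: (measurable_energy pg').
  + by rewrite mulr_ge0 ?invr_ge0 ?(ltW p0) ?(ltW k0).
  + move=> z; rewrite mulr_ge0 ?invr_ge0 ?powR_ge0//; exact: (energy_ge0 pg').
  + move=> z; rewrite patchE; case: ifP; rewrite // lee_fin.
    by rewrite mulr_ge0 ?invr_ge0 ?powR_ge0// G_ge0// mulr_ge0 ?invr_ge0 ?powR_ge0.
  move=> z _; rewrite patchE energy_density_scaled mulrA mulfVK ?gt_eqF//.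
  have t0 : 0 <= `|psi z.1 - psi z.2| / heis_dist z.1 z.2 `^ s.
    by rewrite mulr_ge0 ?invr_ge0 ?powR_ge0.
  case: ifP => _; rewrite lee_fin.
    by rewrite (heis_distC z.2) mulrA ler_wpM2r ?invr_ge0 ?powR_ge0// G_le.
  by rewrite !mulr_ge0 ?invr_ge0 ?powR_ge0 ?(ltW p0).
have sB : [set xi | psi xi != 0] `<=` heis_ball xi0 (4 * r).
  move=> x /= px; apply: scaled_ball; rewrite ltNge; apply/negP => /psi0 h.
  by rewrite h eqxx in px.
have cB := closure_subset sB; split; last exact: subset_trans cB sub.2.
exact: subclosed_compact (@closed_closure _ _) sub.1 cB.
Qed.

Let weak_scaled (psi : heis R n -> R) : measurable_fun setT psi ->
  (forall x, 3 <= d' xi0 x -> psi x = 0) ->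
  (nint mu (fun x => energy g' `|psi x|)%R < +oo)%E ->
  (nint (mu \x mu)%E (energy_density s Q d' g' psi) < +oo)%E ->
  nint (mu \x mu)%E (fun z => Num.max (flux s Q d' g' v psi z) 0)%R =
  nint (mu \x mu)%E (fun z => Num.max (- flux s Q d' g' v psi z) 0)%R.
Proof.
move=> mpsi psi0 e0 e1; have [hw cc] := test_function mpsi psi0 e0 e1.
have [_ /(_ psi hw cc)] := weak.
rewrite /weak_form integral_mkcond; set w := (X in (\int[_]_x X x)%E).
rewrite integralE => W0.
have A0 : (0 <= \int[mu \x mu]_x w^\+ x)%E by apply: integral_ge0 => z _; exact: funepos_ge0.
have B0 : (0 <= \int[mu \x mu]_x w^\- x)%E by apply: integral_ge0 => z _; exact: funeneg_ge0.
have AB : (\int[mu \x mu]_x w^\+ x = \int[mu \x mu]_x w^\- x)%E.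
  (* An infinite integral of either part would make the difference infinite, also when both are
     infinite; so the weak equation forces both to be finite and equal. *)
  move: (integral _ _ _) (integral _ _ _) W0 A0 B0 => [a| |] [b| |] //= + _ _.
  by rewrite -EFinB => -[/eqP]; rewrite subr_eq0 => /eqP ->.
have k0 : 0 < r `^ (Q + s) by exact: powR_gt0.
have mf : measurable_fun setT (flux s Q d' g' v psi) by exact: flux_measurable.
have wE z : ~ (Z `*` setT `|` setT `*` Z) z ->
    w z = (flux s Q d' g' v psi z / r `^ (Q + s))%:E.
  move=> Zz; have /not_orP[Z1 Z2] : ~ (Z z.1 \/ Z z.2).
    by move=> [Z1|Z2]; apply: Zz; [left|right].
  rewrite /w patchE flux_scaled [r `^ _ * _]mulrC mulfK ?gt_eqF//.
  rewrite (memNset Z1) (memNset Z2).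
  case: ifPn => //; rewrite notin_setE => /not_orP[n1 n2].
  (* Off [crossed Omega] neither point is in [Omega], so the test function vanishes at both and so
     does the flux. *)
  have psi_out x : ~ Omega x -> psi x = 0.
    move=> Ox; apply: psi0; rewrite leNgt; apply/negP => h; apply: Ox.
    exact/ball_Omega/scaled_ball.
  rewrite !psi_out ?subrr ?mulr0 ?mul0r//.
    by move=> h; apply: n2; split.
  by move=> h; apply: n1; split.
rewrite (nint_pos_null mZZ.1 mZZ.2 mf k0 (h := (w^\+)%E)); last 2 first.
- by move=> z; exact: funepos_ge0.
- by move=> z /wE wz; rewrite funeposE wz EFin_max.
rewrite (nint_pos_null mZZ.1 mZZ.2 (measurableT_comp (@oppr_measurable R setT) mf) k0
  (h := (w^\-)%E)); last 2 first.
- by move=> z; exact: funeneg_ge0.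
- by move=> z /wE wz; rewrite funenegE wz -EFinN EFin_max mulNr.
by rewrite AB.
Qed.

Lemma scaled_solution : solution mu p q s Q La d' c' g' xi0 v.
Proof.
split; [exact: regular_scaled_dist|exact: pg'|exact: mv| |exact: energy_finite0|
  exact: energy_finite|exact: weak_scaled].
move=> x; rewrite ltr_pdivrMr// => xd; case: ifPn => //.
by rewrite notin_setE => Zx; exact: uZ.
Qed.

(** Outside the ball of radius [r] one has [1 + |x| <= K1 d(xi0, x)], so the weights of the tail are
    controlled by those in [Lgs]. Finiteness is what makes [fine] of the tail its true value. *)
Lemma tail_fin : Lgs s g u -> (tail s g (u^\-)%R xi0 r < +oo)%E.
Proof.
move=> [_ uL]; pose K1 : R := (1 + heis_norm xi0) / r + 1.
have K11 : 1 <= K1 by rewrite lerDr divr_ge0 ?addr_ge0 ?heis_norm_ge0 ?(ltW r0).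
have K10 : 0 < K1 by exact: lt_le_trans K11.
have normE x : @heis_norm R n x = heis_dist 0 x.
  by rewrite /heis_dist /heis_inv oppr0 heis_mul0g.
have nK x : r <= heis_dist xi0 x -> 1 + heis_norm x <= K1 * heis_dist xi0 x.
  move=> rx; apply: le_trans (_ : 1 + heis_norm xi0 + heis_dist xi0 x <= _).
    by rewrite -addrA lerD2l !normE; exact: heis_dist_triangle.
  rewrite /K1 mulrDl mul1r lerD2r mulrAC -mulrA ler_peMr ?addr_ge0 ?heis_norm_ge0//.
  by rewrite ler_pdivlMr ?mul1r.
(* Shifting the distance by [1] turns [tail_density] into the integrand of [tail]. *)
pose f x := if r <= heis_dist xi0 x then
  tail_density s Q (fun a b => heis_dist a b - 1) g0 xi0 (negpart v) x else 0.
have fE x : f x = if r <= heis_dist xi0 x then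
    g0 (negpart v x / heis_dist xi0 x `^ s) / heis_dist xi0 x `^ (Q + s) else 0.
  by rewrite /f /tail_density [1 + _]addrC subrK.
have mf : measurable_fun setT f.
  apply: measurable_fun_ifT => //; first exact: measurable_fun_ler.
  apply: tail_density_measurable; first exact: measurable_funB.
    exact: (measurable_pg pg0).
  by apply: measurable_maxr0; exact: measurableT_comp mv.
have f0 x : 0 <= f x.
  by rewrite fE; case: ifP => // _; rewrite mulr_ge0 ?invr_ge0 ?powR_ge0.
rewrite /tail integral_mkcond.
apply: (integral_lt_null (K := 1) (f := f) mZ Z0) => //.
- move=> x; rewrite patchE; case: ifP => // _; rewrite lee_fin.
  rewrite mulr_ge0 ?invr_ge0 ?powR_ge0// g_ge0//.
  by rewrite mulr_ge0 ?invr_ge0 ?powR_ge0.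
- move=> x Zx; rewrite mul1r patchE; case: ifPn; last by rewrite lee_fin.
  rewrite inE /heis_ball/= => /negP; rewrite -leNgt => rx.
  rewrite fE rx lee_fin /negpart (memNset Zx).
  rewrite max_l; last by rewrite mulr_ge0 ?invr_ge0 ?powR_ge0// le_max lexx orbT.
  by rewrite ger0_norm// le_max lexx orbT.
pose K := q / p * (K1 `^ s) `^ (q - 1) * K1 `^ (Q + s).
have K0 : 0 < K by rewrite /K !mulr_gt0 ?powR_gt0 ?invr_gt0.
pose h x := (g (`|u x| / (1 + heis_norm x) `^ s) / (1 + heis_norm x) `^ (Q + s))%:E.
have h0 x : (0 <= h x)%E.
  rewrite lee_fin mulr_ge0 ?invr_ge0 ?powR_ge0// g_ge0//.
  by rewrite mulr_ge0 ?invr_ge0 ?powR_ge0.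
apply: le_lt_trans (nint_le_null (h := h) mZ Z0 mf K0 f0 h0 _) _; last first.
  by rewrite lte_mul_pinfty ?lee_fin ?(ltW K0).
move=> x Zx; rewrite -EFinM lee_fin fE; case: ifPn => [rx|_]; last first.
  by rewrite mulr_ge0 ?(ltW K0)//; have := h0 x; rewrite lee_fin.
have a0 : 0 < heis_dist xi0 x by exact: lt_le_trans rx.
have b0 : 0 < 1 + heis_norm x by rewrite ltr_pwDl ?heis_norm_ge0.
have inv_le (e : R) : 0 <= e ->
    (heis_dist xi0 x `^ e)^-1 <= K1 `^ e / (1 + heis_norm x) `^ e.
  move=> e0; have := inv_powR_le b0 (nK _ rx) e0.
  by rewrite (powRM _ (ltW K10) (ltW a0)) invfM (ler_pdivrMl _ _ (powR_gt0 _ K10)).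
rewrite /K mulrACA.
have t0 : 0 <= `|u x| / (1 + heis_norm x) `^ s by rewrite mulr_ge0 ?invr_ge0 ?powR_ge0.
apply: ler_pM; rewrite ?invr_ge0 ?powR_ge0//; last first.
  by apply: inv_le; rewrite addr_ge0 ?(ltW s0).
rewrite (_ : g (`|u x| / (1 + heis_norm x) `^ s) = g0 (`|u x| / (1 + heis_norm x) `^ s)); last first.
  by rewrite max_l.
have K1s : 1 <= K1 `^ s by rewrite -(powRr0 K1) ler_powR// ltW.
apply: le_trans (pg_upper pg0 K1s t0); apply: (pg_homo pg0).
rewrite /negpart (memNset Zx) mulrCA.
apply: ler_pM; rewrite ?invr_ge0 ?powR_ge0//; first by rewrite le_max lexx orbT.
  by rewrite ge_max normr_ge0 andbT -normrN ler_norm.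
exact: inv_le (ltW s0).
Qed.

(** Up to the null set, the negative part lives at distance at least [4 r], hence in the domain of
    the tail; there the weight with [r + d] is no larger than the one with [d], and the rescaling
    contributes [r ^ (Q + s)]. *)
Lemma scaled_tail_le : Lgs s g u ->
  (nint mu (tail_density s Q d' g' xi0 (negpart v)) <=
   (r `^ (Q + s) * fine (tail s g (u^\-)%R xi0 r))%:E)%E.
Proof.
move=> uL; have tfin := tail_fin uL.
pose h := (fun x => (g (`|u^\- x| / heis_dist xi0 x `^ s) /
  heis_dist xi0 x `^ (Q + s))%:E) \_ (~` heis_ball xi0 r).
have h0 x : (0 <= h x)%E.
  rewrite /h patchE; case: ifP => // _; rewrite lee_fin.
  rewrite mulr_ge0 ?invr_ge0 ?powR_ge0// g_ge0//.
  by rewrite mulr_ge0 ?invr_ge0 ?powR_ge0.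
have tE : (tail s g (u^\-)%R xi0 r = \int[mu]_x h x)%E by rewrite /tail integral_mkcond.
have t0 : (0 <= tail s g (u^\-)%R xi0 r)%E by rewrite tE integral_ge0.
rewrite EFinM fineK; last by rewrite ge0_fin_numE.
have N0 x : 0 <= negpart v x by rewrite le_max lexx orbT.
rewrite tE; apply: (nint_le_null mZ Z0) => //.
- apply: tail_density_measurable => //; first exact: measurable_funM.
  by apply: measurable_maxr0; exact: measurableT_comp mv.
- exact: powR_gt0.
- by move=> x; rewrite mulr_ge0 ?invr_ge0 ?powR_ge0.
move=> x Zx; have [xd|xd] := ltP (heis_dist xi0 x) (4 * r).
  rewrite /tail_density /negpart (memNset Zx).
  rewrite max_r ?oppr_le0; last exact: uZ.
  by rewrite mul0r (pg_eq0 pg')// mul0r mule_ge0// lee_fin powR_ge0.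
have rx : r <= heis_dist xi0 x by apply: le_trans xd; rewrite ler_peMl ?(ltW r0)// ler1n.
rewrite /h patchE mem_set; last by rewrite /heis_ball/= => /(le_lt_trans rx); rewrite ltxx.
have a0 : 0 < heis_dist xi0 x by exact: lt_le_trans rx.
have e1 : 1 + d' xi0 x = (r + heis_dist xi0 x) / r by rewrite mulrDl divff ?gt_eqF.
have b0 : 0 < r + heis_dist xi0 x by rewrite addr_gt0.
rewrite -EFinM lee_fin /tail_density e1 !powRM ?invr_ge0 ?(ltW r0) ?(ltW b0)//.
rewrite !powRV ?(ltW r0)// /scaled_growth scaled_quot invf_div mulrCA.
rewrite ler_pM2l ?powR_gt0//; apply: ler_pM; rewrite ?invr_ge0 ?powR_ge0//.
  rewrite (_ : g (`|u^\- x| / heis_dist xi0 x `^ s) = g0 (`|u^\- x| / heis_dist xi0 x `^ s)).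
    2: by rewrite max_l ?mulr_ge0 ?invr_ge0 ?powR_ge0.
  apply: (pg_homo pg0).
  rewrite /negpart (memNset Zx).
  rewrite ger0_norm ?le_max ?lexx ?orbT// ler_wpM2l ?le_max ?lexx ?orbT//.
  by apply: inv_powR_le (ltW s0) => //; rewrite lerDr ltW.
apply: inv_powR_le => //; first by rewrite lerDr ltW.
by rewrite addr_ge0 ?(ltW s0).
Qed.

End rescaling.

(** * Back to the original scale, with essential suprema and infima *)

Theorem theorem1p3 (R : realType) (n : nat) (p q s : R) :
  (1 <= n)%N -> 0 < s < 1 ->
  exists C : R, 0 < C /\
  forall (g : R -> R) (Omega : set (heis R n)) (u : heis R n -> R)
    (xi0 : heis R n) (r : R),
    growth_function p q g ->
    bounded_domain Omega ->
    HW s g Omega u -> Lgs s g u ->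
    weak_solution s g Omega u ->
    0 < r ->
    compactly_contained (heis_ball xi0 (4 * r)) Omega ->
    {ae heis_measure R n, forall xi, heis_ball xi0 (4 * r) xi -> 0 <= u xi} ->
    (ess_sup_on (heis_ball xi0 r) u <=
     C%:E * (ess_inf_on (heis_ball xi0 r) u +
             (r `^ s * growth_inv g (r `^ s * fine (tail s g u^\- xi0 r)))%:E))%E.
Proof.
(* The constant precedes [g], so [1 < p] and [p <= q] cannot yet be read off a growth function; if
   one of them fails, there is no such [g] and any constant will do. *)
move=> _ s01; have [p1|p1] := ltP 1 p; last first.
  exists 1; split=> // g Omega u xi0 r /growth_p_gt1; by rewrite ltNge p1.
have [pq|pq] := leP p q; last first.
  by exists 1; split=> // g Omega u xi0 r /growth_pq; rewrite leNgt pq.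
have [c0 c00 ballc] := @heis_ball_ge R n.
have p0 : 0 < p by exact: lt_trans p1.
have qp0 : 0 <= q / p by rewrite divr_ge0 ?(ltW p0) ?(ltW (lt_le_trans p0 pq)).
pose La : R := 1 + q / p + 2 ^+ (n + n).+1 / c0.
have k0 : 0 <= 2 ^+ (n + n).+1 / c0 :> R by rewrite divr_ge0 ?exprn_ge0 ?(ltW c00).
have La1 : 1 <= La by rewrite /La -addrA lerDl addr_ge0.
have Lapq : q / p <= La by rewrite /La -addrA addrCA lerDl addr_ge0.
have Lac : 2 ^+ (n + n).+1 <= La * c0.
  by rewrite -ler_pdivrMr// /La lerDr addr_ge0.
have La0 : 0 < La by exact: lt_le_trans La1.
have Q0 : 0 < (heis_dim n)%:R :> R by rewrite ltr0n /heis_dim addn2.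
have [C1 C10 HC] := harnack (heis_measure R n) p1 pq s01 Q0 La1.
(* The tail is at most [r ^ Q g b], while [harnack] asks for [c0 r ^ Q] times the rescaled growth at
   [m]. As [ka ^ (p - 1) >= La / c0], multiplying the level by [ka] gains the missing factor
   [1 / c0]. *)
pose ka := (1 + La / c0) `^ (p - 1)^-1.
have kac : 1 <= 1 + La / c0 by rewrite lerDl divr_ge0 ?(ltW La0) ?(ltW c00).
have ka1 : 1 <= ka by rewrite /ka -[X in X <= _](powRr0 (1 + La / c0)) ler_powR// invr_ge0 subr_ge0 ltW.
have kaE : ka `^ (p - 1) = 1 + La / c0.
  rewrite /ka -powRrM mulVf ?powRr1 ?(le_trans ler01)//.
  by rewrite gt_eqF// subr_gt0.
have ka0 : 0 < ka by exact: lt_le_trans ka1.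
exists (C1 * ka); split; first by rewrite mulr_gt0.
move=> g Omega u xi0 r gG _ _ uL weak r0 sub upos.
have [[mu_u _ _] _] := weak.
have [Z [mZ Z0 NZ mv]] := borel_representative mu_u upos.
have uZ x : ~ Z x -> heis_dist xi0 x < 4 * r -> 0 <= u x.
  by move=> Zx xd; apply: contrapT => ux; apply: Zx; apply: NZ => /(_ xd).
have sol := scaled_solution r0 gG La1 Lapq c00 Lac ballc mZ Z0 mv uZ sub weak.
have tl := scaled_tail_le s01 r0 gG Lapq mZ Z0 mv uZ uL.
have pg' := power_growth_scaled s r0 gG Lapq.
have tT : 0 <= fine (tail s g u^\- xi0 r).
  apply: fine_ge0; apply: integral_ge0 => x _; rewrite lee_fin.
  rewrite mulr_ge0 ?invr_ge0 ?powR_ge0//.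
  have := pg_ge0 (growth_function_power gG) (`|u^\- x| / heis_dist xi0 x `^ s).
  by rewrite max_l// mulr_ge0 ?invr_ge0 ?powR_ge0.
move: (fine _) tT tl => T T0 tl.
have [b0 gb] := growth_invK gG (mulr_ge0 (powR_ge0 r s) T0).
set b := growth_inv g _ in b0 gb *.
have rs0 : 0 < r `^ s by exact: powR_gt0.
set I := ess_inf_on _ u.
pose v x := if x \in Z then 0 else u x.
have ballE x : (scaled_dist r xi0 x < 1) = (heis_dist xi0 x < r).
  by rewrite ltr_pdivrMr// mul1r.
have Zneg : (heis_measure R n).-negligible Z by apply/negligibleP.
have vE x : ~ Z x -> v x = u x by move=> Zx; rewrite /v memNset.
have Ige (m : R) : {ae heis_measure R n, forall x, heis_dist xi0 x < r -> m <= u x} ->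
    (m%:E <= I)%E.
  move=> mu_m; apply/ess_infP; apply: filterS mu_m => x mx; rewrite /patch.
  by case: ifPn => [|_]; rewrite ?leey// inE /heis_ball/= lee_fin.
have I0 : (0%:E <= I)%E.
  apply: Ige; apply: filterS upos => x ux xr; apply: ux.
  by rewrite /heis_ball/=; apply: lt_le_trans xr _; rewrite ler_peMl ?(ltW r0)// ler1n.
have mball : measurable_fun setT (fun x : heis R n => scaled_dist r xi0 x < 1).
  apply: measurable_fun_ltr; last exact: measurable_cst.
  exact: regular_dist1 (sol_metric sol).
have C0 : 0 < C1 * ka by rewrite mulr_gt0.
move: I Ige I0 => [i| |] Ige I0; last by [].
  2: by rewrite addye// gt0_muley ?lte_fin// leey.
rewrite lee_fin in I0; apply/lee_addgt0Pr => e e0.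
(* The excess over [ka (i + r ^ s b)] makes [m] positive and strictly larger than the essential
   infimum; after multiplication by [C1] it contributes exactly [e]. *)
pose m := ka * (i + r `^ s * b) + e / C1.
have rb0 : 0 <= r `^ s * b by rewrite mulr_ge0 ?(ltW rs0).
have im : ka * (i + r `^ s * b) < m by rewrite ltrDl divr_gt0.
have le_ka x : 0 <= x -> x <= i + r `^ s * b -> x < m.
  move=> x0 xi; apply: le_lt_trans im; apply: le_trans xi _.
  by rewrite ler_peMl// addr_ge0.
have m0 : 0 < m by apply: le_ka; rewrite ?addr_ge0.
have /(HC _ _ _ _ _ m sol m0) : (nint (heis_measure R n) (tail_density s (heis_dim n)%:R
    (scaled_dist r) (scaled_growth s r g) xi0 (negpart v)) <=
    (c0 * r ^+ heis_dim n * scaled_growth s r g m)%:E)%E.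
  apply: le_trans tl _; rewrite lee_fin powRD; last by rewrite (gt_eqF r0) implybT.
  rewrite powR_mulrn ?(ltW r0)// -mulrA -gb [c0 * _]mulrC -mulrA.
  rewrite ler_pM2l ?exprn_gt0//.
  have e1 : g b = scaled_growth s r g (r `^ s * b).
    by rewrite /scaled_growth [_ * b]mulrC mulfK ?gt_eqF// max_l.
  have := pg_lower pg' ka1 rb0; rewrite kaE -e1 => h.
  have {}h : La / c0 * g b <= La * scaled_growth s r g m.
    apply: le_trans (_ : La * scaled_growth s r g (ka * (r `^ s * b)) <= _); last first.
      rewrite ler_pM2l//; apply: (pg_homo pg'); apply: le_trans (ltW im).
      by rewrite ler_pM2l// lerDr.
    by apply: le_trans h; rewrite ler_wpM2r ?lerDr// e1 (pg_ge0 pg').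
  by move: h; rewrite -mulrA ler_pM2l// ler_pdivrMl.
have mset (f : heis R n -> bool) : measurable_fun setT f ->
    measurable [set x | (scaled_dist r xi0 x < 1) && f x].
  by move=> mf; apply: measurable_pred; exact: measurable_and.
(* Otherwise [m] would be an essential lower bound on the ball, although [m > i]. *)
have nn : heis_measure R n [set x | (scaled_dist r xi0 x < 1) && (v x < m)] != 0%E.
  apply/eqP => h0; have : (m%:E <= i%:E)%E.
    apply: Ige; apply: (@negligibleS _ _ _ _ (Z `|` [set x |
       (scaled_dist r xi0 x < 1) && (v x < m)])).
      move=> x /= h; have [Zx|Zx] := pselect (Z x); [by left|right].
      rewrite vE// ballE; apply: contrapT => /negP h2; apply: h => xr.
      by move: h2; rewrite xr/= -leNgt.
    apply: negligibleU Zneg _; apply/negligibleP => //.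
    by apply: mset; exact: measurable_fun_ltr.
  by rewrite lee_fin leNgt le_ka// lerDl.
move=> /(_ nn) h0; apply/ess_supP; apply: (@negligibleS _ _ _ _ (Z `|` [set x |
    (scaled_dist r xi0 x < 1) && (C1 * m < v x)])).
  move=> x /= h; have [Zx|Zx] := pselect (Z x); [by left|right].
  rewrite vE// ballE; apply: contrapT => /negP h2; apply: h; rewrite /patch.
  case: ifPn => [|_]; last by rewrite leNye.
  rewrite inE /heis_ball/= => xr; move: h2; rewrite xr/= -leNgt => h2.
  rewrite -(EFinD i) -(EFinM (C1 * ka)) -EFinD lee_fin; apply: le_trans h2 _.
  by rewrite /m mulrDr mulrA [C1 * (e / C1)]mulrC divfK ?gt_eqF.
apply: negligibleU Zneg _; apply/negligibleP => //.
by apply: mset; exact: measurable_fun_ltr.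
Qed.
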